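(* Let $A$ be a bounded double complex over a field $K$. 1. Let $r\ge 1$. Both Frölicher spectral sequences of $A$ degenerate at page $r$ if and only if every even-length zigzag shape $S$ with $\operatorname{mult}_S(A)\neq 0$ has length strictly less than $2r$. 2. Let $d,k\in\mathbb{Z}$, put $H:=H^d_{dR}(A)$ and $H^{p,q}:=F_1^pH\cap F_2^qH$. Then $H$ carries a pure Hodge structure of weight $k$, i.e. $H=\bigoplus_{p+q=k}H^{p,q}$, if and only if all odd zigzag shapes of the form $S_d^{p,q}$ with nonzero multiplicity in $A$ satisfy $p+q=k$; equivalently, all zigzags contributing to $H_{dR}^d(A)$ have length $2|d-k|+1$ and are concentrated in total degrees $d$ and $d+\operatorname{sgn}(d-k)$. Further, the spaces $H^{p,q}$ have the following description. If $p+q\ge d$, then $H^{p,q}$ is the set of classes in $H$ that admit, for every $(r,s)\in\{(d-q,q),(d-q+1,q-1),\dots,(p,d-p)\}$, a representative $\omega\in A^{r,s}$. If $p+q\le d$, then $H^{p,q}$ is the set of classes in $H$ that admit a representative $\omega=\sum_{j=p}^{d-q}\omega_{j,d-j}$ with $\omega_{j,d-j}\in A^{j,d-j}$. If the involved quantities are finite, the degeneration in 1. is equivalent to the equality $\sum_{p,q\in\mathbb{Z}}\dim {}_iE_r^{p,q}(A)=\sum_{m\in\mathbb{Z}}b_m$ for $i=1,2$, and the condition in 2. is equivalent to $b_d=\sum_{p+q=k}b_d^{p,q}$, where $b_m:=\dim H^m_{dR}(A)$ and $b_d^{p,q}:=\dim\operatorname{gr}_{F_1}^p\operatorname{gr}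_{F_2}^qH^d_{dR}(A)$.
   Context: A double complex over a field $K$ is a bigraded $K$-vector space $A=\bigoplus_{p,q\in\mathbb{Z}}A^{p,q}$ with endomorphisms $\partial_1,\partial_2$ of bidegree $(1,0)$ and $(0,1)$ satisfying $\partial_1^2=\partial_2^2=0$ and $\partial_1\partial_2+\partial_2\partial_1=0$. It is bounded if $A^{p,q}=0$ for all but finitely many $(p,q)$. A shape is one of the following finite subsets of $\mathbb{Z}^2$; its length is its number of elements. - Square shapes: $S^{p,q}=\{(p,q),(p-1,q),(p,q-1),(p-1,q-1)\}$. - Even zigzag shapes ($r\ge 1$, length $2r$): $S_{1,r}^{p,q}=\{(p+j,q-j),(p+j+1,q-j)\mid 0\le j\le r-1\}$ and $S_{2,r}^{p,q}=\{(p-j,q+j),(p-j,q+j+1)\mid 0\le j\le r-1\}$. - Odd zigzag shapes (length $2|p+q-d|+1$): if $p+q\le d$, $S_d^{p,q}=\{(j,d-j)\mid p\le j\le d-q\}\cup\{(j,d+1-j)\mid p+1\le j\le d-q\}$; if $p+q> d$, $S_d^{p,q}=\{(j,d-j)\mid d-q\le j\le p\}\cup\{(j,d-1-j)\mid d-q\le j\le p-1\}$. For a shape $S$, $C(S)$ is the (unique up to isomorphism) double complex that is one-dimensional in the bidegrees of $S$, zero elsewhere, with every component of $\partial_1,\partial_2$ between two bidegrees of $S$ an isomorphism. Every bounded double complex is isomorphic to $\bigoplus_S C(S)^{\oplus\operatorname{mult}_S(A)}$ for unique cardinals $\operatorname{mult}_S(A)$. The zigzags contributing to $H^d_{dR}(A)$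 are those zigzags occurring in such a decomposition with nonzero $H^d_{dR}$; these are the ones of shape $S_d^{p,q}$. $H^d_{dR}(A)$ is the cohomology of the total complex $\bigoplus_{p+q=d}A^{p,q}$ with differential $\partial_1+\partial_2$. $F_1,F_2$ are the descending (Hodge) filtrations on $H_{dR}^d(A)$ induced by $F_1^m=\bigoplus_{p\ge m}A^{p,q}$ and $F_2^m=\bigoplus_{q\ge m}A^{p,q}$. The Frölicher spectral sequences are those of these two filtrations: ${}_1E_1^{p,q}=H_{\partial_2}^{p,q}(A)\Rightarrow (H^{p+q}_{dR}(A),F_1)$ and ${}_2E_1^{p,q}=H_{\partial_1}^{p,q}(A)\Rightarrow(H^{p+q}_{dR}(A),F_2)$, with differentials ${}_1d_r$ of bidegree $(r,1-r)$ and ${}_2d_r$ of bidegree $(1-r,r)$. Degeneration at page $r$ means all differentials on pages $\ge r$ vanish. *)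

(* Defs.v *)
From HB Require Import structures.
From mathcomp Require Import all_boot all_order all_algebra.
From mathcomp Require Import finmap.
From mathcomp Require Import boolp classical_sets cardinality fsbigop.

Set Implicit Arguments.
Unset Strict Implicit.
Unset Printing Implicit Defensive.

Import Order.TTheory GRing.Theory Num.Theory.
Local Open Scope ring_scope.

Record subspace (K : fieldType) (V : lmodType K) := Subspace {
  in_sub :> V -> Prop;
  sub0 : in_sub 0;
  subZD : forall a x y, in_sub x -> in_sub y -> in_sub (a *: x + y) }.

Section SubspaceOps.
Context {K : fieldType} {V : lmodType K}.
Implicit Types (W : subspace V).

Lemma subD W x y : W x -> W y -> W (x + y).
Proof. by move=> Wx Wy; rewrite -[x]scale1r; apply: subZD. Qed.

Lemma subZ W a x : W x -> W (a *: x).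
Proof. by move=> Wx; rewrite -[_ *: _]addr0; apply: subZD => //; apply: sub0. Qed.

Lemma subN W x : W x -> W (- x).
Proof. by rewrite -scaleN1r; apply: subZ. Qed.

Lemma subB W x y : W x -> W y -> W (x - y).
Proof. by move=> Wx Wy; apply: subD => //; apply: subN. Qed.

Definition sub_null : subspace V.
Proof.
exists (fun x => x = 0) => // a x y -> ->.
by rewrite scaler0 addr0.
Defined.

Definition sub_full : subspace V.
Proof. by exists (fun=> True). Defined.

Definition sub_cap W1 W2 : subspace V.
Proof.
exists (fun x => W1 x /\ W2 x); first by split; apply: sub0.
by move=> a x y [? ?] [? ?]; split; apply: subZD.
Defined.

Definition sub_add W1 W2 : subspace V.
Proof.
exists (fun x => exists x1 x2, [/\ W1 x1, W2 x2 & x = x1 + x2]).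
  by exists 0, 0; split; rewrite ?addr0 //; apply: sub0.
move=> a _ _ [x1 [x2 [? ? ->]]] [y1 [y2 [? ? ->]]].
exists (a *: x1 + y1), (a *: x2 + y2).
by split; rewrite ?scalerDr 1?addrACA //; apply: subZD.
Defined.

(* The sum of the subspaces [W i], for [i] satisfying [P]. *)
Definition sub_sum (I : Type) (P : I -> Prop) (W : I -> subspace V) :
  subspace V.
Proof.
exists (fun x => exists s : seq V,
  (forall v, v \in s -> exists i, P i /\ W i v) /\ x = \sum_(v <- s) v).
  by exists [::]; rewrite big_nil.
move=> a _ _ [s [Ws ->]] [t [Wt ->]].
exists ([seq a *: v | v <- s] ++ t); split; last first.
  by rewrite big_cat big_map /= scaler_sumr.
move=> v; rewrite mem_cat => /orP[/mapP[u /Ws[i [Pi Wu]] ->]|/Wt //].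
by exists i; split=> //; apply: subZ.
Defined.

(* [V] is the internal direct sum of the subspaces [W i]. *)
Definition direct_sum (I : eqType) (W : I -> subspace V) : Prop :=
  (forall x : V, sub_sum (fun=> True) W x) /\
  (forall (s : seq I) (w : I -> V), uniq s ->
     (forall i, i \in s -> W i (w i)) -> \sum_(i <- s) w i = 0 ->
     forall i, i \in s -> w i = 0).

Definition has_dim W (n : nat) : Prop :=
  exists e : 'I_n -> V, (forall i, W (e i)) /\
    forall x, W x -> exists! c : 'rV[K]_n, x = \sum_i c 0 i *: e i.

Definition fin_dim W : Prop := exists n, has_dim W n.

(* Only meaningful when [fin_dim W]; it is 0 otherwise. *)
Definition sdim W : nat := xget 0%N (has_dim W : set nat).

End SubspaceOps.

Arguments sub_null {K} V.
Arguments sub_full {K} V.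

Section SubspaceImage.
Context {K : fieldType} {U V : lmodType K} (f : {linear U -> V}).

Definition sub_im (W : subspace U) : subspace V.
Proof.
exists (fun y => exists x, W x /\ y = f x).
  by exists 0; rewrite linear0; split=> //; apply: sub0.
move=> a _ _ [x [Wx ->]] [y [Wy ->]].
by exists (a *: x + y); rewrite linearP; split=> //; apply: subZD.
Defined.

Definition sub_preim (W : subspace V) : subspace U.
Proof.
exists (fun x => W (f x)); first by rewrite linear0; apply: sub0.
by move=> a x y ? ?; rewrite linearP; apply: subZD.
Defined.

End SubspaceImage.

(* The vector space Z / (Z `&` B).  Its elements are chosen representatives,
   one in each coset; [sq_class x] is the class of x in Z (and, as a default
   value, 0 when x is not in Z + B). *)
Section Subquotient.
Context {K : fieldType} {V : lmodType K} (Z B : subspace V).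

Let z0 : V := xget 0 (fun y => Z y /\ B y).
Let canon (x : V) : V := xget z0 (fun y => Z y /\ B (y - x)).

Let z0P : Z z0 /\ B z0.
Proof.
rewrite /z0; case: xgetP => [y _ //|/(_ 0)[]].
by split; apply: sub0.
Qed.

Let canonZ x : Z (canon x).
Proof. by rewrite /canon; case: xgetP => [y _ []//|_]; case: z0P. Qed.

Let canonB x : Z x -> B (canon x - x).
Proof.
move=> Zx; rewrite /canon; case: xgetP => [y _ []//|/(_ x)[]].
by split=> //; rewrite subrr; apply: sub0.
Qed.

Let canon_eq x y : B (x - y) -> canon x = canon y.
Proof.
move=> Bxy; rewrite /canon; congr xget; apply/funext => z.
apply/propext; split=> -[Zz Bz]; split=> //.
  by rewrite -(subrKA x); apply: subD.
by rewrite -(subrKA y) -[y - x]opprB; apply: subB.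
Qed.

Let canonK x : canon (canon x) = canon x.
Proof.
have [[y [Zy Byx]]|nex] := pselect (exists y, Z y /\ B (y - x)).
  by rewrite -(canon_eq Byx); apply/canon_eq/canonB.
have -> : canon x = z0 by rewrite /canon; case: xgetP => // y _ ?; case: nex; exists y.
rewrite (_ : canon z0 = canon 0); last by apply: canon_eq; rewrite subr0; case: z0P.
have -> : canon 0 = z0.
  rewrite /canon (_ : (fun y => Z y /\ B (y - 0)) = (fun y => Z y /\ B y)).
    by rewrite /z0 /xget; case: pselect => // -[]; exists 0; split; apply: sub0.
  by apply/funext => y; rewrite subr0.
by [].
Qed.

Record subquot := Subquot {
  sq_repr : V;
  _ : `[< Z sq_repr /\ canon sq_repr = sq_repr >] }.

HB.instance Definition _ := [isSub for sq_repr].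
HB.instance Definition _ := [Choice of subquot by <:].

Definition sq_class (x : V) : subquot :=
  @Subquot (canon x) (asboolT (conj (canonZ x) (canonK x))).

Lemma sq_reprP (c : subquot) : Z (sq_repr c).
Proof. by case: c => x /= /asboolP[]. Qed.

Lemma sq_reprK (c : subquot) : sq_class (sq_repr c) = c.
Proof. by apply: val_inj; case: c => x /= /asboolP[]. Qed.

Lemma sq_class_eq x y : Z x -> Z y -> sq_class x = sq_class y <-> B (x - y).
Proof.
move=> Zx Zy; split=> [[exy]|/canon_eq exy]; last exact: val_inj.
have := subB (canonB Zy) (canonB Zx).
by rewrite exy opprB addrC subrKA.
Qed.

Let sq_classrK x : Z x -> B (x - sq_repr (sq_class x)).
Proof. by move=> /canonB /subN; rewrite opprB. Qed.

Let sq_add (c1 c2 : subquot) := sq_class (sq_repr c1 + sq_repr c2).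
Let sq_opp (c : subquot) := sq_class (- sq_repr c).
Let sq_scale (a : K) (c : subquot) := sq_class (a *: sq_repr c).

Let sq_addE x y : Z x -> Z y ->
  sq_add (sq_class x) (sq_class y) = sq_class (x + y).
Proof.
move=> Zx Zy; apply/sq_class_eq.
- by apply: subD; apply: sq_reprP.
- exact: subD.
by rewrite -opprB; apply: subN; rewrite opprD addrACA; apply: subD; apply: sq_classrK.
Qed.

Let sq_oppE x : Z x -> sq_opp (sq_class x) = sq_class (- x).
Proof.
move=> Zx; apply/sq_class_eq; [exact/subN/sq_reprP|exact: subN|].
by rewrite opprK addrC; apply: sq_classrK.
Qed.

Let sq_scaleE a x : Z x -> sq_scale a (sq_class x) = sq_class (a *: x).
Proof.
move=> Zx; apply/sq_class_eq; [exact/subZ/sq_reprP|exact: subZ|].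
by rewrite -scalerBr; apply: subZ; rewrite -opprB; apply/subN/sq_classrK.
Qed.

Let sq_ind (P : subquot -> Prop) :
  (forall x, Z x -> P (sq_class x)) -> forall c, P c.
Proof. by move=> Pc c; rewrite -[c]sq_reprK; apply/Pc/sq_reprP. Qed.

Let sq_addA : associative sq_add.
Proof.
elim/sq_ind => x Zx; elim/sq_ind => y Zy; elim/sq_ind => z Zz.
by rewrite !sq_addE ?addrA //; apply: subD.
Qed.

Let sq_addC : commutative sq_add.
Proof. by elim/sq_ind => x Zx; elim/sq_ind => y Zy; rewrite !sq_addE // addrC. Qed.

Let sq_add0 : left_id (sq_class 0) sq_add.
Proof. by elim/sq_ind => x Zx; rewrite sq_addE ?add0r //; apply: sub0. Qed.

Let sq_addN : left_inverse (sq_class 0) sq_opp sq_add.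
Proof. by elim/sq_ind => x Zx; rewrite sq_oppE ?sq_addE ?addNr //; apply: subN. Qed.

HB.instance Definition _ :=
  GRing.isZmodule.Build subquot sq_addA sq_addC sq_add0 sq_addN.

Let sq_scaleA a b c : sq_scale a (sq_scale b c) = sq_scale (a * b) c.
Proof.
elim/sq_ind: c => x Zx; rewrite !sq_scaleE ?scalerA //; exact: subZ.
Qed.

Let sq_scale1 : left_id 1 sq_scale.
Proof. by elim/sq_ind => x Zx; rewrite sq_scaleE ?scale1r. Qed.

Let sq_scaleDr : right_distributive sq_scale +%R.
Proof.
move=> a; elim/sq_ind => x Zx; elim/sq_ind => y Zy.
rewrite /GRing.add /= !(sq_scaleE, sq_addE) ?scalerDr //.
- exact: subZ.
- exact: subZ.
- exact: subD.
Qed.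

Let sq_scaleDl c : {morph sq_scale^~ c : a b / a + b}.
Proof.
move=> a b; elim/sq_ind: c => x Zx.
by rewrite {2}/GRing.add /= !(sq_scaleE, sq_addE) ?scalerDl //; apply: subZ.
Qed.

HB.instance Definition _ := GRing.Zmodule_isLmodule.Build K subquot
  sq_scaleA sq_scale1 sq_scaleDr sq_scaleDl.

Lemma sq_classP a x y : Z x -> Z y ->
  sq_class (a *: x + y) = a *: sq_class x + sq_class y.
Proof.
move=> Zx Zy; rewrite /GRing.add /GRing.scale /= sq_scaleE // sq_addE //.
exact: subZ.
Qed.

(* The classes of elements of [W `&` Z]. *)
Definition sq_induced (W : subspace V) : subspace subquot.
Proof.
exists (fun c => exists x, [/\ W x, Z x & c = sq_class x]).
  by exists 0; split=> //; apply: sub0.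
move=> a _ _ [x [Wx Zx ->]] [y [Wy Zy ->]].
by exists (a *: x + y); split; [exact: subZD|exact: subZD|rewrite sq_classP].
Defined.

End Subquotient.

Definition gr (K : fieldType) (V : lmodType K) (F : int -> subspace V)
  (m : int) : lmodType K := subquot (F m) (F (m + 1)).

(* [dc_comp A p q] is the component of bidegree (p, q). *)
Record dcomplex (K : fieldType) := DComplex {
  dc_sort :> lmodType K;
  dc_comp : int -> int -> subspace dc_sort;
  dc_direct : direct_sum (fun x : int * int => dc_comp x.1 x.2);
  dc_d1 : {linear dc_sort -> dc_sort};
  dc_d2 : {linear dc_sort -> dc_sort};
  dc_d1_bideg : forall p q x, dc_comp p q x -> dc_comp (p + 1) q (dc_d1 x);
  dc_d2_bideg : forall p q x, dc_comp p q x -> dc_comp p (q + 1) (dc_d2 x);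
  dc_d1d1 : forall x, dc_d1 (dc_d1 x) = 0;
  dc_d2d2 : forall x, dc_d2 (dc_d2 x) = 0;
  dc_anticomm : forall x, dc_d1 (dc_d2 x) + dc_d2 (dc_d1 x) = 0 }.

Definition bounded (K : fieldType) (A : dcomplex K) : Prop :=
  exists s : seq (int * int), forall p q, (p, q) \notin s ->
    forall x, dc_comp A p q x -> x = 0.

Definition dc_morphism (K : fieldType) (A B : dcomplex K)
    (f : {linear A -> B}) : Prop :=
  [/\ forall p q x, dc_comp A p q x -> dc_comp B p q (f x),
      forall x, f (dc_d1 A x) = dc_d1 B (f x)
    & forall x, f (dc_d2 A x) = dc_d2 B (f x)].

(* A is isomorphic to the direct sum of the double complexes [X i]: there are
   morphisms [X i -> A] that identify A with the direct sum. *)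
Definition iso_direct_sum (K : fieldType) (A : dcomplex K) (I : eqType)
    (X : I -> dcomplex K) : Prop :=
  exists f : forall i, {linear X i -> A},
    [/\ forall i, dc_morphism (f i), forall i, injective (f i)
      & direct_sum (fun i => sub_im (f i) (sub_full (X i)))].

Local Open Scope fset_scope.
Local Open Scope ring_scope.

Definition zrange (a b : int) : seq int :=
  [seq a + i%:Z | i <- iota 0 (absz (Num.max 0 (b + 1 - a)))].

Lemma mem_zrange a b j : (j \in zrange a b) = (a <= j <= b).
Proof.
apply/mapP/andP => [[i + ->]|[le_aj le_jb]].
  rewrite mem_iota add0n => /= lt_i; split; first by rewrite lerDl.
  move: lt_i; rewrite -ltz_nat gez0_abs ?le_max ?lexx // lt_max ltNge lez_nat /=.
  by rewrite ltrBrDl ltzD1.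
exists (absz (j - a)); last by rewrite gez0_abs ?subr_ge0 // subrKC.
rewrite mem_iota add0n /= -ltz_nat !gez0_abs ?le_max ?lexx ?subr_ge0 //.
by rewrite lt_max ltrD2r ltzD1 le_jb orbT.
Qed.

Definition square_shape (p q : int) : {fset int * int} :=
  [fset (p, q); (p - 1, q); (p, q - 1); (p - 1, q - 1)].

Definition even_shape1 (r : nat) (p q : int) : {fset int * int} :=
  [fset (p + j%:Z, q - j%:Z) | j in iota 0 r] `|`
  [fset (p + j%:Z + 1, q - j%:Z) | j in iota 0 r].

Definition even_shape2 (r : nat) (p q : int) : {fset int * int} :=
  [fset (p - j%:Z, q + j%:Z) | j in iota 0 r] `|`
  [fset (p - j%:Z, q + j%:Z + 1) | j in iota 0 r].

Definition odd_shape (d p q : int) : {fset int * int} :=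
  if p + q <= d then
    [fset (j, d - j) | j in zrange p (d - q)] `|`
    [fset (j, d + 1 - j) | j in zrange (p + 1) (d - q)]
  else
    [fset (j, d - j) | j in zrange (d - q) p] `|`
    [fset (j, d - 1 - j) | j in zrange (d - q) (p - 1)].

Definition is_square (S : {fset int * int}) : Prop :=
  exists p q, S = square_shape p q.

Definition is_even_zigzag (S : {fset int * int}) : Prop :=
  exists r p q, (1 <= r)%N /\ (S = even_shape1 r p q \/ S = even_shape2 r p q).

Definition is_odd_zigzag (S : {fset int * int}) : Prop :=
  exists d p q, S = odd_shape d p q.

Definition is_zigzag (S : {fset int * int}) : Prop :=
  is_even_zigzag S \/ is_odd_zigzag S.

Definition is_shape (S : {fset int * int}) : Prop :=
  is_square S \/ is_zigzag S.

(* [X] is a double complex C(S). *)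
Definition is_C (K : fieldType) (S : {fset int * int}) (X : dcomplex K) :
    Prop :=
  [/\ forall p q, has_dim (dc_comp X p q) ((p, q) \in S),
      forall p q, (p, q) \in S -> (p + 1, q) \in S ->
        forall y, dc_comp X (p + 1) q y ->
          exists! x, dc_comp X p q x /\ dc_d1 X x = y
    & forall p q, (p, q) \in S -> (p, q + 1) \in S ->
        forall y, dc_comp X p (q + 1) y ->
          exists! x, dc_comp X p q x /\ dc_d2 X x = y].

(* A is isomorphic to the direct sum, over all shapes S, of [m S] copies of
   C(S); the cardinal [m S] is represented by an indexing type. *)
Definition multiplicities (K : fieldType) (A : dcomplex K)
    (m : {fset int * int} -> eqType) : Prop :=
  (forall S, ~ is_shape S -> m S -> False) /\
  exists C : {fset int * int} -> dcomplex K,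
    (forall S, is_shape S -> is_C S (C S)) /\
    iso_direct_sum A (fun i : {S : {fset int * int} & m S} => C (tag i)).

(* mult_S(A) <> 0. *)
Definition mult_neq0 (K : fieldType) (A : dcomplex K) (S : {fset int * int}) :
    Prop :=
  exists m, multiplicities A m /\ inhabited (m S).

Section Cohomology.
Context {K : fieldType} (A : dcomplex K).

Definition dc_part (P : int * int -> Prop) : subspace A :=
  sub_sum P (fun x => dc_comp A x.1 x.2).

Definition tot (n : int) : subspace A := dc_part (fun x => x.1 + x.2 = n).

Definition dtot : {linear A -> A} := dc_d1 A \+ dc_d2 A.

Lemma dtotK x : dtot (dtot x) = 0.
Proof.
rewrite /= !linearD dc_d1d1 dc_d2d2 add0r addr0; exact: dc_anticomm.
Qed.

Lemma dtot_tot n x : tot n x -> tot (n + 1) (dtot x).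
Proof.
case=> s [Ws ->]; rewrite linear_sum big_seq_cond.
apply: (@big_ind _ (in_sub (tot (n + 1)))); [exact: sub0|exact: subD|].
move=> v; rewrite andbT => /Ws[[p q] /= [<- Wv]].
apply: (@subD _ _ (tot (p + q + 1))).
  exists [:: dc_d1 A v]; rewrite big_seq1; split=> // u; rewrite inE => /eqP ->.
  by exists (p + 1, q); rewrite /= addrAC; split=> //; apply: dc_d1_bideg.
exists [:: dc_d2 A v]; rewrite big_seq1; split=> // u; rewrite inE => /eqP ->.
by exists (p, q + 1); rewrite /= addrA; split=> //; apply: dc_d2_bideg.
Qed.

Definition filt1 (m : int) : subspace A := dc_part (fun x => m <= x.1).
Definition filt2 (m : int) : subspace A := dc_part (fun x => m <= x.2).

Definition dR_cocycle (d : int) : subspace A :=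
  sub_cap (tot d) (sub_preim dtot (sub_null A)).

Definition dR_cobound (d : int) : subspace A := sub_im dtot (tot (d - 1)).

Definition HdR (d : int) : lmodType K :=
  subquot (dR_cocycle d) (dR_cobound d).

Definition dR_represents (d : int) (w : A) (h : HdR d) : Prop :=
  dR_cocycle d w /\ h = sq_class (dR_cocycle d) (dR_cobound d) w.

Definition hodge1 (d m : int) : subspace (HdR d) := sq_induced _ _ (filt1 m).
Definition hodge2 (d m : int) : subspace (HdR d) := sq_induced _ _ (filt2 m).

Definition Hpq (d p q : int) : subspace (HdR d) :=
  sub_cap (hodge1 d p) (hodge2 d q).

Definition pure_hodge (d k : int) : Prop :=
  direct_sum (fun p : int => Hpq d p (k - p)).

(* gr_{F_1}^p gr_{F_2}^q H^d_dR, with the filtration induced by F_1 on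
   gr_{F_2}^q. *)
Definition grgr (d p q : int) : lmodType K :=
  gr (V := gr (hodge2 d) q) (fun m => sq_induced _ _ (hodge1 d m)) p.

(* The spectral sequence of the total complex filtered by F, in filtration
   degree a and total degree n:
   Z_r^a = {x in F^a | dx in F^(a+r)},
   E_r^a = Z_r^a / (Z_(r-1)^(a+1) + d Z_(r-1)^(a-r+1)).
   In bidegree (p, q) the total degree is n = p + q, and a is p for the first
   filtration and q for the second one, so that [ss_diff] has bidegree
   (r, 1 - r), respectively (1 - r, r). *)
Section SpectralSequence.
Variable F : int -> subspace A.

Definition ss_cycle (r a n : int) : subspace A :=
  sub_cap (sub_cap (F a) (tot n)) (sub_preim dtot (F (a + r))).

Definition ss_bound (r a n : int) : subspace A :=
  sub_add (ss_cycle (r - 1) (a + 1) n)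
          (sub_im dtot (ss_cycle (r - 1) (a - r + 1) (n - 1))).

Definition ss_page (r : nat) (a n : int) : lmodType K :=
  subquot (ss_cycle r a n) (ss_bound r a n).

Definition ss_class (r : nat) (a n : int) (x : A) : ss_page r a n :=
  sq_class (ss_cycle r a n) (ss_bound r a n) x.

Definition ss_diff (r : nat) (a n : int) (c : ss_page r a n) :
    ss_page r (a + r) (n + 1) :=
  ss_class r (a + r) (n + 1) (dtot (sq_repr c)).

Lemma ss_diffE (r : nat) (a n : int) (x : A) : ss_cycle r a n x ->
  ss_diff (ss_class r a n x) = ss_class r (a + r) (n + 1) (dtot x).
Proof.
have dcyc y : ss_cycle r a n y -> ss_cycle r (a + r) (n + 1) (dtot y).
  case=> -[Fy Ty] Fdy; split; last first.
    by change (F (a + r + r) (dtot (dtot y))); rewrite dtotK; apply: sub0.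
  by split=> //; apply: dtot_tot.
move=> Zx; have Zc := sq_reprP (ss_class r a n x).
apply/sq_class_eq; [exact: dcyc|exact: dcyc|].
have /sq_class_eq : ss_class r a n (sq_repr (ss_class r a n x)) =
  ss_class r a n x by apply: sq_reprK.
case=> // u [_ [Zu [v [_ ->]] e]].
rewrite -linearB e linearD dtotK addr0.
exists 0, (dtot u); rewrite add0r; split=> //; first exact: sub0.
by exists u; rewrite !addrK.
Qed.

Definition ss_degenerates (r : nat) : Prop :=
  forall (s : nat) (a n : int), (r <= s)%N ->
    forall c : ss_page s a n, ss_diff c = 0.

End SpectralSequence.

Definition froelicher1 (r : nat) (p q : int) : lmodType K :=
  ss_page filt1 r p (p + q).
Definition froelicher2 (r : nat) (p q : int) : lmodType K :=
  ss_page filt2 r q (p + q).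

Definition betti (m : int) : nat := sdim (sub_full (HdR m)).

Definition hodge_number (d p q : int) : nat := sdim (sub_full (grgr d p q)).

End Cohomology.

Arguments dR_represents {K A} d w h.

(* A zigzag of shape S occurs in A and C(S) has nonzero d-th de Rham
   cohomology. *)
Definition contributes (K : fieldType) (A : dcomplex K) (d : int)
    (S : {fset int * int}) : Prop :=
  [/\ is_zigzag S, mult_neq0 A S
    & exists X : dcomplex K, is_C S X /\ exists h : HdR X d, h <> 0].

(* Main.v *)
Require Import Defs.
From HB Require Import structures.
From mathcomp Require Import all_boot all_order all_algebra.
From mathcomp Require Import finmap.
From mathcomp Require Import boolp classical_sets cardinality fsbigop.
From mathcomp Require Import zify.

Set Implicit Arguments.
Unset Strict Implicit.
Unset Printing Implicit Defensive.

Import Order.TTheory GRing.Theory Num.Theory.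
Local Open Scope classical_set_scope.
Local Open Scope ring_scope.

(* Degeneration at page r and purity are rephrased as conditions on elements.
   The spectral sequence of F degenerates at r iff every x in F^a of total degree
   n with dx in F^(a+r) agrees with a cocycle of F^a modulo F^(a+1) ([lifts]); H
   is pure of weight k iff H^{p,q} is contained in H^{p+1,q} + H^{p,q+1} whenever
   p + q <> k.  Both conditions hold for a direct sum iff they hold for its
   summands, so by the decomposition theorem they can be tested on the C(S).
   There everything follows from one principle: columns exact for d2 let an
   element be pushed, modulo coboundaries, further into F_1.  C(S) has exact
   columns for squares and one kind of even zigzags (exact rows for the other
   kind), and S_d^{p,q} is exact in columns except at (p, d - p).

   Decomposition theorem: with D = d1 d2, the squares generated by a complement
   of ker D split off.  On the rest D = 0, so the complex is a sum of zigzags of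
   vector spaces T^p -d1-> B^(p+1) <-d2- T^(p+1) -d1-> ...  These are decomposed
   from left to right, using the filtration of the last space by how far to the
   left an element extends: any basis adapted to it consists of the right ends
   of intervals of a decomposition, and this property propagates one step.

   For the numerical criteria, dim E_r is split along
   B_r <= B_r + B_oo <= B_r + Z_oo <= Z_r, whose middle step is gr H. *)

(** * Linear algebra: direct sums and projections *)

(** The components may be infinite-dimensional, so decompositions are built from bases of one
    subspace modulo another ([rel_basis]), which Zorn's lemma supplies. A string of basis vectors
    running through several bidegrees is a function [int * int -> A]. Since all strings live in this
    one type, a single family of strings gives a basis in every bidegree, and the strings supported
    on S index the copies of C(S). In the induction along a line, a basis fixed too early may not
    suit the next map. The induction hypothesis therefore promises strings ending in any prescribed
    adapted basis, so that the basis of a space is chosen after that of its right neighbour.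
    [mult_neq0] asks for some decomposition in which S occurs. A summand is a retract, so conditions
    pass from A to C(S) for an arbitrary decomposition; the converse uses the constructed one.
    Statements on rows come from those on columns through the transposed complex [dc_tr], which has
    the same carrier. *)

Lemma big_uniq_widen (I : eqType) (V : nmodType) (s t : seq I) (w : I -> V) :
  uniq s -> uniq t -> {subset s <= t} -> (forall i, i \notin s -> w i = 0) ->
  \sum_(i <- t) w i = \sum_(i <- s) w i.
Proof.
move=> us ut st w0; rewrite (bigID (mem s)) /= [X in _ + X]big1 => [|i /w0//].
rewrite addr0 -big_filter; apply: perm_big; apply: uniq_perm => [||i] //.
  exact: filter_uniq.
by rewrite mem_filter andb_idr //; apply: st.
Qed.

Section Subspaces.
Context {K : fieldType} {V : lmodType K}.
Implicit Types (W : subspace V).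

Lemma subspace_ext W1 W2 : (forall x, W1 x <-> W2 x) -> W1 = W2.
Proof.
case: W1 W2 => [i1 z1 c1] [i2 z2 c2] /= h.
have e : i1 = i2 by apply/funext => x; apply/propext.
by case: _ / e in z2 c2 h *; congr Subspace; apply: Prop_irrelevance.
Qed.

Lemma sub_lin W (I : Type) (s : seq I) (P : pred I) (F : I -> V) :
  (forall i, P i -> W (F i)) -> W (\sum_(i <- s | P i) F i).
Proof.
move=> WF; apply: (@big_ind _ (in_sub W)) => //; first exact: sub0.
by move=> x y; apply: subD.
Qed.

Lemma sub_lin_seq W (I : eqType) (s : seq I) (F : I -> V) :
  (forall i, i \in s -> W (F i)) -> W (\sum_(i <- s) F i).
Proof. by move=> WF; rewrite big_seq; apply: sub_lin. Qed.

Lemma sub_subE W x y : W (x - y) -> W y -> W x.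
Proof. by move=> Wxy Wy; rewrite -(subrK y x); apply: subD. Qed.

Lemma sub_sum_min (I : Type) (P : I -> Prop) (W : I -> subspace V)
    (U : subspace V) :
  (forall i v, P i -> W i v -> U v) -> forall x, sub_sum P W x -> U x.
Proof.
move=> h x [s [hs ->]]; apply: sub_lin_seq => v /hs[i [Pi Wv]]; exact: h Wv.
Qed.

Lemma sub_sum_in (I : Type) (P : I -> Prop) (W : I -> subspace V) i v :
  P i -> W i v -> sub_sum P W v.
Proof.
move=> Pi Wv; exists [:: v]; rewrite big_seq1; split=> // u.
by rewrite inE => /eqP ->; exists i.
Qed.

Lemma sub_addl W1 W2 x : W1 x -> sub_add W1 W2 x.
Proof. by exists x, 0; split=> //; [exact: sub0|rewrite addr0]. Qed.

Lemma sub_addr W1 W2 x : W2 x -> sub_add W1 W2 x.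
Proof. by exists 0, x; split=> //; [exact: sub0|rewrite add0r]. Qed.

End Subspaces.

(** Choice turns a total, functional and linear relation into a linear map. Projections and
    retractions are obtained in this way, from what they should satisfy rather than from
    coordinates. *)
Lemma linear_of_rel (K : fieldType) (U V : lmodType K) (R : U -> V -> Prop) :
  (forall x, exists y, R x y) ->
  (forall x y y', R x y -> R x y' -> y = y') ->
  (forall a x x' y y', R x y -> R x' y' -> R (a *: x + x') (a *: y + y')) ->
  exists g : {linear U -> V}, forall x, R x (g x).
Proof.
move=> /choice[g gP] Ru Rl.
have lg : linear g.
  by move=> a x y; apply: Ru (gP _) _; apply: Rl; apply: gP.
pose G : {linear U -> V} := HB.pack g (GRing.isLinear.Build K U V *:%R g lg).
by exists G => x; apply: gP.
Qed.

Section DirectSum.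
Context {K : fieldType} {V : lmodType K} {I : eqType} (W : I -> subspace V).
Hypothesis dW : direct_sum W.

Let dec x (w : I -> V) := (forall i, W i (w i)) /\ exists s : seq I,
  [/\ uniq s, forall i, i \notin s -> w i = 0 & x = \sum_(i <- s) w i].

Let dec_lin a x x' w w' : dec x w -> dec x' w' ->
  dec (a *: x + x') (fun i => a *: w i + w' i).
Proof.
case=> Ww [s [us s0 ->]] [Ww' [s' [us' s0' ->]]]; split=> [i|].
  by apply: subZD.
exists (undup (s ++ s')); rewrite undup_uniq; split=> // [i|].
  rewrite mem_undup mem_cat negb_or => /andP[/s0 -> /s0' ->].
  by rewrite scaler0 addr0.
rewrite big_split /= -scaler_sumr; congr (_ *: _ + _); apply/esym.
  apply: big_uniq_widen => //; first exact: undup_uniq.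
  by move=> i; rewrite mem_undup mem_cat => ->.
apply: big_uniq_widen => //; first exact: undup_uniq.
by move=> i; rewrite mem_undup mem_cat => ->; rewrite orbT.
Qed.

Let dec_in i x : W i x -> dec x (fun j => if j == i then x else 0).
Proof.
move=> Wx; split=> [j|]; first by case: eqP => [->|_] //; apply: sub0.
exists [:: i]; split=> // [j|]; first by rewrite inE => /negbTE ->.
by rewrite big_seq1 eqxx.
Qed.

Let dec_ex x : exists w, dec x w.
Proof.
have [s [hs ->]] := dW.1 x; elim: s hs => [|v s IH] hs.
  rewrite big_nil; exists (fun=> 0); split; first by move=> i; apply: sub0.
  by exists [::]; rewrite big_nil.
rewrite big_cons.
have [w dw] := IH (fun u us => hs u (mem_behead (s := v :: s) us)).
have [i [_ Wv]] := hs v (mem_head _ _).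
exists (fun j => 1 *: (if j == i then v else 0) + w j).
by rewrite -[v in v + _]scale1r; apply: dec_lin => //; apply: dec_in.
Qed.

Let dec_uniq x w w' : dec x w -> dec x w' -> w = w'.
Proof.
move=> dw dw'; have := dec_lin (-1) dw dw'; rewrite scaleN1r addNr.
case=> Wd [s [us s0 e]]; apply/funext => i.
suff : -1 *: w i + w' i = 0.
  by rewrite scaleN1r addrC => /eqP; rewrite subr_eq0 => /eqP ->.
have [si|] := boolP (i \in s); last by move/s0.
by have := dW.2 s _ us (fun j _ => Wd j) (esym e) i si.
Qed.

Lemma direct_sum_proj : exists pr : I -> {linear V -> V},
  [/\ forall i x, W i (pr i x), forall i x, W i x -> pr i x = x,
      forall i j x, W j x -> i != j -> pr i x = 0
    & forall x, exists s, [/\ uniq s, forall i, i \notin s -> pr i x = 0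
        & x = \sum_(i <- s) pr i x]].
Proof.
have /choice[pr prP] (i : I) : exists g : {linear V -> V}, forall x,
    exists2 w, dec x w & g x = w i.
  apply: (@linear_of_rel _ _ _ (fun x y => exists2 w, dec x w & y = w i)).
  - by move=> x; have [w dw] := dec_ex x; exists (w i), w.
  - by move=> x y y' [w dw ->] [w' dw' ->]; rewrite (dec_uniq dw dw').
  move=> a x x' y y' [w dw ->] [w' dw' ->].
  by exists (fun i => a *: w i + w' i) => //; apply: dec_lin.
exists pr; split.
- by move=> i x; have [w [Ww _] ->] := prP i x.
- move=> i x Wx; have [w dw ->] := prP i x.
  by rewrite (dec_uniq dw (dec_in Wx)) eqxx.
- move=> i j x Wx ij; have [w dw ->] := prP i x.
  by rewrite (dec_uniq dw (dec_in Wx)) (negbTE ij).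
move=> x; have [w dw] := dec_ex x.
have prE i : pr i x = w i.
  by have [w' dw' ->] := prP i x; rewrite (dec_uniq dw' dw).
case: dw => _ [s [us s0 e]]; exists s; split=> // [i /s0|].
  by rewrite prE.
by rewrite {1}e; apply: eq_bigr => i _; rewrite prE.
Qed.

Definition ds_pr : I -> {linear V -> V} := sval (cid direct_sum_proj).

Let ds_prP := svalP (cid direct_sum_proj).

Lemma ds_pr_in i x : W i (ds_pr i x).
Proof. by have [h _ _ _] := ds_prP; apply: h. Qed.

Lemma ds_pr_id i x : W i x -> ds_pr i x = x.
Proof. by have [_ h _ _] := ds_prP; apply: h. Qed.

Lemma ds_pr_neq i j x : W j x -> i != j -> ds_pr i x = 0.
Proof. by have [_ _ h _] := ds_prP; apply: h. Qed.

Lemma ds_pr_dec x : exists s, [/\ uniq s, forall i, i \notin s -> ds_pr i x = 0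
        & x = \sum_(i <- s) ds_pr i x].
Proof. by have [_ _ _ h] := ds_prP; apply: h. Qed.

Lemma ds_pr_eq x y : (forall i, ds_pr i x = ds_pr i y) -> x = y.
Proof.
move=> e; apply/eqP; rewrite -subr_eq0; apply/eqP.
have [s [_ _ ->]] := ds_pr_dec (x - y).
by rewrite big1 // => i _; rewrite linearB e subrr.
Qed.

Lemma ds_pr_eq0 x : (forall i, ds_pr i x = 0) -> x = 0.
Proof. by move=> e; apply: ds_pr_eq => i; rewrite e linear0. Qed.

End DirectSum.

(** Injectivity of [s] keeps distinct components of [x] in distinct components of [g x], so no two
    of them can merge. It is used with shifts of bidegrees and with the identity. *)
Lemma ds_pr_comm (K : fieldType) (V V' : lmodType K) (I I' : eqType)
    (W : I -> subspace V) (W' : I' -> subspace V')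
    (dW : direct_sum W) (dW' : direct_sum W') (s : I -> I')
    (g : {linear V -> V'}) :
  injective s -> (forall i x, W i x -> W' (s i) (g x)) ->
  forall i x, ds_pr dW' (s i) (g x) = g (ds_pr dW i x).
Proof.
move=> s_inj gW i x; have [t [ut t0 e]] := ds_pr_dec dW x.
rewrite {1}e !linear_sum; have [it|/[dup] it /t0 ->] := boolP (i \in t).
  rewrite (bigD1_seq i) //= big1 ?addr0 => [|j ji].
    by rewrite (ds_pr_id dW') //; apply/gW/ds_pr_in.
  rewrite (ds_pr_neq dW' (gW _ _ (ds_pr_in dW j x))) //.
  by rewrite (inj_eq s_inj) eq_sym.
rewrite linear0 big_seq big1 // => j jt.
rewrite (ds_pr_neq dW' (gW _ _ (ds_pr_in dW j x))) //.
by rewrite (inj_eq s_inj); apply: contraNneq it => ->.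
Qed.

(** * Bidegrees, degeneration and exact columns *)

Lemma sub_preimE (K : fieldType) (U V : lmodType K) (f : {linear U -> V}) W x :
  sub_preim f W x = W (f x).
Proof. by []. Qed.

Section Projections.
Context {K : fieldType} (A : dcomplex K).
Implicit Types (x y : A) (p q n m : int).

Definition dc_pr (i : int * int) : {linear A -> A} := ds_pr (dc_direct A) i.

Lemma dc_pr_in p q x : dc_comp A p q (dc_pr (p, q) x).
Proof. exact: (ds_pr_in (dc_direct A) (p, q)). Qed.

Lemma dc_pr_id p q x : dc_comp A p q x -> dc_pr (p, q) x = x.
Proof. exact: (ds_pr_id (dc_direct A) (i := (p, q))). Qed.

Lemma dc_pr_neq (i : int * int) p q x :
  dc_comp A p q x -> i != (p, q) -> dc_pr i x = 0.
Proof. exact: (ds_pr_neq (dc_direct A) (j := (p, q))). Qed.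

Lemma dc_pr_dec x : exists s, [/\ uniq s, forall i, i \notin s -> dc_pr i x = 0
  & x = \sum_(i <- s) dc_pr i x].
Proof. exact: ds_pr_dec. Qed.

Lemma dc_pr_eq x y : (forall i, dc_pr i x = dc_pr i y) -> x = y.
Proof. exact: ds_pr_eq. Qed.

Lemma dc_pr_eq0 x : (forall i, dc_pr i x = 0) -> x = 0.
Proof. exact: ds_pr_eq0. Qed.

Lemma dc_pr_d1 p q x : dc_pr (p, q) (dc_d1 A x) = dc_d1 A (dc_pr (p - 1, q) x).
Proof.
have inj : injective (fun i : int * int => (i.1 + 1, i.2)).
  by move=> [a b] [c d] [/addIr -> ->].
have := @ds_pr_comm _ _ _ _ _ _ _ (dc_direct A) (dc_direct A) _ (dc_d1 A) inj
  (fun i x => @dc_d1_bideg _ A i.1 i.2 x) (p - 1, q) x.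
by rewrite /= subrK.
Qed.

Lemma dc_pr_d2 p q x : dc_pr (p, q) (dc_d2 A x) = dc_d2 A (dc_pr (p, q - 1) x).
Proof.
have inj : injective (fun i : int * int => (i.1, i.2 + 1)).
  by move=> [a b] [c d] [-> /addIr ->].
have := @ds_pr_comm _ _ _ _ _ _ _ (dc_direct A) (dc_direct A) _ (dc_d2 A) inj
  (fun i x => @dc_d2_bideg _ A i.1 i.2 x) (p, q - 1) x.
by rewrite /= subrK.
Qed.

Lemma dtotE x : dtot A x = dc_d1 A x + dc_d2 A x.
Proof. by []. Qed.

Lemma dc_pr_dtot p q x : dc_pr (p, q) (dtot A x) =
  dc_d1 A (dc_pr (p - 1, q) x) + dc_d2 A (dc_pr (p, q - 1) x).
Proof. by rewrite dtotE linearD dc_pr_d1 dc_pr_d2. Qed.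

(** Membership becomes the vanishing of projections, after which facts about filtrations and total
    degrees reduce to integer arithmetic. *)
Lemma dc_partP (P : int * int -> Prop) x :
  dc_part A P x <-> forall i, ~ P i -> dc_pr i x = 0.
Proof.
split=> [Px i Pi|h].
  pose U := sub_preim (dc_pr i) (sub_null A).
  apply: (@sub_sum_min _ _ _ _ _ U _ _ Px) => j v Pj Wv.
  by apply: (ds_pr_neq (dc_direct A) Wv); apply/eqP => ij; apply: Pi; rewrite ij.
have [s [us _ ->]] := dc_pr_dec x; apply: sub_lin_seq => i _.
have [Pi|/h ->] := pselect (P i); last exact: sub0.
exact/(sub_sum_in Pi)/(ds_pr_in (dc_direct A)).
Qed.

Lemma totP n x : tot A n x <-> forall p q, p + q != n -> dc_pr (p, q) x = 0.
Proof.
split=> [/dc_partP h p q pq|h]; first by apply: h => /= /eqP; rewrite (negbTE pq).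
by apply/dc_partP => -[p q] /= /eqP; apply: h.
Qed.

Lemma filt1P m x : filt1 A m x <-> forall p q, p < m -> dc_pr (p, q) x = 0.
Proof.
split=> [/dc_partP h p q pm|h]; first by apply: h => /=; rewrite leNgt pm.
by apply/dc_partP => -[p q] /= /negP; rewrite -ltNge; apply: h.
Qed.

Lemma filt2P m x : filt2 A m x <-> forall p q, q < m -> dc_pr (p, q) x = 0.
Proof.
split=> [/dc_partP h p q pm|h]; first by apply: h => /=; rewrite leNgt pm.
by apply/dc_partP => -[p q] /= /negP; rewrite -ltNge; apply: h.
Qed.

Lemma comp_tot p q x : dc_comp A p q x -> tot A (p + q) x.
Proof. by move=> Ax; apply: (@sub_sum_in _ _ _ _ _ (p, q)). Qed.

Lemma comp_filt1 p q x : dc_comp A p q x -> filt1 A p x.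
Proof. by move=> Ax; apply: (@sub_sum_in _ _ _ _ _ (p, q)) => /=. Qed.

Lemma comp_filt2 p q x : dc_comp A p q x -> filt2 A q x.
Proof. by move=> Ax; apply: (@sub_sum_in _ _ _ _ _ (p, q)) => /=. Qed.

Lemma filt1_le m m' x : m' <= m -> filt1 A m x -> filt1 A m' x.
Proof. by move=> mm /filt1P h; apply/filt1P => p q pm; apply: h; lia. Qed.

Lemma filt2_le m m' x : m' <= m -> filt2 A m x -> filt2 A m' x.
Proof. by move=> mm /filt2P h; apply/filt2P => p q pm; apply: h; lia. Qed.

Lemma dtot_filt1 m x : filt1 A m x -> filt1 A m (dtot A x).
Proof.
move=> /filt1P h; apply/filt1P => p q pm.
by rewrite dc_pr_dtot !h ?linear0 ?addr0 //; lia.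
Qed.

Lemma dc_restrict (P : pred (int * int)) x :
  exists y, forall i, dc_pr i y = if P i then dc_pr i x else 0.
Proof.
have [s [us s0 _]] := dc_pr_dec x.
exists (\sum_(i <- s | P i) dc_pr i x) => i; rewrite linear_sum /=.
have pr_pr j : dc_pr i (dc_pr j x) = if j == i then dc_pr i x else 0.
  case: eqP => [->|/eqP ji]; first by case: i => p q; apply/dc_pr_id/dc_pr_in.
  by apply: (ds_pr_neq (dc_direct A)) (ds_pr_in _ _ _) _; rewrite eq_sym.
under eq_bigr do rewrite pr_pr.
rewrite -big_mkcondr /=; have [si|si] := boolP (i \in s); last first.
  by rewrite s0 // if_same big1.
rewrite -big_filter; have [Pi|Pi] := boolP (P i).
  rewrite (_ : [seq _ <- s | _] = [:: i]) ?big_seq1 //.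
  rewrite -(filter_pred1_uniq us si); apply: eq_filter => j.
  by rewrite andbC /=; case: eqP => // ->.
rewrite (_ : [seq _ <- s | _] = [::]) ?big_nil //.
rewrite -(filter_pred0 s); apply: eq_filter => j /=.
by rewrite andbC; case: eqP => // ->; rewrite (negbTE Pi).
Qed.

Lemma boundedP : bounded A ->
  exists M : int, 0 <= M /\ forall p q, (M <= `|p|) || (M <= `|q|) ->
    forall x, dc_comp A p q x -> x = 0.
Proof.
case=> s hs; pose M := (\max_(i <- s) (absz i.1 + absz i.2)).+1.
exists (M%:Z); split=> // p q pq; apply: hs; apply/negP => si.
suff : (absz p + absz q <= M.-1)%N by lia.
by rewrite /M /= (big_rem (p, q)) //= leq_maxl.
Qed.

(** Exactness of a column is recorded one bidegree at a time, because odd zigzags fail it at a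
    single place. *)
Definition exact2_at p q := forall u, dc_comp A p q u -> dc_d2 A u = 0 ->
  exists2 v, dc_comp A p (q - 1) v & dc_d2 A v = u.

(** The component of [x] in column p is a d2-cocycle: [dtot A x] has nothing in column p and [x]
    nothing in column p - 1. Writing it as d2 u and subtracting the total differential of u clears
    column p and changes only column p + 1 besides. *)
Lemma exact2_step p e x : filt1 A p x -> tot A e x ->
  filt1 A (p + 1) (dtot A x) -> exact2_at p (e - p) ->
  exists u, [/\ filt1 A p u, tot A (e - 1) u & filt1 A (p + 1) (x - dtot A u)].
Proof.
move=> Fx Tx Fdx /(_ _ (dc_pr_in _ _ x))[|u Au ux].
  have /filt1P/(_ p (e - p + 1)) := Fdx; rewrite ltzD1 lexx => /(_ isT).
  have /filt1P/(_ (p - 1) (e - p + 1)) x0 := Fx.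
  by rewrite dc_pr_dtot addrK x0 ?linear0 ?add0r // ltrBlDr ltzD1.
have Tu : tot A (e - 1) u by have := comp_tot Au; congr (tot A _ u); lia.
have Fu := comp_filt1 Au.
exists u; split=> //; apply/filt1P => i j ip; rewrite linearB.
have [ip'|] := boolP (i < p).
  have /filt1P -> // := Fx; have /filt1P -> // := dtot_filt1 Fu.
  by rewrite subr0.
move=> ip'; have {ip ip'} -> : i = p by lia.
have [->|je] := eqVneq j (e - p).
  have /filt1P/(_ (p - 1) (e - p)) u0 := Fu.
  rewrite dc_pr_dtot u0; last by lia.
  by rewrite linear0 add0r (dc_pr_id Au) ux subrr.
have /totP -> := Tx; first have /totP -> := dtot_tot Tu.
- by rewrite subr0.
- by lia.
by lia.
Qed.

(** Subtracting coboundaries does not alter [dtot A x], so the single step can be repeated through k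
    columns. *)
Lemma exact2_push p (k : nat) e x : filt1 A p x -> tot A e x ->
  filt1 A (p + k%:Z) (dtot A x) ->
  (forall j, p <= j < p + k%:Z -> exact2_at j (e - j)) ->
  exists u, [/\ filt1 A p u, tot A (e - 1) u
    & filt1 A (p + k%:Z) (x - dtot A u)].
Proof.
move=> Fx Tx; elim: k => [|k IH] Fdx ex.
  have -> : p + 0%N = p by lia.
  by exists 0; rewrite linear0 subr0; split=> //; apply: sub0.
have [||u [Fu Tu Fxu]] := IH.
- by apply: filt1_le Fdx; lia.
- by move=> j jp; apply: ex; lia.
have [||||v [Fv Tv]] := @exact2_step (p + k%:Z) e (x - dtot A u).
- by [].
- by apply: subB => //; rewrite -(subrK 1 e); apply: dtot_tot.
- by rewrite linearB dtotK subr0; apply: filt1_le Fdx; lia.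
- by apply: ex; lia.
have -> : x - dtot A u - dtot A v = x - dtot A (u + v).
  by rewrite [dtot A (u + v)]linearD [- (dtot A u + _)]opprD addrA.
move=> Fuv; exists (u + v); split.
- by apply: subD => //; apply: filt1_le Fv; lia.
- exact: subD.
- by apply: filt1_le Fuv; lia.
Qed.

End Projections.

(** * Degeneration in terms of elements *)

Section Degeneration.
Context {K : fieldType} (A : dcomplex K) (F : int -> subspace A).
Hypothesis F_decr : forall a x, F (a + 1) x -> F a x.

Lemma F_le a b x : b <= a -> F a x -> F b x.
Proof.
move=> ba; have {ba} -> : a = b + (absz (a - b))%:Z by lia.
elim: (absz _) => [|k IH]; first by have -> : b + 0%N = b by lia.
by rewrite -addn1 PoszD addrA => /F_decr.
Qed.

Definition lifts (r a n : int) := forall x, F a x -> tot A n x ->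
  F (a + r) (dtot A x) ->
  exists z, [/\ F a z, dR_cocycle A n z & F (a + 1) (x - z)].

Lemma lifts_le r s a n : r <= s -> lifts r a n -> lifts s a n.
Proof. by move=> rs h x Fx Tx Fdx; apply: h => //; apply: F_le Fdx; lia. Qed.

Hypothesis F_bound : exists M, forall x, F M x -> x = 0.

(** A vanishing d_s allows a cycle of page s to be corrected, inside F^(a+1), to a cycle of page s +
    1. Repeating this beyond the last filtration step gives a cocycle. Conversely, the difference
    between a cycle and its lift exhibits the image under d_s as a boundary. *)
Lemma ss_degeneratesP r :
  ss_degenerates F r <-> forall a n, lifts r a n.
Proof.
split=> [dg a n|h s a n rs c]; last first.
  rewrite -(sq_reprK c) ss_diffE; last exact: sq_reprP.
  have [[Fx Tx] Fdx] := sq_reprP c; move: (sq_repr c) Fx Tx Fdx => x Fx Tx Fdx.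
  have [||||z [Fz [Tz dz] Fxz]] := lifts_le (s := s) _ (h a n) (x := x) => //.
  have dz0 : dtot A z = 0 by [].
  apply/sq_class_eq.
  - split; first by split=> //; apply: dtot_tot.
    by rewrite sub_preimE dtotK; apply: sub0.
  - exact: sub0.
  (* As z is a cocycle, dx = d(x - z), and x - z lies in Z_(s-1)^(a+1), which is the source of
     boundaries on page s in filtration degree a + s. *)
  rewrite subr0; apply: sub_addr; exists (x - z); split; last first.
    by rewrite linearB dz0 subr0.
  rewrite (_ : a + s%:Z - s%:Z + 1 = a + 1) ?addrK //; split.
    by split=> //; apply: subB.
  rewrite sub_preimE linearB dz0 subr0; apply: F_le Fdx; lia.
(* k bounds the number of pages left before F^(a+s) vanishes; once it does, dx = 0 and x is its own
   lift. *)
suff step k (s : nat) x : (r <= s)%N ->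
    (exists M : int, M <= a + s%:Z + k%:Z /\ forall y, F M y -> y = 0) ->
    F a x -> tot A n x -> F (a + s) (dtot A x) ->
    exists z, [/\ F a z, dR_cocycle A n z & F (a + 1) (x - z)].
  have [M M0] := F_bound => x Fx Tx Fdx.
  refine (step (absz (M - a - r%:Z)%R) r x _ _ Fx Tx Fdx) => //; exists M; split=> //; lia.
elim: k s x => [|k IH] s x rs [M [Mk M0]] Fx Tx Fdx.
  have dx0 : dtot A x = 0 by apply: M0; apply: F_le Fdx; lia.
  by exists x; split=> //; rewrite subrr; apply: sub0.
have Zx : ss_cycle F s a n x by [].
have Zdx : ss_cycle F s (a + s) (n + 1) (dtot A x).
  split; first by split=> //; apply: dtot_tot.
  by rewrite sub_preimE dtotK; apply: sub0.
have := dg s a n rs (ss_class F s a n x); rewrite ss_diffE //.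
move=> /sq_class_eq; case => //; first exact: sub0.
(* The vanishing of d_s [x] reads dx = u + dv with u in F^(a+s+1) and v in F^(a+1). Hence x - v is a
   cycle for the next page and agrees with x modulo F^(a+1). *)
move=> u [_ [[[Fu Tu] _] [v [[[Fv Tv] Fdv] ->]]]]; rewrite subr0 => dxE.
rewrite addrK in Tv; rewrite (_ : a + s%:Z - s%:Z + 1 = a + 1) ?addrK // in Fv.
have [|||||z [Fz Zz Fxz]] := IH s.+1 (x - v).
- lia.
- by exists M; split=> //; lia.
- by apply: subB => //; apply: F_decr.
- exact: subB.
- by rewrite linearB dxE addrK; apply: F_le Fu; lia.
exists z; split=> //; rewrite -(subrK v x) addrAC; exact: subD.
Qed.

End Degeneration.

(** * Representatives of the classes in H^{p,q} *)

Section Cutting.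
Context {K : fieldType} (A : dcomplex K).
Implicit Types (x y : A) (p q n m d j : int).

Lemma compP p q x :
  dc_comp A p q x <-> forall i, i != (p, q) -> dc_pr A i x = 0.
Proof.
split=> [Ax i|h]; first exact: dc_pr_neq.
suff -> : x = dc_pr A (p, q) x by apply: dc_pr_in.
apply: dc_pr_eq => i; have [->|ipq] := eqVneq i (p, q).
  by rewrite [RHS]dc_pr_id //; apply: dc_pr_in.
by rewrite h // (dc_pr_neq (dc_pr_in _ _ _)).
Qed.

Lemma HpqP d p q (h : HdR A d) : Hpq A d p q h <->
  (exists2 x, filt1 A p x & dR_represents d x h) /\
  (exists2 x, filt2 A q x & dR_represents d x h).
Proof.
split=> [[[x [Fx Zx hx]] [y [Fy Zy hy]]]|[[x Fx [Zx hx]] [y Fy [Zy hy]]]].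
  by split; [exists x|exists y].
by split; [exists x|exists y].
Qed.

Lemma dR_cocycle_cobound d x : dR_cobound A d x -> dR_cocycle A d x.
Proof.
case=> u [Tu ->]; split; last exact: dtotK.
by have := dtot_tot Tu; rewrite subrK.
Qed.

Lemma dR_represents_sub d x y h : dR_represents d x h -> dR_cobound A d y ->
  dR_represents d (x - y) h.
Proof.
case=> Zx -> By; have Zxy : dR_cocycle A d (x - y).
  by apply: subB => //; apply: dR_cocycle_cobound.
by split=> //; apply/sq_class_eq => //; rewrite opprB addrC subrK.
Qed.

Lemma dR_represents_cobound d x y h : dR_represents d x h ->
  dR_represents d y h -> dR_cobound A d (x - y).
Proof. by case=> Zx -> [Zy] /sq_class_eq; apply. Qed.

(* Remove from a representative in F_1^p the coboundary of the part in columns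
   at least j of a primitive of its difference with one in F_2^q. *)
Lemma Hpq_cut d p q j (h : HdR A d) : d - q <= j -> Hpq A d p q h ->
  exists2 w, dR_represents d w h & forall a b : int,
    (j < a) || (a < j) && (a < p) || (a + b != d) -> dc_pr A (a, b) w = 0.
Proof.
move=> jq /HpqP[[x Fx hx] [y Fy hy]].
have [e [Te xyE]] := dR_represents_cobound hx hy.
have [e' e'E] := dc_restrict (fun i => j <= i.1) e.
have Te' : tot A (d - 1) e'.
  by apply/totP => a b ab; rewrite e'E; case: ifP => // _; have /totP -> := Te.
have rw : dR_represents d (x - dtot A e') h.
  by apply: dR_represents_sub hx _; exists e'.
exists (x - dtot A e') => // a b.
have [abd|abd] := eqVneq (a + b) d; last first.
  by move=> _; case: rw => -[/totP -> //].
rewrite /= orbF => /orP[ja|/andP[aj ap]]; rewrite linearB dc_pr_dtot !e'E /=.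
  (* Right of column j, e' and e have the same differential, so the component is that of y; its row
     d - a is below q. *)
  have [-> ->] : j <= a - 1 /\ j <= a by lia.
  rewrite -dc_pr_dtot -linearB -xyE opprB addrC subrK.
  by have /filt2P := Fy; apply; lia.
(* Left of column j, the differential of e' vanishes, so the component is that of x, which is zero
   in columns below p. *)
have [-> ->] : (j <= a - 1) = false /\ (j <= a) = false by lia.
by rewrite !linear0 addr0 subr0; have /filt1P -> := Fx.
Qed.

(** Cutting at a column j <= p leaves nothing on either side of it, since the columns below j are
    also below p. Conversely, the representatives in the two extreme columns p and d - q give
    membership in F_1^p and F_2^q. *)
Lemma Hpq_ge d p q (h : HdR A d) : d <= p + q -> Hpq A d p q h <->
  (forall j, d - q <= j <= p ->
     exists w, dc_comp A j (d - j) w /\ dR_represents d w h).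
Proof.
move=> pq; split=> [hh j /andP[jq jp]|hj].
  have [w hw w0] := Hpq_cut jq hh; exists w; split=> //.
  apply/compP => -[a b] ab; apply: w0.
  have {}ab : (a != j) || (b != d - j) by rewrite -negb_and.
  by lia.
apply/HpqP; split.
  have [|w [Aw hw]] := hj p; first by lia.
  by exists w => //; apply: comp_filt1 Aw.
have [|w [Aw hw]] := hj (d - q); first by lia.
exists w => //; apply: (@comp_filt2 _ _ (d - q)); move: Aw.
by have -> : d - (d - q) = q by lia.
Qed.

Lemma zrange_uniq a b : uniq (zrange a b).
Proof. by rewrite map_inj_uniq ?iota_uniq // => i k; lia. Qed.

(** Here the cut is at column d - q, which is not left of p: exactly the columns from p to d - q
    survive. *)
Lemma Hpq_le d p q (h : HdR A d) : p + q <= d -> Hpq A d p q h <->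
  (exists w : int -> A,
     (forall j, p <= j <= d - q -> dc_comp A j (d - j) (w j)) /\
     dR_represents d (\sum_(j <- zrange p (d - q)) w j) h).
Proof.
move=> pq; split=> [hh|[w [Aw hw]]]; last first.
  apply/HpqP; split; exists (\sum_(j <- zrange p (d - q)) w j) => //.
    apply: sub_lin_seq => j; rewrite mem_zrange => jr.
    by apply: (filt1_le _ (comp_filt1 (Aw j jr))); lia.
  apply: sub_lin_seq => j; rewrite mem_zrange => jr.
  by apply: (filt2_le _ (comp_filt2 (Aw j jr))); lia.
have [w hw w0] := Hpq_cut (lexx _) hh.
exists (fun j => dc_pr A (j, d - j) w); split=> [j _|]; first exact: dc_pr_in.
suff <- : w = \sum_(j <- zrange p (d - q)) dc_pr A (j, d - j) w by [].
have pr_pr i j : dc_pr A i (dc_pr A (j, d - j) w) =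
    if (j, d - j) == i then dc_pr A i w else 0.
  case: eqP => [<-|/eqP ij]; first exact/dc_pr_id/dc_pr_in.
  by rewrite (dc_pr_neq (dc_pr_in _ _ _)) // eq_sym.
apply: dc_pr_eq => -[a b]; rewrite linear_sum /=.
under eq_bigr do rewrite pr_pr.
have [ab|ab] := boolP ((p <= a <= d - q) && (a + b == d)); last first.
  rewrite w0 ?big1 //; last by lia.
  by move=> j _; rewrite if_same.
rewrite (bigD1_seq a) /= ?zrange_uniq ?mem_zrange; [|lia|by []].
rewrite big1 => [|j ja]; last by rewrite xpair_eqE (negbTE ja).
have -> : d - a = b by lia.
by rewrite addr0 eqxx.
Qed.

End Cutting.

(** * Exchange of rows and columns *)

Section Transpose.
Context {K : fieldType} (A : dcomplex K).

Lemma direct_sum_swap :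
  direct_sum (fun x : int * int => dc_comp A x.2 x.1).
Proof.
have [span free] := dc_direct A; split=> [x|s w us Ww w0 i si].
  have [s [hs ->]] := span x; exists s; split=> // v /hs[[p q] [_ Wv]].
  by exists (q, p).
pose sw (i : int * int) := (i.2, i.1).
have swK : involutive sw by case.
have := free (map sw s) (w \o sw).
rewrite (map_inj_uniq (inv_inj swK)) big_map => /(_ us) /=.
move=> h; have := h _ _ (sw i); rewrite swK; apply=> [_ /mapP[j js ->]||].
- by rewrite swK; apply: Ww.
- by rewrite -[RHS]w0; apply: eq_bigr => j _; rewrite swK.
exact: map_f.
Qed.

(** The carrier stays [A], so the filtrations, cocycles and coboundaries of the transpose are equal,
    as subspaces of [A], to those of [A] with the indices exchanged, and can be rewritten into each
    other. *)
Definition dc_tr : dcomplex K := @DComplex K A (fun p q => dc_comp A q p)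
  direct_sum_swap (dc_d2 A) (dc_d1 A) (fun p q => @dc_d2_bideg _ A q p)
  (fun p q => @dc_d1_bideg _ A q p) (@dc_d2d2 _ A) (@dc_d1d1 _ A)
  (fun x => etrans (addrC _ _) (dc_anticomm x)).

Lemma dtot_tr (x : A) : dtot dc_tr x = dtot A x :> A.
Proof. by rewrite !dtotE addrC. Qed.

Lemma filt1_tr m : filt1 dc_tr m = filt2 A m :> subspace A.
Proof.
apply: subspace_ext => x; split; apply: (@sub_sum_min K A) => -[p q] v mp Wv.
  exact: (@sub_sum_in _ _ _ _ _ (q, p)).
exact: (@sub_sum_in _ dc_tr _ _ (fun x => dc_comp A x.2 x.1) (q, p)).
Qed.

Lemma tot_tr n : tot dc_tr n = tot A n :> subspace A.
Proof.
apply: subspace_ext => x; split; apply: (@sub_sum_min K A) => -[p q] v mp Wv.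
  by apply: (@sub_sum_in _ _ _ _ _ (q, p)) => //=; rewrite addrC.
apply: (@sub_sum_in _ dc_tr _ _ (fun x => dc_comp A x.2 x.1) (q, p)) => //=.
by rewrite addrC.
Qed.

Lemma dR_cocycle_tr n : dR_cocycle dc_tr n = dR_cocycle A n :> subspace A.
Proof.
apply: subspace_ext => x; split=> -[Tx dx]; split.
- by rewrite -tot_tr.
- by rewrite sub_preimE -dtot_tr.
- by rewrite tot_tr.
- by rewrite sub_preimE dtot_tr.
Qed.

Lemma dR_cobound_tr n : dR_cobound dc_tr n = dR_cobound A n :> subspace A.
Proof.
apply: subspace_ext => x; split=> -[u [Tu ->]]; exists u; rewrite ?dtot_tr; split=> //.
  by rewrite -tot_tr.
by rewrite tot_tr.
Qed.

Lemma lifts_tr r a n : lifts (filt1 dc_tr) r a n <-> lifts (filt2 A) r a n.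
Proof.
by split=> h x; have := h x; rewrite !filt1_tr tot_tr dR_cocycle_tr dtot_tr.
Qed.

End Transpose.

(** * Consequences of exact columns *)

Section ExactColumns.
Context {K : fieldType} (A : dcomplex K).
Hypothesis A_bounded : bounded A.
Implicit Types (x y : A) (p q n m d j : int).

Lemma filt1_bounded : exists M : int, 0 <= M /\
  (forall m x, m <= - M -> filt1 A m x) /\
  (forall m x, M <= m -> filt1 A m x -> x = 0).
Proof.
have [M [M0 hM]] := boundedP A_bounded; exists M; split=> //; split=> m x mM.
  by apply/filt1P => p q pm; apply: (hM p q); [lia|apply: dc_pr_in].
move=> /filt1P Fx; apply: dc_pr_eq0 => -[p q].
have [pm|pm] := ltP p m; first exact: Fx.
by apply: (hM p q); [lia|apply: dc_pr_in].
Qed.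

Lemma tot_bounded : exists M : int, 0 <= M /\
  forall n x, M <= `|n| -> tot A n x -> x = 0.
Proof.
have [M [M0 hM]] := boundedP A_bounded; exists (2 * M); split=> [|n x nM]; first by lia.
move=> /totP Tx; apply: dc_pr_eq0 => -[p q].
have [pq|] := eqVneq (p + q) n; last exact: Tx.
by apply: (hM p q); [lia|apply: dc_pr_in].
Qed.

(** The push starts at a column left of the whole complex, where membership in F_1 is no
    condition. *)
Lemma exact2_push_all e c x : tot A e x -> filt1 A c (dtot A x) ->
  (forall j, j < c -> exact2_at A j (e - j)) ->
  exists2 u, tot A (e - 1) u & filt1 A c (x - dtot A u).
Proof.
move=> Tx Fdx ex; have [M [M0 [hM _]]] := filt1_bounded.
pose p := - M - `|c|; have cE : c = p + (absz (c - p))%:Z by lia.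
have [||||u [_ Tu Fu]] := @exact2_push _ A p (absz (c - p)) e x; rewrite -?cE //.
- by apply: hM; lia.
- by move=> j jc; apply: ex; lia.
by exists u; rewrite // cE.
Qed.

(** Pushing a cocycle beyond the last column turns it into 0; the accumulated correction is a
    primitive lying in the same filtration step. *)
Lemma exact2_filt1_cobound p e x : dR_cocycle A e x -> filt1 A p x ->
  (forall j, p <= j -> exact2_at A j (e - j)) ->
  exists2 u, filt1 A p u & tot A (e - 1) u /\ x = dtot A u.
Proof.
case=> Tx; rewrite sub_preimE => dx0 Fx ex.
have [M [M0 [_ hM]]] := filt1_bounded; pose k := absz (`|M| + `|p|)%R.
have [||u [Fu Tu]] := @exact2_push _ A p k e x Fx Tx.
- by rewrite dx0; apply: sub0.
- by move=> j jp; apply: ex; lia.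
move=> Fxu; exists u => //; split=> //; apply/eqP; rewrite -subr_eq0.
by apply/eqP/(hM _ _ _ Fxu); rewrite /k; lia.
Qed.

Lemma exact2_cobound e x : (forall j, exact2_at A j (e - j)) ->
  dR_cocycle A e x -> dR_cobound A e x.
Proof.
move=> ex Zx; have [M [M0 [hM _]]] := filt1_bounded.
have [u _ [Tu ->]] :=
  exact2_filt1_cobound Zx (hM _ x (lexx _)) (fun j _ => ex j).
by exists u.
Qed.

(** Exactness at the leading bidegree makes x agree with a coboundary modulo F^(a+1), and this
    coboundary is the lift. *)
Lemma exact2_lifts (r : nat) a n : (1 <= r)%N -> exact2_at A a (n - a) ->
  lifts (filt1 A) r a n.
Proof.
move=> r1 ex x Fx Tx Fdx; have [||||u [Fu Tu Fxu]] := @exact2_step _ A a n x => //.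
  by apply: filt1_le Fdx; lia.
exists (dtot A u); split=> //; first exact: dtot_filt1.
by apply: dR_cocycle_cobound; exists u.
Qed.

(** This covers the case where the leading bidegree itself is not exact: if the next total degree
    is, dx has a primitive u in F^(a+r), and x - u is the lift. *)
Lemma exact2_lifts_next (r : nat) a n : (1 <= r)%N ->
  (forall j, exact2_at A j (n + 1 - j)) -> lifts (filt1 A) r a n.
Proof.
move=> r1 ex x Fx Tx Fdx.
have Zdx : dR_cocycle A (n + 1) (dtot A x).
  by split; [apply: dtot_tot|apply: dtotK].
have [u Fu [Tu dxu]] := exact2_filt1_cobound Zdx Fdx (fun j _ => ex j).
exists (x - u); split.
- by apply: subB => //; apply: filt1_le Fu; lia.
- split; first by apply: subB => //; rewrite addrK in Tu.
  by rewrite sub_preimE linearB dxu subrr.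
by rewrite subKr; apply: filt1_le Fu; lia.
Qed.

End ExactColumns.

Lemma bounded_tr (K : fieldType) (A : dcomplex K) : bounded A -> bounded (dc_tr A).
Proof.
case=> s hs; exists [seq (i.2, i.1) | i <- s] => p q pq x Ax.
by apply: (hs q p _ x Ax); apply: contra pq => qps; apply/mapP; exists (q, p).
Qed.

(** * Shapes and the complexes C(S) *)

Section ShapeMembership.
Implicit Types (p q d x y : int) (r : nat) (S : {fset int * int}).
Local Open Scope fset_scope.
Local Open Scope ring_scope.

(** Membership in each kind of shape is turned into inequalities, which leaves the later
    combinatorics of shapes to [lia]. *)
Lemma mem_square_shape p q x y : ((x, y) \in square_shape p q) =
  ((x == p) || (x == p - 1)) && ((y == q) || (y == q - 1)).
Proof. by rewrite !inE !xpair_eqE; lia. Qed.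

Lemma mem_even_shape1 r p q x y : ((x, y) \in even_shape1 r p q) =
  (x + y == p + q) && (p <= x < p + r%:Z) ||
  (x + y == p + q + 1) && (p + 1 <= x < p + r%:Z + 1).
Proof.
rewrite in_fsetU; congr (_ || _).
  apply/imfsetP/idP => /= [[j]|h].
    by rewrite mem_iota => jr [-> ->]; lia.
  exists (absz (x - p)%R); first by rewrite mem_iota; lia.
  by congr pair; lia.
apply/imfsetP/idP => /= [[j]|h].
  by rewrite mem_iota => jr [-> ->]; lia.
exists (absz (x - p - 1)%R); first by rewrite mem_iota; lia.
by congr pair; lia.
Qed.

Lemma mem_even_shape2 r p q x y : ((x, y) \in even_shape2 r p q) =
  ((x + y == p + q) || (x + y == p + q + 1)) && (p - r%:Z < x <= p).
Proof.
rewrite in_fsetU andb_orl; congr (_ || _).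
  apply/imfsetP/idP => /= [[j]|h].
    by rewrite mem_iota => jr [-> ->]; lia.
  exists (absz (p - x)%R); first by rewrite mem_iota; lia.
  by congr pair; lia.
apply/imfsetP/idP => /= [[j]|h].
  by rewrite mem_iota => jr [-> ->]; lia.
exists (absz (p - x)%R); first by rewrite mem_iota; lia.
by congr pair; lia.
Qed.

Lemma mem_odd_shape d p q x y : ((x, y) \in odd_shape d p q) =
  if p + q <= d then
    (x + y == d) && (p <= x <= d - q) ||
    (x + y == d + 1) && (p + 1 <= x <= d - q)
  else
    (x + y == d) && (d - q <= x <= p) ||
    (x + y == d - 1) && (d - q <= x <= p - 1).
Proof.
rewrite /odd_shape; case: ifP => pq; rewrite in_fsetU; congr (_ || _).
- apply/imfsetP/idP => /= [[j]|h]; first by rewrite mem_zrange => jr [-> ->]; lia.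
  by exists x; [rewrite mem_zrange; lia|congr pair; lia].
- apply/imfsetP/idP => /= [[j]|h]; first by rewrite mem_zrange => jr [-> ->]; lia.
  by exists x; [rewrite mem_zrange; lia|congr pair; lia].
- apply/imfsetP/idP => /= [[j]|h]; first by rewrite mem_zrange => jr [-> ->]; lia.
  by exists x; [rewrite mem_zrange; lia|congr pair; lia].
apply/imfsetP/idP => /= [[j]|h]; first by rewrite mem_zrange => jr [-> ->]; lia.
by exists x; [rewrite mem_zrange; lia|congr pair; lia].
Qed.

Definition shape_tr S : {fset int * int} := [fset (i.2, i.1) | i in S].

Lemma mem_shape_tr S x y : ((x, y) \in shape_tr S) = ((y, x) \in S).
Proof.
apply/imfsetP/idP => /= [[[a b] abS [-> ->]] //|yxS].
by exists (y, x).
Qed.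

Lemma shape_tr_square p q : shape_tr (square_shape p q) = square_shape q p.
Proof.
by apply/fsetP => -[x y]; rewrite mem_shape_tr !mem_square_shape andbC.
Qed.

Lemma shape_tr_even1 r p q : shape_tr (even_shape1 r p q) = even_shape2 r q p.
Proof.
apply/fsetP => -[x y]; rewrite mem_shape_tr mem_even_shape1 mem_even_shape2.
by lia.
Qed.

Lemma shape_tr_even2 r p q : shape_tr (even_shape2 r p q) = even_shape1 r q p.
Proof.
apply/fsetP => -[x y]; rewrite mem_shape_tr mem_even_shape1 mem_even_shape2.
by lia.
Qed.

Lemma shape_tr_odd d p q : shape_tr (odd_shape d p q) = odd_shape d q p.
Proof.
apply/fsetP => -[x y]; rewrite mem_shape_tr !mem_odd_shape (addrC q p).
by case: ifP; lia.
Qed.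

Lemma card_fset_seq (s : seq (int * int)) S : uniq s -> S =i s -> #|` S| = size s.
Proof.
by move=> us Ss; apply/perm_size/uniq_perm.
Qed.

Lemma card_even_shape1 r p q : #|` even_shape1 r p q| = (2 * r)%N.
Proof.
pose f i := (p + i%:Z, q - i%:Z); pose g i := (p + i%:Z + 1, q - i%:Z).
rewrite (@card_fset_seq (map f (iota 0 r) ++ map g (iota 0 r))).
- by rewrite size_cat !size_map size_iota; lia.
- rewrite cat_uniq !map_inj_uniq ?iota_uniq /=; last 2 first.
  + by move=> i j [h1 h2]; lia.
  + by move=> i j [h1 h2]; lia.
  rewrite andbT; apply/hasPn => _ /mapP[i _ ->]; apply/mapP => -[j _ [h1 h2]].
  lia.
move=> x; rewrite in_fsetU mem_cat; congr (_ || _).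
  by apply/imfsetP/mapP => -[j jr ->]; exists j.
by apply/imfsetP/mapP => -[j jr ->]; exists j.
Qed.

Lemma card_shape_tr S : #|` shape_tr S| = #|` S|.
Proof. by apply: card_imfset => -[a b] [c d] /= [-> ->]. Qed.

Lemma card_even_shape2 r p q : #|` even_shape2 r p q| = (2 * r)%N.
Proof. by rewrite -shape_tr_even1 card_shape_tr card_even_shape1. Qed.

Lemma card_odd_shape d p q : #|` odd_shape d p q| = (2 * absz (p + q - d)%R + 1)%N.
Proof.
have gen (a b a' b' d' : int) : d' != d ->
    #|` [fset (j, d - j) | j in zrange a b] `|`
        [fset (j, d' - j) | j in zrange a' b']| =
    (absz (Num.max 0 (b + 1 - a))%R + absz (Num.max 0 (b' + 1 - a'))%R)%N.
  move=> dd'; pose f j := (j, d - j); pose g j := (j, d' - j).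
  rewrite (@card_fset_seq (map f (zrange a b) ++ map g (zrange a' b'))).
  - by rewrite size_cat !size_map !size_iota.
  - have f_inj : injective f by move=> i j [].
    have g_inj : injective g by move=> i j [].
    rewrite cat_uniq (map_inj_uniq f_inj) (map_inj_uniq g_inj) !zrange_uniq /=.
    rewrite andbT; apply/hasPn => _ /mapP[i _ ->]; apply/mapP => -[j _ [h1 h2]].
    lia.
  move=> x; rewrite in_fsetU mem_cat; congr (_ || _).
    by apply/imfsetP/mapP => -[j jr ->]; exists j.
  by apply/imfsetP/mapP => -[j jr ->]; exists j.
rewrite /odd_shape; case: ifP => pq; rewrite gen; lia.
Qed.

End ShapeMembership.

(** Combinatorial form of [exact2_at] for C(S): a bidegree of S with a vertical neighbour in S is
    the source or the target of an isomorphism d2. *)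
Definition col_exact (S : {fset int * int}) (x y : int) :=
  ((x, y) \in S) ==> ((x, y + 1) \in S) || ((x, y - 1) \in S).

Section ShapeComplexes.
Context {K : fieldType}.
Implicit Types (X : dcomplex K) (S : {fset int * int}) (p q d a n : int).

Lemma is_C_zero S X p q : is_C S X -> (p, q) \notin S ->
  forall v, dc_comp X p q v -> v = 0.
Proof.
case=> dimX _ _ /negbTE pqS v Xv; have := dimX p q; rewrite pqS.
by case=> e [_ /(_ v Xv)[c [-> _]]]; rewrite big_ord0.
Qed.

Lemma is_C_nonzero S X p q : is_C S X -> (p, q) \in S ->
  exists2 v, dc_comp X p q v & v <> 0.
Proof.
case=> dimX _ _ pqS; have := dimX p q; rewrite pqS => -[e [Xe unq]].
exists (e ord0) => // e0; have [c [_ cu]] := unq 0 (sub0 _).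
have c0 : c = 0 by apply: cu; rewrite big1 // => i _; rewrite mxE scale0r.
have /matrixP/(_ ord0 ord0) : c = const_mx 1.
  by apply: cu; rewrite big_ord1 e0 scaler0.
by rewrite c0 !mxE => /esym/eqP; rewrite oner_eq0.
Qed.

Lemma is_C_bounded S X : is_C S X -> bounded X.
Proof. by move=> SX; exists S => p q; apply: is_C_zero. Qed.

(** With a neighbour above, d2 is injective and its kernel is zero; with a neighbour below, d2 is
    onto. *)
Lemma is_C_exact2 S X (x y : int) : is_C S X -> col_exact S x y -> exact2_at X x y.
Proof.
move=> SX ex u Xu du0; have [xyS|xyS] := boolP ((x, y) \in S); last first.
  by exists 0; [apply: sub0|rewrite linear0 (is_C_zero SX xyS Xu)].
have [_ _ iso2] := SX; move: ex; rewrite /col_exact xyS /= => /orP[Sy|Sy].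
  have [z [_ zu]] := iso2 x y xyS Sy 0 (sub0 _).
  exists 0; first exact: sub0.
  by rewrite linear0 -(zu u) //; apply/esym/zu; split; [apply: sub0|rewrite linear0].
have [||v [[Xv dv] _]] := iso2 x (y - 1) Sy _ u; rewrite ?subrK //.
by exists v.
Qed.

Lemma is_C_tr S X : is_C S X -> is_C (shape_tr S) (dc_tr X).
Proof.
case=> dimX iso1 iso2; split=> p q; rewrite !mem_shape_tr.
- exact: dimX.
- exact: iso2.
exact: iso1.
Qed.

Lemma even2_col_exact r p q (x y : int) : col_exact (even_shape2 r p q) x y.
Proof. by rewrite /col_exact !mem_even_shape2; lia. Qed.

Lemma square_col_exact p q (x y : int) : col_exact (square_shape p q) x y.
Proof. by rewrite /col_exact !mem_square_shape; lia. Qed.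

(** Every other column that meets the zigzag does so in two vertically adjacent bidegrees; column p
    contains (p, d - p) alone, whichever way p + q compares with d. *)
Lemma odd_col_exact d p q (x y : int) : (x, y) != (p, d - p) ->
  col_exact (odd_shape d p q) x y.
Proof. by rewrite xpair_eqE /col_exact !mem_odd_shape; case: ifP; lia. Qed.

Lemma odd_lifts1 d p q X (r : nat) a n : is_C (odd_shape d p q) X ->
  (1 <= r)%N -> lifts (filt1 X) r a n.
Proof.
move=> SX r1; have bX := is_C_bounded SX.
have [anp|anp] := boolP ((a == p) && (n == d)); last first.
  apply: exact2_lifts => //; apply/(is_C_exact2 SX)/odd_col_exact.
  by rewrite xpair_eqE; lia.
apply: exact2_lifts_next => // j; apply/(is_C_exact2 SX)/odd_col_exact.
by rewrite xpair_eqE; lia.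
Qed.

Lemma exact_lifts1 X (r : nat) a n : (forall x y, exact2_at X x y) ->
  (1 <= r)%N -> lifts (filt1 X) r a n.
Proof. by move=> ex r1; apply: exact2_lifts. Qed.

(** The shape occupies the s + 1 columns from p to p + s. For a >= p the condition dx in F^(a+r)
    with r > s forces dx = 0; for a < p the whole complex lies in F^(a+1). *)
Lemma even1_lifts1 (s r : nat) p q X a n : is_C (even_shape1 s p q) X ->
  (s < r)%N -> lifts (filt1 X) r a n.
Proof.
move=> SX sr x Fx Tx Fdx.
have C0 i j : ~~ (p <= i <= p + s%:Z) -> dc_pr X (i, j) =1 fun=> 0.
  move=> ij v; apply: (is_C_zero SX _ (dc_pr_in _ _ v)).
  by rewrite mem_even_shape1; lia.
have [ap|pa] := ltP a p.
  exists 0; split; [exact: sub0|exact: sub0|rewrite subr0].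
  apply/filt1P => i j ia; apply: C0; lia.
exists x; split=> //; last by rewrite subrr; apply: sub0.
split=> //; rewrite sub_preimE; apply: dc_pr_eq0 => -[i j].
have [ia|ia] := ltP i (a + r%:Z); first by have /filt1P := Fdx; apply.
by apply: C0; lia.
Qed.

(** The differential d_s joins the two ends of the zigzag: the generator t at (p, q) extends to a
    cycle of page s, but no cocycle of this degree has a component there. *)
Lemma even1_not_lifts1 (s : nat) p q X : is_C (even_shape1 s p q) X ->
  (1 <= s)%N -> ~ lifts (filt1 X) s p (p + q).
Proof.
move=> SX s1 h; have bX := is_C_bounded SX.
have [|t Xt t0] := is_C_nonzero (p := p) (q := q) SX.
  by rewrite mem_even_shape1; lia.
have dt2 : dc_d2 X t = 0.
  apply: (is_C_zero SX _ (dc_d2_bideg Xt)); rewrite mem_even_shape1; lia.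
have Fdt : filt1 X (p + 1) (dtot X t).
  by rewrite dtotE dt2 addr0; apply: comp_filt1 (dc_d1_bideg Xt).
have Tdt := dtot_tot (comp_tot Xt).
(* Columns p + 1, ..., p + s - 1 contain a bidegree of each of the two total degrees, so dt can be
   pushed s - 1 columns, into F^(p+s). Then t - w is a cycle of page s. *)
have [||w [Fw Tw Fdtw]] := @exact2_push _ X (p + 1) s.-1 _ _ Fdt Tdt.
- by rewrite dtotK; apply: sub0.
- move=> j jp; apply: (is_C_exact2 SX); rewrite /col_exact !mem_even_shape1; lia.
rewrite addrK in Tw; have [|||z [_ [Tz dz] Fz]] := h (t - w).
- apply: subB => //; first exact: comp_filt1 Xt.
  by apply: filt1_le Fw; lia.
- by apply: subB => //; apply: comp_tot.
- by rewrite linearB; apply: filt1_le Fdtw; lia.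
(* The rows are exact, so z is a coboundary, and the complex is zero in total degree p + q - 1. *)
have z0 : z = 0.
  have Zz : dR_cocycle (dc_tr X) (p + q) z by rewrite dR_cocycle_tr.
  have [|u [Tu ->]] := exact2_cobound (bounded_tr bX) _ Zz.
    move=> j; apply: (is_C_exact2 (is_C_tr SX)); rewrite shape_tr_even1.
    exact: even2_col_exact.
  rewrite (_ : u = 0) ?linear0 //; move/totP: Tu => Tu; apply: dc_pr_eq0 => -[i j].
  have [ij|] := eqVneq (i + j) (p + q - 1); last exact: Tu.
  apply: (is_C_zero (is_C_tr SX) _ (dc_pr_in _ _ _)).
  by rewrite mem_shape_tr mem_even_shape1; lia.
apply: t0; move: Fz; rewrite z0 subr0 => /filt1P/(_ p q); rewrite linearB.
rewrite dc_pr_id //; have /filt1P -> := Fw; [|lia].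
by rewrite subr0; apply; lia.
Qed.

(** The columns left of p are exact, so a cocycle can be pushed to column p. Together with the next
    lemma this places all of H^d at step p of F_1. *)
Lemma odd_filt1 d p q X (x : X) : is_C (odd_shape d p q) X -> dR_cocycle X d x ->
  exists u, [/\ filt1 X p u, dR_cocycle X d u & dR_cobound X d (x - u)].
Proof.
move=> SX [Tx]; rewrite sub_preimE => dx0; have bX := is_C_bounded SX.
have [||u Tu Fu] := exact2_push_all bX (c := p) Tx.
- by rewrite dx0; apply: sub0.
- move=> j jp; apply/(is_C_exact2 SX)/odd_col_exact.
  by rewrite xpair_eqE; lia.
exists (x - dtot X u); split=> //; last by rewrite subKr; exists u.
split; last by rewrite sub_preimE linearB dx0 dtotK subr0.
by apply: subB => //; rewrite -(subrK 1 d); apply: dtot_tot.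
Qed.

Lemma odd_filt1_cobound d p q X m (x : X) : is_C (odd_shape d p q) X ->
  dR_cocycle X d x -> filt1 X m x -> p < m -> dR_cobound X d x.
Proof.
move=> SX Zx Fx pm; have bX := is_C_bounded SX.
have [|u _ [Tu ->]] := exact2_filt1_cobound bX Zx Fx.
  move=> j mj; apply/(is_C_exact2 SX)/odd_col_exact.
  by rewrite xpair_eqE; lia.
by exists u.
Qed.

(** The generator t at (p, d - p) is completed to a cocycle t - w by exactness in degree d + 1. By
    exactness in degree d - 1, a primitive could be moved into F_1^p; its component below (p, d - p)
    lies outside the shape, which would give t = 0. *)
Lemma odd_HdR d p q X : is_C (odd_shape d p q) X ->
  exists2 x, dR_cocycle X d x & ~ dR_cobound X d x.
Proof.
move=> SX; have bX := is_C_bounded SX.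
have ex n : n != d -> forall j, exact2_at X j (n - j).
  move=> nd j; apply/(is_C_exact2 SX)/odd_col_exact.
  by rewrite xpair_eqE; lia.
have pS : (p, d - p) \in odd_shape d p q.
  by rewrite mem_odd_shape; case: ifP; lia.
have [t Xt t0] := is_C_nonzero SX pS.
have dt2 : dc_d2 X t = 0.
  apply: (is_C_zero SX _ (dc_d2_bideg Xt)); rewrite mem_odd_shape.
  by case: ifP; lia.
have Fdt : filt1 X (p + 1) (dtot X t).
  by rewrite dtotE dt2 addr0; apply: comp_filt1 (dc_d1_bideg Xt).
have Tt : tot X d t by have := comp_tot Xt; rewrite addrC subrK.
have Zdt : dR_cocycle X (d + 1) (dtot X t).
  by split; [apply: dtot_tot|apply: dtotK].
have [|w Fw [Tw dw]] := exact2_filt1_cobound bX Zdt Fdt.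
  by move=> j _; apply: ex; lia.
rewrite addrK in Tw; exists (t - w).
  by split; [apply: subB|rewrite sub_preimE linearB dw subrr].
case=> x [Tx dxE].
have Ft : filt1 X p (t - w).
  apply: subB; first exact: comp_filt1 Xt.
  by apply: filt1_le Fw; lia.
have Zd : dR_cocycle X d (dtot X x).
  by split; [have := dtot_tot Tx; rewrite subrK|apply: dtotK].
have [||u Tu Fu] := exact2_push_all bX (c := p) Tx.
- by rewrite -dxE.
- by move=> j _; apply: ex; lia.
apply: t0; have : dc_pr X (p, d - p) (t - w) = 0.
  have e : dtot X x = dtot X (x - dtot X u) by rewrite linearB dtotK subr0.
  rewrite dxE e dc_pr_dtot.
  have /filt1P/(_ (p - 1) (d - p)) -> := Fu; last by lia.
  suff -> : dc_pr X (p, d - p - 1) (x - dtot X u) = 0 by rewrite !linear0 addr0.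
  apply: (is_C_zero SX _ (dc_pr_in _ _ _)).
  by rewrite mem_odd_shape; case: ifP; lia.
by rewrite linearB dc_pr_id //; have /filt1P -> := Fw; [rewrite subr0|lia].
Qed.

Lemma even_HdR S X n (x : X) : is_C S X -> is_even_zigzag S -> dR_cocycle X n x ->
  dR_cobound X n x.
Proof.
move=> SX [r [p [q [_ [SE|SE]]]]] Zx; subst S.
  rewrite -dR_cobound_tr.
  apply: (exact2_cobound (bounded_tr (is_C_bounded SX))); last by rewrite dR_cocycle_tr.
  move=> j; apply: (is_C_exact2 (is_C_tr SX)); rewrite shape_tr_even1.
  exact: even2_col_exact.
apply: (exact2_cobound (is_C_bounded SX)) => // j.
exact/(is_C_exact2 SX)/even2_col_exact.
Qed.

Lemma square_HdR S X n (x : X) : is_C S X -> is_square S -> dR_cocycle X n x ->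
  dR_cobound X n x.
Proof.
move=> SX [p [q SE]] Zx; subst S.
apply: (exact2_cobound (is_C_bounded SX)) => // j.
exact/(is_C_exact2 SX)/square_col_exact.
Qed.

Lemma odd_HdR_neq d p q X n (x : X) : is_C (odd_shape d p q) X -> n != d ->
  dR_cocycle X n x -> dR_cobound X n x.
Proof.
move=> SX nd; apply: (exact2_cobound (is_C_bounded SX)) => j.
by apply/(is_C_exact2 SX)/odd_col_exact; rewrite xpair_eqE; lia.
Qed.

Lemma shape_lifts S X (r : nat) a n : is_C S X -> is_shape S -> (1 <= r)%N ->
  (is_even_zigzag S -> (#|` S| < 2 * r)%N) ->
  lifts (filt1 X) r a n /\ lifts (filt2 X) r a n.
Proof.
move=> SX [[p [q SE]]|[[s [p [q [s1 [SE|SE]]]]]|[d [p [q SE]]]]] r1 card_S; subst S.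
- split; last rewrite -lifts_tr.
    apply: exact_lifts1 => // x y; exact/(is_C_exact2 SX)/square_col_exact.
  apply: exact_lifts1 => // x y; apply/(is_C_exact2 (is_C_tr SX)).
  by rewrite shape_tr_square; apply: square_col_exact.
- have {card_S} sr : (s < r)%N.
    rewrite -(ltn_pmul2l (m := 2)) // -(card_even_shape1 s p q); apply: card_S.
    by exists s, p, q; split=> //; left.
  split; first exact: even1_lifts1 SX _.
  rewrite -lifts_tr; apply: exact_lifts1 => // x y; apply/(is_C_exact2 (is_C_tr SX)).
  by rewrite shape_tr_even1; apply: even2_col_exact.
- have {card_S} sr : (s < r)%N.
    rewrite -(ltn_pmul2l (m := 2)) // -(card_even_shape2 s p q); apply: card_S.
    by exists s, p, q; split=> //; right.
  split; first apply: exact_lifts1 => // x y.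
    exact/(is_C_exact2 SX)/even2_col_exact.
  rewrite -lifts_tr; have := is_C_tr SX; rewrite shape_tr_even2 => SX'.
  exact: even1_lifts1 SX' _.
split; first exact: odd_lifts1 SX _.
rewrite -lifts_tr; have := is_C_tr SX; rewrite shape_tr_odd => SX'.
exact: odd_lifts1 SX' _.
Qed.

(** A zigzag of length 2s of the first kind obstructs the first spectral sequence at page s, one of
    the second kind the second, whence both hypotheses. *)
Lemma even_lifts_card S X (r : nat) : is_C S X -> is_even_zigzag S ->
  (forall a n, lifts (filt1 X) r a n) -> (forall a n, lifts (filt2 X) r a n) ->
  (#|` S| < 2 * r)%N.
Proof.
move=> SX [s [p [q [s1 [SE|SE]]]]] h1 h2; subst S;
  rewrite ?card_even_shape1 ?card_even_shape2 ltn_pmul2l // ltnNge;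
  apply/negP => rs.
  apply: (even1_not_lifts1 SX s1).
  by apply: lifts_le (h1 _ _); [move=> m x; apply: filt1_le; lia|lia].
have := is_C_tr SX; rewrite shape_tr_even2 => SX'.
apply: (even1_not_lifts1 SX' s1); rewrite lifts_tr.
by apply: lifts_le (h2 _ _); [move=> m x; apply: filt2_le; lia|lia].
Qed.

End ShapeComplexes.

(** * Pure Hodge structures and direct sums *)

Section BifilteredSpaces.
Context {K : fieldType} {V : lmodType K} (F1 F2 : int -> subspace V).
Implicit Types (p q k m : int) (x : V).
Hypotheses (F1_decr : forall m x, F1 (m + 1) x -> F1 m x)
           (F2_decr : forall m x, F2 (m + 1) x -> F2 m x).

Definition bicap p q : subspace V := sub_cap (F1 p) (F2 q).

(** The vanishing of gr_{F1}^p gr_{F2}^q, written without quotients. *)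
Definition jumpfree p q :=
  forall x, bicap p q x -> sub_add (bicap (p + 1) q) (bicap p (q + 1)) x.

Let decr_le (F : int -> subspace V) :
  (forall m x, F (m + 1) x -> F m x) -> forall m m' x, m' <= m -> F m x -> F m' x.
Proof.
move=> Fd m m' x mm; have -> : m = m' + (absz (m - m')%R)%:Z by lia.
elim: (absz _) => [|n IH]; first by have -> : m' + 0%N = m' by lia.
by rewrite -addn1 PoszD addrA => /Fd.
Qed.

Let F1_le := decr_le F1_decr.
Let F2_le := decr_le F2_decr.

Variable M : int.
Hypotheses (F1_full : forall m x, m <= - M -> F1 m x)
           (F2_full : forall m x, m <= - M -> F2 m x)
           (F1_null : forall m x, M <= m -> F1 m x -> x = 0)
           (F2_null : forall m x, M <= m -> F2 m x -> x = 0).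

(** For purity, the absence of jumps above weight k kills H^{p,q} for p + q > k by descent from the
    bounds, and below weight k it spreads every H^{p,q} over the diagonal. Conversely, the
    components of an element of H^{p,q} sit between the indices p and k - q. *)
Lemma pure_jumpfree k : direct_sum (fun p => bicap p (k - p)) <->
  (forall p q, p + q != k -> jumpfree p q).
Proof.
split=> [dV p q pqk x [F1x F2x]|jf].
  (* Such a y belongs to the two different summands with indices m and m - 1, hence is zero. *)
  have opp m y : F1 m y -> F2 (k - m + 1) y -> y = 0.
    move=> F1y F2y; rewrite -(ds_pr_id dV (i := m) (x := y)); last first.
      by split=> //; apply: F2_decr.
    apply: (ds_pr_neq dV (j := m - 1)); last by lia.
    split; first by apply: F1_le F1y; lia.
    by have -> : k - (m - 1) = k - m + 1 by lia.
  have prV i y : bicap i (k - i) (ds_pr dV i y) := ds_pr_in dV i y.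
  have pr_pr i j y : ds_pr dV i (ds_pr dV j y) = if j == i then ds_pr dV j y else 0.
    case: eqP => [->|/eqP ij]; first exact/ds_pr_id/prV.
    by apply: (ds_pr_neq dV (prV j y)); rewrite eq_sym.
  have [s [us s0 xE]] := ds_pr_dec dV x.
  have pr_sum (P : pred int) i : P i ->
      ds_pr dV i (\sum_(j <- s | P j) ds_pr dV j x) = ds_pr dV i x.
    move=> Pi; rewrite linear_sum /=.
    under eq_bigr do rewrite pr_pr.
    rewrite -big_mkcondr /= -big_filter.
    have [si|si] := boolP (i \in s).
      rewrite (_ : [seq _ <- s | _] = [:: i]) ?big_seq1 //.
      rewrite -(filter_pred1_uniq us si); apply: eq_filter => j.
      by rewrite andbC /=; case: eqP => // ->.
    rewrite s0 //; rewrite (_ : [seq _ <- s | _] = [::]) ?big_nil //.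
    rewrite -(filter_pred0 s); apply: eq_in_filter => j js /=.
    by case: eqP si => [<-|_]; rewrite ?js ?andbF.
  (* The components with index below p add up to an element of F2 at step k - p + 1 which, as x
     minus the others, is also in F1 at step p; [opp] applies. The next claim is the mirror
     image. *)
  have low i : i < p -> ds_pr dV i x = 0.
    move=> ip; rewrite -(pr_sum (fun j => j < p)) //.
    suff -> : \sum_(j <- s | j < p) ds_pr dV j x = 0 by rewrite linear0.
    apply: (opp p); last first.
      apply: sub_lin => j jp; have [_ F2j] := prV j x.
      by apply: F2_le F2j; lia.
    have xE' := xE; rewrite (bigID (fun j => j < p)) /= in xE'.
    have -> := canRL (addrK _) (esym xE').
    apply: subB => //; apply: sub_lin => j jp; have [F1j _] := prV j x.
    by apply: F1_le F1j; lia.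
  have high i : k - q < i -> ds_pr dV i x = 0.
    move=> ip; rewrite -(pr_sum (fun j => k - q < j)) //.
    suff -> : \sum_(j <- s | k - q < j) ds_pr dV j x = 0 by rewrite linear0.
    apply: (opp (k - q + 1)).
      apply: sub_lin => j jp; have [F1j _] := prV j x.
      by apply: F1_le F1j; lia.
    have xE' := xE; rewrite (bigID (fun j => k - q < j)) /= in xE'.
    have -> := canRL (addrK _) (esym xE').
    apply: subB => //; first by apply: F2_le F2x; lia.
    apply: sub_lin => j jp; have [_ F2j] := prV j x.
    by apply: F2_le F2j; lia.
  rewrite xE; apply: sub_lin => i _; have [F1i F2i] := prV i x.
  have [/low ->|pi] := ltP i p; first exact: sub0.
  have [/high ->|iq] := ltP (k - q) i; first exact: sub0.
  (* For i = p, the inequality q <= k - p is strict because p + q differs from k, so the component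
     gains a step of F2; for larger i it gains a step of F1. *)
  have [ip|ip] := eqVneq i p.
    by apply: sub_addr; split; [apply: F1_le F1i; lia|apply: F2_le F2i; lia].
  by apply: sub_addl; split; [apply: F1_le F1i; lia|apply: F2_le F2i; lia].
have big0 p q x : k < p + q -> bicap p q x -> x = 0.
  have [n] := ubnP (absz (2 * M - p - q)%R).
  elim: n p q x => // n IH p q x; rewrite ltnS => nM kpq Vx.
  have [Mp|pM] := leP M p; first by case: Vx => /(F1_null Mp).
  have [Mq|qM] := leP M q; first by case: Vx => _ /(F2_null Mq).
  have [|y [z [Vy Vz ->]]] := jf p q _ x Vx; first by lia.
  have -> : y = 0 by apply: (IH (p + 1) q) => //; lia.
  have -> : z = 0 by apply: (IH p (q + 1)) => //; lia.
  exact: addr0.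
pose S := sub_sum (fun=> True) (fun p => bicap p (k - p)).
have small p q x : p + q <= k -> bicap p q x -> S x.
  have [n] := ubnP (absz (k - p - q)%R).
  elim: n p q x => // n IH p q x; rewrite ltnS => nM kpq Vx.
  have [pqk|pqk] := eqVneq (p + q) k.
    apply: (@sub_sum_in _ _ _ _ _ p) => //.
    by have -> : k - p = q by lia.
  have [//|y [z [Vy Vz ->]]] := jf p q _ x Vx.
  by apply: subD; [apply: (IH (p + 1) q)|apply: (IH p (q + 1))] => //; lia.
split=> [x|s w us Vw].
  pose m := - (`|M| + `|k|).
  by apply: (small m m); [lia|split; [apply: F1_full|apply: F2_full]; lia].
have [n] := ubnP (size s); elim: n s us Vw => // n IH s us Vw; rewrite ltnS => sn w0.
have [->//|s0] := eqVneq s [::].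
have [p ps p_min] : exists2 p, p \in s & forall i, i \in s -> p <= i.
  elim: {us Vw sn w0} s s0 => // a [|b s] IHs _.
    by exists a => [|i]; rewrite inE // => /eqP ->.
  have [//|p ps pm] := IHs; have [ap|pa] := leP a p.
    exists a => [|i]; rewrite inE ?eqxx // => /orP[/eqP -> //|/pm]; lia.
  by exists p => [|i]; rewrite inE ?ps ?orbT // => /orP[/eqP ->|/pm //]; lia.
(* With p minimal in the support, w p is minus a sum of terms in F1 at step p + 1, so it has weight
   at least k + 1 and [big0] applies. *)
have wp0 : w p = 0.
  apply: (@big0 (p + 1) (k - p)); first by lia.
  have [F1p F2p] := Vw p ps; split=> //.
  move: w0; rewrite (bigD1_seq p) //= => /eqP; rewrite addr_eq0 => /eqP ->.
  apply: subN; rewrite big_seq_cond; apply: sub_lin => i /andP[si ip].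
  have [F1i _] := Vw i si; apply: F1_le F1i; have := p_min i si; lia.
move=> i si; have [-> //|ip] := eqVneq i p.
apply: (IH (rem p s)).
- exact: rem_uniq.
- by move=> j /mem_rem; apply: Vw.
- by rewrite size_rem // prednK //; case: (s) s0.
- by move: w0; rewrite (big_rem p) //= wp0 add0r.
by rewrite mem_rem_uniq // !inE ip.
Qed.

End BifilteredSpaces.

Section Morphisms.
Context {K : fieldType} {A B : dcomplex K} (f : {linear A -> B}).
Hypothesis fM : dc_morphism f.

Lemma morph_part P x : dc_part A P x -> dc_part B P (f x).
Proof.
have [fc _ _] := fM; pose U := sub_preim f (dc_part B P).
apply: (@sub_sum_min _ _ _ _ _ U) => i v Pi Wv.
exact: (@sub_sum_in _ _ _ P (fun x => dc_comp B x.1 x.2) i _ Pi (fc _ _ _ Wv)).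
Qed.

Lemma morph_dtot x : f (dtot A x) = dtot B (f x).
Proof. by have [_ f1 f2] := fM; rewrite !dtotE linearD f1 f2. Qed.

Lemma morph_cocycle n x : dR_cocycle A n x -> dR_cocycle B n (f x).
Proof.
case=> Tx; rewrite sub_preimE => dx; split; first exact: morph_part.
by rewrite sub_preimE -morph_dtot dx linear0.
Qed.

Lemma morph_cobound n x : dR_cobound A n x -> dR_cobound B n (f x).
Proof.
by case=> u [Tu ->]; exists (f u); split; [apply: morph_part|apply: morph_dtot].
Qed.

Lemma morph_pr i x : dc_pr B i (f x) = f (dc_pr A i x).
Proof.
have [fc _ _] := fM; apply: (@ds_pr_comm _ _ _ _ _ _ _ _ _ id) => // j y.
exact: fc.
Qed.

End Morphisms.

Section HodgeClasses.
Context {K : fieldType} (A : dcomplex K).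
Implicit Types (d p q m : int).

(** Hodge classes are handled through cocycles of [A], so that morphisms and finite sums act on them
    directly rather than through induced maps of subquotients. *)
Definition hodge_type d p q x :=
  [/\ dR_cocycle A d x,
      exists u, [/\ filt1 A p u, dR_cocycle A d u & dR_cobound A d (x - u)]
    & exists v, [/\ filt2 A q v, dR_cocycle A d v & dR_cobound A d (x - v)]].

Lemma Hpq_class d p q x : dR_cocycle A d x ->
  Hpq A d p q (sq_class (dR_cocycle A d) (dR_cobound A d) x) <->
  hodge_type d p q x.
Proof.
move=> Zx; rewrite HpqP; split.
  case=> -[u Fu [Zu /sq_class_eq]] xu [v Fv [Zv /sq_class_eq]] xv.
  by split=> //; [exists u|exists v]; split=> //; [apply: xu|apply: xv].
case=> _ [u [Fu Zu Bxu]] [v [Fv Zv Bxv]].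
by split; [exists u|exists v] => //; split=> //; apply/sq_class_eq.
Qed.

Definition hodge_jumpfree d p q := forall x, hodge_type d p q x ->
  exists y z, [/\ hodge_type d (p + 1) q y, hodge_type d p (q + 1) z
    & dR_cobound A d (x - (y + z))].

Lemma hodge_jumpfreeP d p q :
  jumpfree (hodge1 A d) (hodge2 A d) p q <-> hodge_jumpfree d p q.
Proof.
pose cls x := sq_class (dR_cocycle A d) (dR_cobound A d) x.
have clsD x y : dR_cocycle A d x -> dR_cocycle A d y ->
    cls (x + y) = cls x + cls y.
  by move=> Zx Zy; rewrite -[x]scale1r /cls sq_classP ?scale1r.
split=> [jf x xpq|jf h].
  have Zx : dR_cocycle A d x by case: xpq.
  have [y [z [hy hz e]]] := jf _ (proj2 (Hpq_class p q Zx) xpq).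
  rewrite -(sq_reprK y) -(sq_reprK z) in e hy hz.
  have Zy := sq_reprP y; have Zz := sq_reprP z.
  exists (sq_repr y), (sq_repr z); split; [exact/Hpq_class|exact/Hpq_class|].
  have Zyz : dR_cocycle A d (sq_repr y + sq_repr z) by apply: subD.
  by apply/(sq_class_eq _ Zx Zyz); rewrite e -clsD.
rewrite -(sq_reprK h); have Zh := sq_reprP h.
move/(Hpq_class _ _ Zh)/jf => [y [z [hy hz e]]].
have [Zy _ _] := hy; have [Zz _ _] := hz.
exists (cls y), (cls z); split; [exact/Hpq_class|exact/Hpq_class|].
have Zyz : dR_cocycle A d (y + z) by apply: subD.
by rewrite -clsD //; apply/(sq_class_eq _ Zh Zyz).
Qed.

Lemma HdR_eq0 d : (forall h : HdR A d, h = 0) <->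
  (forall x, dR_cocycle A d x -> dR_cobound A d x).
Proof.
split=> [h0 x Zx|ZB h].
  have /sq_class_eq := h0 (sq_class (dR_cocycle A d) (dR_cobound A d) x).
  by rewrite subr0; apply=> //; apply: sub0.
rewrite -(sq_reprK h); apply/sq_class_eq; [exact: sq_reprP|exact: sub0|].
by rewrite subr0; apply/ZB/sq_reprP.
Qed.

Hypothesis A_bounded : bounded A.

Lemma filt2_bounded : exists M : int, 0 <= M /\
  (forall m x, m <= - M -> filt2 A m x) /\
  (forall m x, M <= m -> filt2 A m x -> x = 0).
Proof.
have [M [M0 [h1 h2]]] := filt1_bounded (bounded_tr A_bounded).
exists M; split=> //; split=> m x.
  by move=> /h1 h; rewrite -filt1_tr; apply: h.
by move=> /h2 h; rewrite -filt1_tr; apply: h.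
Qed.

Lemma hodge1_decr d m h : hodge1 A d (m + 1) h -> hodge1 A d m h.
Proof.
by case=> x [Fx Zx ->]; exists x; split=> //; apply: filt1_le Fx; lia.
Qed.

Lemma hodge2_decr d m h : hodge2 A d (m + 1) h -> hodge2 A d m h.
Proof.
by case=> x [Fx Zx ->]; exists x; split=> //; apply: filt2_le Fx; lia.
Qed.

Lemma hodge_bounded d : exists M : int, 0 <= M /\
  [/\ forall m h, m <= - M -> hodge1 A d m h, forall m h, m <= - M -> hodge2 A d m h,
      forall m h, M <= m -> hodge1 A d m h -> h = 0
    & forall m h, M <= m -> hodge2 A d m h -> h = 0].
Proof.
have [M1 [M10 [h1 h1']]] := filt1_bounded A_bounded.
have [M2 [M20 [h2 h2']]] := filt2_bounded.
exists (M1 + M2); split; first by lia.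
split=> m h mM.
- exists (sq_repr h); split; [apply: h1; lia|exact: sq_reprP|].
  by rewrite sq_reprK.
- exists (sq_repr h); split; [apply: h2; lia|exact: sq_reprP|].
  by rewrite sq_reprK.
- by case=> x [Fx _ ->]; rewrite (h1' _ _ _ Fx) //; lia.
by case=> x [Fx _ ->]; rewrite (h2' _ _ _ Fx) //; lia.
Qed.

Lemma pure_hodgeP d k : pure_hodge A d k <->
  (forall p q, p + q != k -> hodge_jumpfree d p q).
Proof.
have [M [M0 [h1 h2 h3 h4]]] := hodge_bounded d.
have := pure_jumpfree (@hodge1_decr d) (@hodge2_decr d) h1 h2 h3 h4 k.
move=> h; split=> [/h jf p q /jf /hodge_jumpfreeP//|jf].
by apply/h => p q /jf /hodge_jumpfreeP.
Qed.

End HodgeClasses.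

Lemma morph_hodge_type (K : fieldType) (A B : dcomplex K) (f : {linear A -> B})
  d p q x : dc_morphism f -> hodge_type d p q x -> hodge_type d p q (f x).
Proof.
move=> fM [Zx [u [Fu Zu Bu]] [v [Fv Zv Bv]]]; split.
- exact: morph_cocycle Zx.
- exists (f u); rewrite -linearB.
  by split; [apply: morph_part Fu|apply: morph_cocycle Zu|apply: morph_cobound Bu].
exists (f v); rewrite -linearB.
by split; [apply: morph_part Fv|apply: morph_cocycle Zv|apply: morph_cobound Bv].
Qed.

Lemma hodge_typeD (K : fieldType) (A : dcomplex K) d p q (x y : A) :
  hodge_type d p q x -> hodge_type d p q y -> hodge_type d p q (x + y).
Proof.
case=> Zx [u [Fu Zu Bu]] [v [Fv Zv Bv]] [Zy [u' [Fu' Zu' Bu']] [v' [Fv' Zv' Bv']]].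
split; first exact: subD.
  exists (u + u'); split; [exact: subD|exact: subD|].
  by rewrite opprD addrACA; apply: subD.
exists (v + v'); split; [exact: subD|exact: subD|].
by rewrite opprD addrACA; apply: subD.
Qed.

Lemma hodge_type0 (K : fieldType) (A : dcomplex K) d p q :
  hodge_type d p q (0 : A).
Proof.
split; first exact: sub0.
  by exists 0; rewrite subrr; split; apply: sub0.
by exists 0; rewrite subrr; split; apply: sub0.
Qed.

(** * Passage to and from direct summands *)

Section Retracts.
Context {K : fieldType} {A X : dcomplex K}.
Context (f : {linear X -> A}) (g : {linear A -> X}).
Hypotheses (fM : dc_morphism f) (gM : dc_morphism g) (gf : cancel f g).

(** [F] is a filtration given for every double complex and respected by [f] and [g], so that one
    proof serves both [filt1] and [filt2]. *)
Lemma lifts_retract (F : forall Y : dcomplex K, int -> subspace Y) r a n :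
  (forall m x, F X m x -> F A m (f x)) -> (forall m x, F A m x -> F X m (g x)) ->
  lifts (F A) r a n -> lifts (F X) r a n.
Proof.
move=> Ff Fg h x Fx Tx Fdx; have [||| z [Fz Zz Fxz]] := h (f x).
- exact: Ff.
- exact: morph_part.
- by rewrite -morph_dtot //; apply: Ff.
exists (g z); split; [exact: Fg|exact: morph_cocycle Zz|].
by rewrite -[x]gf -linearB; apply: Fg.
Qed.

Lemma hodge_jumpfree_retract d p q :
  hodge_jumpfree A d p q -> hodge_jumpfree X d p q.
Proof.
move=> h x /(morph_hodge_type fM)/h[y [z [hy hz Bxyz]]].
exists (g y), (g z); split; [exact: morph_hodge_type hy|exact: morph_hodge_type hz|].
by rewrite -[x]gf -linearD -linearB; apply: morph_cobound Bxyz.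
Qed.

End Retracts.

Section DirectSums.
Context {K : fieldType} {A : dcomplex K} {I : eqType} {X : I -> dcomplex K}.

(** The projections onto the summands commute with every map that preserves the summands, in
    particular with the differentials and the bidegree projections. Hence the corestricted
    projections [g] are morphisms. *)
Lemma iso_direct_sum_retracts : iso_direct_sum A X ->
  exists (f : forall i, {linear X i -> A}) (g : forall i, {linear A -> X i}),
    [/\ forall i, dc_morphism (f i), forall i, dc_morphism (g i),
        forall i, cancel (f i) (g i)
      & forall x, exists s, x = \sum_(i <- s) f i (g i x)].
Proof.
case=> f [fM f_inj dA]; pose P := ds_pr dA.
have g_ex i : exists g : {linear A -> X i}, forall x, P i x = f i (g x).
  apply: (@linear_of_rel _ _ _ (fun x y => P i x = f i y)) =>
      [x|x y y' -> /f_inj //|a x x' y y' Py Py'].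
    by have [y [_ ->]] := ds_pr_in dA i x; exists y.
  by rewrite !linearP Py Py'.
pose g i := sval (cid (g_ex i)); have gP i : forall x, P i x = f i (g i x).
  exact: svalP (cid (g_ex i)).
have Pf i y : P i (f i y) = f i y by apply: ds_pr_id; exists y.
have Pcomm (h : {linear A -> A}) (h' : forall i, X i -> X i) :
    (forall i x, h (f i x) = f i (h' i x)) -> forall i x, P i (h x) = h (P i x).
  move=> hf i x; apply: (@ds_pr_comm _ _ _ _ _ _ _ dA dA id) => // j _ [y [_ ->]].
  by exists (h' j y); rewrite hf.
exists f, g; split=> // i.
- split=> [p q x Ax|x|x].
  + apply/compP => j jpq; apply: f_inj.
    rewrite -(morph_pr (fM i)) -gP -(Pcomm _ (fun i => dc_pr (X i) j)).
      by rewrite (dc_pr_neq Ax jpq) !linear0.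
    by move=> k y; rewrite (morph_pr (fM k)).
  + apply: f_inj; have [_ -> _] := fM i; rewrite -!gP.
    by apply: (Pcomm _ (fun i => dc_d1 (X i))) => k y; have [_ -> _] := fM k.
  apply: f_inj; have [_ _ ->] := fM i; rewrite -!gP.
  by apply: (Pcomm _ (fun i => dc_d2 (X i))) => k y; have [_ _ ->] := fM k.
- by move=> y; apply: f_inj; rewrite -gP.
have [s [_ _ xE]] := ds_pr_dec dA i.
by exists s; rewrite {1}xE; apply: eq_bigr => j _; apply: gP.
Qed.

Context {f : forall i, {linear X i -> A}} {g : forall i, {linear A -> X i}}.
Hypotheses (fM : forall i, dc_morphism (f i)) (gM : forall i, dc_morphism (g i))
  (dec : forall x, exists s, x = \sum_(i <- s) f i (g i x)).

Lemma lifts_sum (F : forall Y : dcomplex K, int -> subspace Y) r a n :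
  (forall i m x, F (X i) m x -> F A m (f i x)) ->
  (forall i m x, F A m x -> F (X i) m (g i x)) ->
  (forall i, lifts (F (X i)) r a n) -> lifts (F A) r a n.
Proof.
move=> Ff Fg h x Fx Tx Fdx.
have z_ex i : exists z,
    [/\ F (X i) a z, dR_cocycle (X i) n z & F (X i) (a + 1) (g i x - z)].
  apply: h; [exact: Fg|exact: (morph_part (gM i))|].
  by rewrite -(morph_dtot (gM i)); apply: Fg.
pose z i := sval (cid (z_ex i)).
have zP i : [/\ F (X i) a (z i), dR_cocycle (X i) n (z i)
    & F (X i) (a + 1) (g i x - z i)] by exact: svalP (cid (z_ex i)).
have [s xE] := dec x; exists (\sum_(i <- s) f i (z i)); split.
- by apply: sub_lin => i _; have [Fz _ _] := zP i; apply: Ff.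
- by apply: sub_lin => i _; have [_ Zz _] := zP i; apply: morph_cocycle Zz.
rewrite {1}xE -sumrB; apply: sub_lin => i _; have [_ _ Fxz] := zP i.
by rewrite -linearB; apply: Ff.
Qed.

Lemma hodge_jumpfree_sum d p q :
  (forall i, hodge_jumpfree (X i) d p q) -> hodge_jumpfree A d p q.
Proof.
move=> h x xpq; have [s ->] := dec x.
elim: s => [|i s [y [z [hy hz Bxyz]]]].
  exists 0, 0; rewrite big_nil addr0 subr0.
  by split; [apply: hodge_type0|apply: hodge_type0|apply: sub0].
have [y' [z' [hy' hz' B']]] := h i _ (morph_hodge_type (gM i) xpq).
exists (f i y' + y), (f i z' + z); split.
- by apply: hodge_typeD => //; apply: morph_hodge_type hy'.
- by apply: hodge_typeD => //; apply: morph_hodge_type hz'.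
rewrite big_cons addrACA opprD addrACA; apply: subD => //.
by rewrite -linearD -linearB; apply: morph_cobound B'.
Qed.

End DirectSums.

Section HodgeOfShapes.
Context {K : fieldType}.
Implicit Types (X : dcomplex K) (S : {fset int * int}) (d p q n : int).

Lemma jumpfree_cobound X d p q :
  (forall x, dR_cocycle X d x -> dR_cobound X d x) -> hodge_jumpfree X d p q.
Proof.
move=> ZB x [Zx _ _]; exists 0, 0.
rewrite addr0 subr0; split; [exact: hodge_type0|exact: hodge_type0|exact: ZB].
Qed.

Lemma odd_filt2 d p q X (x : X) : is_C (odd_shape d p q) X -> dR_cocycle X d x ->
  exists u, [/\ filt2 X q u, dR_cocycle X d u & dR_cobound X d (x - u)].
Proof.
move=> /is_C_tr; rewrite shape_tr_odd => SX Zx.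
have [|u] := @odd_filt1 _ _ _ _ (dc_tr X) x SX; first by rewrite dR_cocycle_tr.
by rewrite filt1_tr dR_cocycle_tr dR_cobound_tr; exists u.
Qed.

Lemma odd_filt2_cobound d p q X m (x : X) : is_C (odd_shape d p q) X ->
  dR_cocycle X d x -> filt2 X m x -> q < m -> dR_cobound X d x.
Proof.
move=> /is_C_tr; rewrite shape_tr_odd => SX Zx Fx qm.
rewrite -dR_cobound_tr; apply: odd_filt1_cobound SX _ _ qm.
  by rewrite dR_cocycle_tr.
by rewrite filt1_tr.
Qed.

(** The nonzero space H^d lies in F_1^p0 and F_2^q0 and meets F_1^(p0+1) and F_2^(q0+1) trivially,
    so both filtrations jump only there. *)
Lemma odd_jumpfree d p0 q0 X p q : is_C (odd_shape d p0 q0) X ->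
  hodge_jumpfree X d p q <-> (p, q) != (p0, q0).
Proof.
move=> SX; have full p' q' x : p' <= p0 -> q' <= q0 -> dR_cocycle X d x ->
    hodge_type d p' q' x.
  move=> pp qq Zx; split=> //.
    have [u [Fu Zu Bu]] := odd_filt1 SX Zx; exists u; split=> //.
    exact: filt1_le Fu.
  have [u [Fu Zu Bu]] := odd_filt2 SX Zx; exists u; split=> //.
  exact: filt2_le Fu.
have null p' q' x : (p0 < p') || (q0 < q') -> hodge_type d p' q' x ->
    dR_cobound X d x.
  move=> pq [Zx [u [Fu Zu Bu]] [v [Fv Zv Bv]]]; case/orP: pq => pq.
    exact: sub_subE Bu (odd_filt1_cobound SX Zu Fu pq).
  exact: sub_subE Bv (odd_filt2_cobound SX Zv Fv pq).
split=> [jf|pq x].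
  apply/eqP => -[pE qE]; have [x Zx] := odd_HdR SX; apply.
  have [|y [z [hy hz Bxyz]]] := jf x; first by apply: full; rewrite ?pE ?qE.
  apply: (sub_subE Bxyz); apply: subD.
    by apply: null hy; rewrite pE ltzD1 lexx.
  by apply: null hz; rewrite qE ltzD1 lexx orbT.
have [np hx|np hx] := boolP ((p0 < p) || (q0 < q)).
  exists 0, 0; rewrite addr0 subr0.
  by split; [apply: hodge_type0|apply: hodge_type0|apply: null hx].
have [Zx _ _] := hx; rewrite xpair_eqE in pq; have [pp|pp] := ltP p p0.
  exists x, 0; rewrite addr0 subrr.
  by split; [apply: full => //; lia|apply: hodge_type0|apply: sub0].
exists 0, x; rewrite add0r subrr.
by split; [apply: hodge_type0|apply: full => //; lia|apply: sub0].
Qed.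

End HodgeOfShapes.

(** * Bases and zigzag representations *)

Section RelativeBases.
Context {K : fieldType} {V : lmodType K}.
Implicit Types (U W : subspace V).

Section Families.
Context {I : eqType}.
Implicit Types (P : I -> Prop) (e : I -> V).

Definition lspan P e : subspace V.
Proof.
exists (fun x => exists (s : seq I) (c : I -> K), [/\ uniq s,
  forall i, i \in s -> P i & x = \sum_(i <- s) c i *: e i]).
  by exists [::], (fun=> 0); rewrite big_nil.
move=> a _ _ [s [c [us Ps ->]]] [t [b [ut Pt ->]]].
exists (undup (s ++ t)), (fun i => a * (if i \in s then c i else 0) +
  (if i \in t then b i else 0)); split; first exact: undup_uniq.
  by move=> i; rewrite mem_undup mem_cat => /orP[/Ps|/Pt].
under [RHS]eq_bigr do rewrite scalerDl -scalerA.
rewrite big_split -scaler_sumr; congr (_ *: _ + _); apply/esym.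
  rewrite (@big_uniq_widen _ _ s) ?undup_uniq //.
  - by rewrite big_seq [RHS]big_seq; apply: eq_bigr => i ->.
  - by move=> i; rewrite mem_undup mem_cat => ->.
  by move=> i /negbTE ->; rewrite scale0r.
rewrite (@big_uniq_widen _ _ t) ?undup_uniq //.
- by rewrite big_seq [RHS]big_seq; apply: eq_bigr => i ->.
- by move=> i; rewrite mem_undup mem_cat => ->; rewrite orbT.
by move=> i /negbTE ->; rewrite scale0r.
Defined.

Lemma lspan_in P e i : P i -> lspan P e (e i).
Proof.
move=> Pi; exists [:: i], (fun=> 1); rewrite big_seq1 scale1r; split=> // j.
by rewrite inE => /eqP ->.
Qed.

Lemma lspan_min P e W : (forall i, P i -> W (e i)) ->
  forall x, lspan P e x -> W x.
Proof.
by move=> PW x [s [c [_ Ps ->]]]; apply: sub_lin_seq => i /Ps/PW; apply: subZ.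
Qed.

Definition rel_free U P e := forall (s : seq I) (c : I -> K), uniq s ->
  (forall i, i \in s -> P i) -> U (\sum_(i <- s) c i *: e i) ->
  forall i, i \in s -> c i = 0.

Definition rel_basis U W P e :=
  [/\ forall i, P i -> W (e i), rel_free U P e
    & forall x, W x -> sub_add U (lspan P e) x].

Lemma rel_free_notin U P e i : rel_free U P e -> P i -> ~ U (e i).
Proof.
move=> fe Pi Uei; have /eqP : (1 : K) = 0; last by rewrite oner_eq0.
apply: (fe [:: i] (fun=> 1) _ _ _ i); rewrite ?mem_head ?big_seq1 ?scale1r //.
by move=> j; rewrite inE => /eqP ->.
Qed.

Lemma rel_free_inj U P e i j : rel_free U P e -> P i -> P j -> U (e i - e j) ->
  i = j.
Proof.
move=> fe Pi Pj Uij; have [//|ij] := eqVneq i j; pose c k : K := if k == i then 1 else -1.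
suff /(_ i (mem_head _ _)) : forall k, k \in [:: i; j] -> c k = 0.
  by rewrite /c eqxx => /eqP; rewrite oner_eq0.
apply: fe => [|k|]; first by rewrite /= inE ij.
  by rewrite !inE => /orP[] /eqP ->.
rewrite big_cons big_seq1 /c eqxx eq_sym (negbTE ij).
by rewrite scale1r scaleN1r.
Qed.

Lemma rel_basis_trans U0 U1 U2 P1 P2 e :
  (forall x, U0 x -> U1 x) -> (forall x, U1 x -> U2 x) ->
  rel_basis U0 U1 P1 e -> rel_basis U1 U2 P2 e ->
  rel_basis U0 U2 (fun i => P1 i \/ P2 i) e.
Proof.
move=> U01 U12 [U1e f1 s1] [U2e f2 s2]; split=> [i [/U1e/U12|/U2e]//||x].
  move=> s c us Ps Us; pose p i := `[< P2 i >].
  have c2 i : i \in [seq j <- s | p j] -> c i = 0.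
    move: i; apply: f2; [exact: filter_uniq| |].
      by move=> i; rewrite mem_filter => /andP[/asboolP].
    rewrite big_filter; move: (U01 _ Us); rewrite (bigID p) /=.
    rewrite -[X in U1 (_ + X)]opprK => /sub_subE; apply; apply: subN.
    rewrite big_seq_cond; apply: sub_lin => i /andP[si /asboolP nP2].
    by apply/subZ/U1e; case: (Ps i si).
  have c1 i : i \in [seq j <- s | ~~ p j] -> c i = 0.
    move: i; apply: f1; [exact: filter_uniq| |].
      move=> i; rewrite mem_filter => /andP[/asboolP nP2 /Ps[]//].
    move: Us; rewrite big_filter (bigID p) /= -big_filter big_seq big1 ?add0r //.
    by move=> i /c2 ->; rewrite scale0r.
  move=> i si; have [pi|pi] := boolP (p i).
    by apply: c2; rewrite mem_filter pi.
  by apply: c1; rewrite mem_filter pi.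
move=> /s2[y [z [/s1[t [u [Ut Pu ->]]] Pz ->]]]; exists t, (u + z); split=> //.
  apply: subD; [move: Pu|move: Pz]; apply: lspan_min => i Pi; apply: lspan_in.
    by left.
  by right.
by rewrite addrA.
Qed.

End Families.

(** Zorn's lemma is applied to the sets that can be added to [E0] without losing independence modulo
    U. *)
Lemma rel_free_extend U W (E0 : V -> Prop) :
  (forall v, E0 v -> W v) -> rel_free U E0 id ->
  exists E : V -> Prop, (forall v, E0 v -> E v) /\ rel_basis U W E id.
Proof.
move=> E0W fE0.
pose good (A : set V) := (A `<=` (W : V -> Prop)) /\
  rel_free U (fun v => E0 v \/ A v) id.
have [F Fgood Ftot|A [[AW fA] Amax]] := @Zorn_bigcup V good.
  split=> [v [X FX Xv]|s c us Ps]; first by case: (Fgood _ FX) => + _; apply.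
  have [X [goodX sX]] : exists X, good X /\ forall i, i \in s -> E0 i \/ X i.
    (* A finite list of vectors in the union of a chain lies in one member of it; [set0] stands in
       when the chain is empty or only [E0] is used. *)
    suff [X [FX sX]] : exists X, (F X \/ X = set0) /\
        forall i, i \in s -> E0 i \/ X i.
      exists X; split=> //; case: FX => [/Fgood //|->]; split=> [v []|].
      move=> t b ut Pt; apply: fE0 => // i /Pt[//|[]].
    elim: s {us} Ps => [|v s IH] Ps; first by exists set0; split=> //; right.
    have [|X [FX sX]] := IH; first by move=> i si; apply: Ps; rewrite inE si orbT.
    have [E0v|[Y FY Yv]] := Ps v (mem_head _ _).
      by exists X; split=> // i; rewrite inE => /orP[/eqP ->|/sX//]; left.
    case: FX => [FX|X0]; last first.
      exists Y; split; [by left|move=> i; rewrite inE => /orP[/eqP ->|/sX]].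
        by right.
      by rewrite X0 => -[|[]]; left.
    case: (Ftot X Y FX FY) => [XY|YX].
      exists Y; split; [by left|move=> i; rewrite inE => /orP[/eqP ->|/sX]].
        by right.
      by case=> [|/XY]; [left|right].
    exists X; split; [by left|move=> i; rewrite inE => /orP[/eqP ->|/sX //]].
    by right; apply: YX.
  by case: goodX => _; apply.
exists (fun v => E0 v \/ A v); split=> [v|]; first by left.
split=> [v [/E0W|/AW]//|//|x Wx]; apply: contrapT => nx.
have Ax : ~ A x.
  by move=> Ax; apply: nx; apply/sub_addr/(@lspan_in V _ id x); right.
apply: (Amax (A `|` [set x])).
  rewrite properEneq; split; last by move=> v; left.
  by apply/eqP => e; apply: Ax; rewrite e; right.
split=> [v [/AW//|->//]|s c us Ps Us].
(* A relation with nonzero coefficient at x could be solved for x and would place it in U plus the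
   span, which [nx] excludes. *)
have cx : x \in s -> c x = 0.
  move=> xs; apply: contrapT => /eqP cx0; apply: nx.
  move: Us; rewrite (bigD1_seq x) //= => Us.
  have L : lspan (fun v => E0 v \/ A v) id
      (- ((c x)^-1 *: \sum_(i <- s | i != x) c i *: i)).
    apply: subN; apply: subZ; rewrite big_seq_cond.
    apply: sub_lin => i /andP[si ix]; apply/subZ/(@lspan_in V _ id i).
    case: (Ps i si) => [|[|/= ie]]; [by left|by right|].
    by rewrite ie eqxx in ix.
  exists ((c x)^-1 *: (c x *: x + \sum_(i <- s | i != x) c i *: i)),
    (- ((c x)^-1 *: \sum_(i <- s | i != x) c i *: i)); split=> //.
    exact: subZ.
  by rewrite scalerDr scalerA mulVf // scale1r addrK.
move=> i si; have [ix|ix] := eqVneq i x; first by rewrite ix cx -?ix.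
apply: (fA (rem x s)).
- exact: rem_uniq.
- move=> j; rewrite mem_rem_uniq // !inE => /andP[jx /Ps[|[|/= je]]]; [by left|by right|].
  by rewrite je eqxx in jx.
- have [xs|xs] := boolP (x \in s); last by rewrite rem_id.
  by move: Us; rewrite (big_rem x) //= cx // scale0r add0r.
by rewrite mem_rem_uniq // !inE ix.
Qed.

Lemma rel_basis_exists U W : exists E : V -> Prop, rel_basis U W E id.
Proof.
have [||E [_ h]] := @rel_free_extend U W (fun=> False); [by []| |by exists E].
by move=> [|v s] c _ Ps _ i //; have := Ps v (mem_head _ _).
Qed.

Lemma rel_basis_reindex (I J : eqType) U W (P : I -> Prop) (e : I -> V)
    (Q : J -> Prop) (e' : J -> V) (phi : I -> J) :
  (forall i, P i -> Q (phi i) /\ e i = e' (phi i)) ->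
  (forall i i', P i -> P i' -> phi i = phi i' -> i = i') ->
  (forall j, Q j -> exists2 i, P i & phi i = j) ->
  rel_basis U W Q e' -> rel_basis U W P e.
Proof.
move=> PQ phi_inj phi_surj [We f s]; split=> [i /PQ[Qi ->]||x].
- exact: We.
- move=> t c ut Pt Ut i ti.
  have phit : {in t &, injective phi}.
    by move=> a b /Pt Pa /Pt Pb; apply: phi_inj.
  (* The coefficients are carried along [phi], which is injective on t; 0 is the default off its
     image. *)
  pose b j := if [pick k : 'I_(size t) | phi (tnth (in_tuple t) k) == j] is Some k
    then c (tnth (in_tuple t) k) else 0.
  have bE k : k \in t -> b (phi k) = c k.
    move=> kt; rewrite /b; case: pickP => [l /eqP el|].
      by congr c; apply: phit => //; apply: mem_tnth.
    move: (kt); rewrite -index_mem => ik /(_ (Ordinal ik)).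
    by rewrite (tnth_nth i) /= nth_index ?eqxx.
  rewrite -(bE _ ti); apply: (f (map phi t)) => [||| ].
  + by rewrite map_inj_in_uniq.
  + by move=> j /mapP[k /Pt/PQ[Qk _] ->].
  + rewrite big_map; move: Ut; congr (in_sub U _).
    rewrite [LHS]big_seq [RHS]big_seq; apply: eq_bigr => k kt; rewrite bE //.
    by have [_ ->] := PQ k (Pt k kt).
  exact: map_f.
move=> /s[u [v [Uu Qv ->]]]; exists u, v; split=> //.
move: v Qv; apply: lspan_min => j /phi_surj[i Pi <-].
by have [_ <-] := PQ i Pi; apply: lspan_in.
Qed.

Lemma rel_basis_null_neq0 (I : eqType) W (P : I -> Prop) (e : I -> V) i :
  rel_basis (sub_null V) W P e -> P i -> e i <> 0.
Proof. by case=> _ f _ Pi; apply: (rel_free_notin f Pi). Qed.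

Lemma rel_basis_chain (U : nat -> subspace V) (E : nat -> V -> Prop) a n :
  (forall k x, (a <= k < a + n)%N -> U k x -> U k.+1 x) ->
  (forall k, (a <= k < a + n)%N -> rel_basis (U k) (U k.+1) (E k) id) ->
  rel_basis (U a) (U (a + n)%N)
    (fun v => exists k, (a <= k < a + n)%N /\ E k v) id.
Proof.
elim: n => [|n IH] Um EB.
  rewrite addn0; split=> [v [k [ka _]]|s c us Ps Us i si|x Ux].
  - by lia.
  - by have [k [ka _]] := Ps i si; lia.
  exact: sub_addl.
have le b x : (b <= n)%N -> U a x -> U (a + b)%N x.
  elim: b => [|b IHb] bn Ux; rewrite ?addn0 // addnS.
  by apply: Um; [lia|apply: IHb => //; lia].
have h1 : rel_basis (U a) (U (a + n)%N)
    (fun v => exists k, (a <= k < a + n)%N /\ E k v) id.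
  by apply: IH => [k x|k] ka; [apply: Um|apply: EB]; lia.
have h2 : rel_basis (U (a + n)%N) (U (a + n.+1)%N) (E (a + n)%N) id.
  by rewrite addnS; apply: EB; lia.
have := rel_basis_trans (le n ^~ (leqnn n)) _ h1 h2; rewrite addnS.
have -> : (fun v : V => (exists k, (a <= k < a + n)%N /\ E k v) \/ E (a + n)%N v)
    = (fun v => exists k, (a <= k < (a + n).+1)%N /\ E k v).
  apply/funext => v; apply/propext; split=> [[[k [ka Ev]]|Ev]|[k [ka Ev]]].
  - by exists k; split=> //; lia.
  - by exists (a + n)%N; split=> //; lia.
  have [kn|kn] := ltnP k (a + n); first by left; exists k; split=> //; lia.
  by right; have -> : (a + n)%N = k by lia.
by apply=> x; apply: Um; lia.
Qed.

End RelativeBases.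

(** The hypotheses make f induce an injection W/U -> W'/U'. A family in W whose image is a basis of
    the target is then itself a basis. *)
Lemma rel_basis_comap (K : fieldType) (V V' : lmodType K) (f : {linear V -> V'})
    (U W : subspace V) (U' W' : subspace V') (I : eqType) (P : I -> Prop)
    (e : I -> V) :
  (forall i, P i -> W (e i)) -> (forall x, U x -> U' (f x)) ->
  (forall x, W x -> W' (f x)) -> (forall x, W x -> U' (f x) -> U x) ->
  rel_basis U' W' P (f \o e) -> rel_basis U W P e.
Proof.
move=> We UU' WW' U'U [_ fr sp]; split=> // [s c us Ps /UU'|x Wx].
  by rewrite linear_sum; under eq_bigr do rewrite linearZ; apply: fr.
have [u [v [U'u [s [c [us Ps ->]]] fx]]] := sp _ (WW' _ Wx).
exists (x - \sum_(i <- s) c i *: e i), (\sum_(i <- s) c i *: e i).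
split; [|by exists s, c|by rewrite subrK].
apply: U'U; first by apply: subB => //; apply: sub_lin_seq => i /Ps/We; apply: subZ.
rewrite linearB fx linear_sum; under [X in _ - X]eq_bigr do rewrite linearZ.
by rewrite addrK.
Qed.

Lemma rel_basis_map (K : fieldType) (V V' : lmodType K) (f : {linear V -> V'})
    (U W : subspace V) (U' W' : subspace V') (I : eqType) (P : I -> Prop)
    (e : I -> V) :
  (forall x, U x -> U' (f x)) -> (forall x, W x -> W' (f x)) ->
  (forall x, W x -> U' (f x) -> U x) ->
  (forall y, W' y -> exists2 x, W x & U' (y - f x)) ->
  rel_basis U W P e -> rel_basis U' W' P (f \o e).
Proof.
move=> UU' WW' U'U W'W [We fr sp]; split=> [i /We/WW'//|s c us Ps U's|y].
  apply: fr => //; apply: U'U.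
    by apply: sub_lin_seq => i /Ps/We; apply: subZ.
  by rewrite linear_sum; under eq_bigr do rewrite linearZ.
move=> /W'W[x /sp[u [v [Uu Pv ->]]] Uyx].
exists (y - f v), (f v); split; last by rewrite subrK.
  rewrite linearD opprD addrA addrAC in Uyx.
  by apply: (sub_subE Uyx); apply: UU'.
by case: Pv => s [c [us Ps ->]]; exists s, c; rewrite linear_sum; split=> //;
  apply: eq_bigr => i _; rewrite linearZ.
Qed.

(** * Decomposition of alternating chains of linear maps *)

Section Strings.
Context {K : fieldType} {V : lmodType K}.
Variables (Vs : nat -> subspace V) (h : nat -> {linear V -> V}).
Hypotheses
  (h_even : forall k x, ~~ odd k -> Vs k x -> Vs k.+1 (h k x))
  (h_odd : forall k x, odd k -> Vs k.+1 x -> Vs k (h k x)).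

(** The arrow between positions k and k + 1 points right for even k and left for odd k. Only a
    nonzero source imposes a condition, so a string may begin or end at the target of an arrow. *)
Definition link k (z : nat -> V) :=
  if odd k then z k.+1 != 0 -> z k = h k (z k.+1)
  else z k != 0 -> z k.+1 = h k (z k).

Definition string n (z : nat -> V) :=
  (exists a b, (a <= b <= n)%N /\ forall k, (z k != 0) = (a <= k <= b)%N) /\
  forall k, (k < n)%N -> link k z.

(* The members of D decompose the truncation of the zigzag representation
   (Vs, h) to positions at most n. *)
Definition string_basis n (D : (nat -> V) -> Prop) :=
  (forall z, D z -> string n z) /\
  forall j, (j <= n)%N -> rel_basis (sub_null V) (Vs j)
    (fun z => D z /\ z j != 0) (fun z => z j).

Lemma string_out n z k : string n z -> (n < k)%N -> z k = 0.
Proof.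
case=> [[a [b [ab zE]]] _] nk; apply/eqP; apply/negPn; rewrite zE; lia.
Qed.

Section Extend.
(** [psi] prolongs a string by the basis vector following its right end, or by 0 when it stops
    there; the vectors of [E'] outside its image start new strings. For a right arrow [psi] is the
    map h n itself, for a left arrow a partial section of it, and new vectors must then be
    killed. *)
Variables (n : nat) (D : (nat -> V) -> Prop) (E' : V -> Prop) (psi : V -> V).
Hypothesis DB : string_basis n D.
Let E v := exists2 z, D z & z n = v /\ v != 0.
Hypotheses (E'B : rel_basis (sub_null V) (Vs n.+1) E' id)
  (psi0 : psi 0 = 0) (psiE : forall v, E v -> psi v != 0 -> E' (psi v))
  (psi_inj : forall v w, E v -> E w -> psi v = psi w -> psi v != 0 -> v = w)
  (psi_even : ~~ odd n -> forall v, E v -> psi v = h n v)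
  (psi_odd : odd n -> forall v, E v -> psi v != 0 -> v = h n (psi v))
  (psi_new : odd n -> forall v, E' v -> (forall u, E u -> psi u <> v) -> h n v = 0).

Let ext (z : nat -> V) k := if k == n.+1 then psi (z n) else z k.
Let single (v : V) k := if k == n.+1 then v else 0.
Let D' z' := (exists2 z, D z & z' = ext z) \/
  (exists2 v, E' v /\ (forall u, E u -> psi u <> v) & z' = single v).

Let ext_le z k : (k <= n)%N -> ext z k = z k.
Proof. by move=> kn; rewrite /ext; case: eqP => // ke; lia. Qed.

Let ext_top z : ext z n.+1 = psi (z n).
Proof. by rewrite /ext eqxx. Qed.

Let single_le v k : (k <= n)%N -> single v k = 0.
Proof. by move=> kn; rewrite /single; case: eqP => // ke; lia. Qed.

Let single_top v : single v n.+1 = v.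
Proof. by rewrite /single eqxx. Qed.

Let E'_neq0 v : E' v -> v != 0.
Proof. by move=> E'v; apply/eqP; apply: (rel_basis_null_neq0 E'B E'v). Qed.

Let D_string z : D z -> string n z := DB.1 z.

Let D_inj z w : D z -> D w -> z n != 0 -> z n = w n -> z = w.
Proof.
move=> Dz Dw z0 zw; have [_ fr _] := DB.2 n (leqnn n).
apply: (rel_free_inj fr); [by []|by rewrite -zw|].
by rewrite zw subrr.
Qed.

Let string_ext z : D z -> string n.+1 (ext z).
Proof.
move=> Dz; have Sz := D_string Dz; have [[a [b [ab zE]]] zL] := Sz.
have zout k : (n < k)%N -> z k = 0 by apply: string_out.
split.
  have [p0|p0] := eqVneq (psi (z n)) 0.
    exists a, b; split=> [|k]; first by lia.
    rewrite /ext; case: (k =P n.+1) => [->|_]; last exact: zE.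
    by rewrite p0 eqxx; lia.
  have zn0 : z n != 0 by apply: contraNneq p0 => ->; rewrite psi0.
  move: (zn0); rewrite zE => /andP[an nb].
  exists a, n.+1; split=> [|k]; first by lia.
  rewrite /ext; case: (k =P n.+1) => [->|/eqP kn]; first by rewrite p0; lia.
  rewrite zE; lia.
move=> k; rewrite ltnS leq_eqVlt => /orP[/eqP ->|kn]; last first.
  by have := zL k kn; rewrite /link !ext_le //; lia.
rewrite /link (ext_le z (leqnn n)) ext_top; case: ifP => on pz.
  apply: psi_odd => //; exists z => //; split=> //.
  by apply: contraNneq pz => ->; rewrite psi0.
by apply: psi_even; [rewrite on|exists z].
Qed.

Let string_single v : E' v -> (forall u, E u -> psi u <> v) ->
  string n.+1 (single v).
Proof.
move=> E'v nv; split.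
  exists n.+1, n.+1; split=> [|k]; first by lia.
  rewrite /single; case: (k =P n.+1) => [->|/eqP kn]; first by rewrite E'_neq0 //; lia.
  by rewrite eqxx; lia.
move=> k; rewrite ltnS leq_eqVlt => /orP[/eqP ->|kn]; last first.
  by rewrite /link !single_le ?eqxx //; [case: odd|lia].
rewrite /link (single_le v (leqnn n)) single_top eqxx; case: ifP => // on _.
by rewrite psi_new.
Qed.

Lemma string_basis_extend : exists D'' : (nat -> V) -> Prop,
  string_basis n.+1 D'' /\
  forall v, E' v <-> exists2 z, D'' z & z n.+1 = v /\ v != 0.
Proof.
have tops v : E' v <-> exists2 z, D' z & z n.+1 = v /\ v != 0.
  split=> [E'v|[_ [[z Dz ->]|[w [E'w _] ->]]]].
  - have [[u [Eu pu]]|nu] := pselect (exists u, E u /\ psi u = v).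
      have [z Dz [zu u0]] := Eu; exists (ext z); first by left; exists z.
      by rewrite ext_top zu pu; split=> //; apply: E'_neq0.
    exists (single v); last by rewrite single_top; split=> //; apply: E'_neq0.
    by right; exists v => //; split=> // u Eu pu; apply: nu; exists u.
  - rewrite ext_top => -[<- p0]; apply: psiE => //; exists z => //; split=> //.
    by apply: contraNneq p0 => ->; rewrite psi0.
  by rewrite single_top => -[<-].
exists D'; split=> //; split=> [z|j].
  by case=> [[w Dw ->]|[v [E'v nv] ->]]; [apply: string_ext|apply: string_single].
rewrite leq_eqVlt => /orP[/eqP ->|jn].
  apply: (rel_basis_reindex (phi := fun z => z n.+1) _ _ _ E'B).
  - by move=> z [Dz z0]; split=> //; apply/tops; exists z.
  - move=> z w [Dz z0] [Dw _] zw; move: z0 zw.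
    case: Dz => [[x Dx ->]|[v [E'v nv] ->]]; case: Dw => [[y Dy ->]|[u [E'u nu] ->]];
      rewrite ?ext_top ?single_top => p0.
    + have pE t : D t -> psi (t n) != 0 -> E (t n).
        move=> Dt pt; exists t => //; split=> //.
        by apply: contraNneq pt => ->; rewrite psi0.
      move=> pxy; have xy : x n = y n.
        by apply: psi_inj => //; apply: pE => //; rewrite -pxy.
      rewrite (D_inj Dx Dy) //; apply: contraNneq p0 => ->.
      by rewrite psi0.
    + move=> pxu; case: (nu (x n)) => //; exists x => //; split=> //.
      by apply: contraNneq p0 => ->; rewrite psi0.
    + move=> vpy; case: (nv (y n)) => //; exists y => //; split=> //.
      by apply: contraNneq p0 => y0; rewrite vpy y0 psi0.
    by move=> ->.
  by move=> v E'v; have [z Dz [zv v0]] := (tops v).1 E'v; exists z; rewrite ?zv.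
rewrite ltnS in jn.
(* Forgetting position n + 1 inverts [ext], since strings of [D] vanish beyond n. This identifies
   the bases at the old positions. *)
pose phi (z : nat -> V) k := if k == n.+1 then 0 else z k.
have phi_ext z : D z -> phi (ext z) = z.
  move=> /D_string Sz; apply/funext => k; rewrite /phi /ext.
  by case: eqP => // ->; rewrite (string_out Sz).
have DE z : D' z -> z j != 0 -> exists2 w, D w & z = ext w.
  case=> [[w Dw ->] _|[v _ ->]]; first by exists w.
  by rewrite single_le ?eqxx.
apply: (rel_basis_reindex (phi := phi) _ _ _ (DB.2 j jn)).
- move=> z [/DE Dz z0]; have [w Dw zE] := Dz z0; move: z0.
  by rewrite zE phi_ext // ext_le.
- move=> z w [/DE Dz z0] [/DE Dw w0].
  have [x Dx ->] := Dz z0; have [y Dy ->] := Dw w0.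
  by rewrite !phi_ext // => ->.
move=> z [Dz z0]; exists (ext z); last exact: phi_ext.
by split; [left; exists z|rewrite ext_le].
Qed.

End Extend.

Lemma string_basis_step n D (E' : V -> Prop) (psi : V -> V) (E : V -> Prop) :
  string_basis n D -> (forall v, E v <-> exists2 z, D z & z n = v /\ v != 0) ->
  rel_basis (sub_null V) (Vs n.+1) E' id -> psi 0 = 0 ->
  (forall v, E v -> psi v != 0 -> E' (psi v)) ->
  (forall v w, E v -> E w -> psi v = psi w -> psi v != 0 -> v = w) ->
  (~~ odd n -> forall v, E v -> psi v = h n v) ->
  (odd n -> forall v, E v -> psi v != 0 -> v = h n (psi v)) ->
  (odd n -> forall v, E' v -> (forall u, E u -> psi u <> v) -> h n v = 0) ->
  exists D' : (nat -> V) -> Prop, string_basis n.+1 D' /\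
    forall v, E' v <-> exists2 z, D' z & z n.+1 = v /\ v != 0.
Proof.
move=> DB EE; have -> : E = fun v => exists2 z, D z & z n = v /\ v != 0.
  by apply/funext => v; apply/propext.
move=> E'B p0 pE p_inj p_even p_odd p_new.
exact: (string_basis_extend DB E'B p0 pE p_inj p_even p_odd p_new).
Qed.

(* U is the filtration of Vs n by how far to the left an element extends; every
   basis of Vs n adapted to it is the set of ends of a string basis. *)
Definition adapted_chain n (U : nat -> subspace V) :=
  [/\ forall x, U 0%N x -> x = 0,
      forall k x, (k <= n)%N -> U k x -> U k.+1 x,
      U n.+1 = Vs n
    & forall E : nat -> V -> Prop,
        (forall k, (k <= n)%N -> rel_basis (U k) (U k.+1) (E k) id) ->
        exists D, string_basis n D /\ forall v,
          (exists k, (k <= n)%N /\ E k v) <-> exists2 z, D z & z n = v /\ v != 0].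

Lemma adapted_chain_le n U i j x : adapted_chain n U -> (i <= j <= n.+1)%N ->
  U i x -> U j x.
Proof.
case=> _ Um _ _; elim: j => [|j IH] /andP[ij jn] Ux.
  by move: ij Ux; rewrite leqn0 => /eqP ->.
have [e|ij'] := eqVneq i j.+1; first by rewrite -e.
by apply: Um; [lia|apply: IH => //; lia].
Qed.

End Strings.

Section AdaptedChains.
Context {K : fieldType} {V : lmodType K}.
Variables (Vs : nat -> subspace V) (h : nat -> {linear V -> V}).
Hypotheses
  (h_even : forall k x, ~~ odd k -> Vs k x -> Vs k.+1 (h k x))
  (h_odd : forall k x, odd k -> Vs k.+1 x -> Vs k (h k x)).

Lemma adapted_chain0 : exists U, adapted_chain Vs h 0 U.
Proof.
exists (fun k => if k is _.+1 then Vs 0 else sub_null V).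
split=> // [[|//] x _ ->|E EB]; first exact: sub0.
have E0 := EB 0%N isT.
exists (fun z => E 0%N (z 0%N) /\ forall k, (0 < k)%N -> z k = 0).
have nz v : E 0%N v -> v != 0.
  by move=> Ev; apply/eqP; apply: (rel_basis_null_neq0 E0 Ev).
split; last first.
  move=> v; split=> [[k [+ Ev]]|[z [Ez z0] [<- _]]]; last by exists 0%N.
  rewrite leqn0 => /eqP k0; rewrite {k}k0 in Ev.
  exists (fun k => if k is 0%N then v else 0); last by split=> //; apply: nz.
  by split=> // -[].
split=> [z [Ez z0]|j].
  split=> //; exists 0%N, 0%N; split=> // -[|k]; first by rewrite nz.
  by rewrite z0 // eqxx.
rewrite leqn0 => /eqP ->.
apply: (rel_basis_reindex (phi := fun z : nat -> V => z 0%N) _ _ _ E0).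
- by move=> z [[]].
- move=> z w [[_ z0] _] [[_ w0] _] zw; apply/funext => -[//|k].
  by rewrite z0 ?w0.
move=> v Ev; exists (fun k => if k is 0%N then v else 0) => //.
by split; [split=> // -[]|apply: nz].
Qed.

(** For f : V_n -> V_(n+1) the new filtration consists of the images f(U_k), followed by the whole
    space, where new strings begin. An adapted basis upstairs is lifted level by level and completed
    by bases of the kernel of f, whose strings end at n. *)
Lemma adapted_chain_even n U : ~~ odd n -> adapted_chain Vs h n U ->
  exists U', adapted_chain Vs h n.+1 U'.
Proof.
move=> on UC; have [U0 Um Utop UE] := UC; pose f := h n.
have fVs x : Vs n x -> Vs n.+1 (f x) by apply: h_even.
have U_top k x : (k <= n.+1)%N -> U k x -> Vs n x.
  by move=> kn Ux; rewrite -Utop; apply: (adapted_chain_le UC _ Ux); lia.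
pose U' k := if (k <= n.+1)%N then sub_im f (U k) else Vs n.+1.
have U'm k x : (k <= n.+1)%N -> U' k x -> U' k.+1 x.
  move=> kn; rewrite /U' kn => -[y [Uy ->]]; case: ifP => kn'.
    by exists y; split=> //; apply: Um.
  exact/fVs/(U_top k).
exists U'; split=> // [x [y [/U0 -> ->]]||E' E'B]; first exact: linear0.
  by rewrite /U' ltnn.
have E'all : rel_basis (sub_null V) (Vs n.+1)
    (fun v => exists k, (k <= n.+1)%N /\ E' k v) id.
  have := @rel_basis_chain _ _ U' E' 0 n.+2 _ _; rewrite add0n.
  have -> : U' n.+2 = Vs n.+1 by rewrite /U' ltnn.
  have -> : U' 0%N = sub_null V.
    apply: subspace_ext => x; split=> [[y [/U0 -> ->]]|->]; first exact: linear0.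
    exact: sub0.
  by apply=> k; [move=> x|]; rewrite leq0n ltnS => kn; [apply: U'm|apply: E'B].
(* A vector of one level lies in all later steps of the filtration, whereas a vector of level k is
   nonzero modulo U' k. Distinct levels are therefore disjoint, which makes f injective on the lifts
   of all levels together. *)
have E'_level j k v : (j <= n.+1)%N -> (k <= n.+1)%N -> E' j v -> E' k v -> j = k.
  have lt_level i l : (i < l <= n.+1)%N -> E' i v -> E' l v -> False.
    move=> /andP[il ln] Ei El; have [_ fl _] := E'B l ln.
    apply: (rel_free_notin fl El); have [|Wi _ _] := E'B i _; first by lia.
    have : U' i.+1 v by apply: Wi.
    elim: l il ln {El fl} => // l IHl; rewrite ltnS leq_eqVlt.
    move=> /orP[/eqP <- //|il] ln Uv; apply: U'm; [lia|apply: IHl => //; lia].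
  move=> jn kn Ej Ek; case: (ltngtP j k) => // jk.
    by case: (lt_level j k) => //; lia.
  by case: (lt_level k j) => //; lia.
have E'S k : (k <= n)%N -> rel_basis (sub_im f (U k)) (sub_im f (U k.+1)) (E' k) id.
  by move=> kn; have := E'B k (leqW kn); rewrite /U' ltnS kn leqW.
have /choice[l lP] (kv : nat * V) : exists x, (kv.1 <= n)%N -> E' kv.1 kv.2 ->
    U kv.1.+1 x /\ f x = kv.2.
  have [[kn Ek]|nE] := pselect ((kv.1 <= n)%N /\ E' kv.1 kv.2).
    have [W _ _] := E'S _ kn; have [x [Ux xE]] := W _ Ek.
    by exists x.
  by exists 0 => kn Ek; case: nE.
pose Uk k := sub_cap (sub_preim f (sub_null V)) (U k).
have /choice[B BP] (k : nat) : exists E : V -> Prop, rel_basis (Uk k) (Uk k.+1) E id.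
  exact: rel_basis_exists.
pose L k x := exists2 v, E' k v & x = l (k, v).
pose E k x := B k x \/ L k x.
have EB k : (k <= n)%N -> rel_basis (U k) (U k.+1) (E k) id.
  move=> kn; have UU x : U k x -> U k.+1 x by apply: Um.
  (* [B k] is a basis of M modulo U k. Since f identifies U k.+1 modulo M with f(U k.+1) modulo f(U
     k), the lifts [L k] form a basis of the remaining step. *)
  pose M := sub_add (U k) (Uk k.+1).
  have fL x : L k x -> E' k (f x) /\ U k.+1 x.
    by case=> v Ev ->; have [Ul ->] := lP (k, v) kn Ev.
  apply: (@rel_basis_trans _ _ _ _ M).
  - exact: sub_addl.
  - by move=> x [y [z [/UU Uy [_ Uz] ->]]]; apply: subD.
  - apply: (@rel_basis_map _ _ _ idfun (Uk k) (Uk k.+1)) (BP k).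
    + by move=> x [].
    + by move=> x Ux; apply: sub_addr.
    + by move=> x [fx _] Ux.
    by move=> y [u [x [Uu Ux ->]]]; exists x => //; rewrite addrK.
  apply: (@rel_basis_comap _ _ _ f _ _ (sub_im f (U k)) (sub_im f (U k.+1))).
  - by move=> x /fL[].
  - move=> x [u [y [Uu [fy _] ->]]]; exists u; split=> //.
    by rewrite linearD [f y]fy addr0.
  - by move=> x Ux; exists x.
  - move=> x Ux [u [Uu fx]]; exists u, (x - u); split=> //; last by rewrite addrC subrK.
    split; first by rewrite sub_preimE linearB fx subrr.
    by apply: subB => //; apply: UU.
  apply: (rel_basis_reindex (phi := f) _ _ _ (E'S k kn)).
  - by move=> x /fL[].
  - move=> _ _ [v Ev ->] [w Ew ->]; have [_ ->] := lP (k, v) kn Ev.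
    by have [_ -> /= ->] := lP (k, w) kn Ew.
  by move=> v Ev; exists (l (k, v)); [exists v|have [_ ->] := lP (k, v) kn Ev].
have [D [DB DE]] := UE E EB.
have Ef v : (exists k, (k <= n)%N /\ E k v) -> f v != 0 ->
    exists k, [/\ (k <= n)%N, E' k (f v) & v = l (k, f v)].
  case=> k [kn [Bv|[w Ew ->]]] fv0.
    have [W _ _] := BP k; have [fv _] := W v Bv.
    by move/eqP: fv0; rewrite [f v]fv.
  by have [_ flE] := lP (k, w) kn Ew; exists k; rewrite flE.
apply: (string_basis_step (psi := f) DB DE E'all).
- exact: linear0.
- move=> v Ev fv0; have [k [kn Ek _]] := Ef v Ev fv0.
  by exists k; split=> //; apply: leqW.
- move=> v w Ev Ew fvw fv0; have [k [kn Ek ->]] := Ef v Ev fv0.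
  have [|j [jn Ej ->]] := Ef w Ew; first by rewrite -fvw.
  by rewrite -fvw in Ej *; rewrite (E'_level _ _ _ (leqW kn) (leqW jn) Ek Ej).
- by [].
- by rewrite (negbTE on).
by rewrite (negbTE on).
Qed.

(** For g : V_(n+1) -> V_n the new filtration is 0 followed by the preimages of the U_k, shifted by
    one index; its first step is the kernel of g, where new strings begin. The images of an adapted
    basis are independent modulo the U_k and are completed to an adapted basis of V_n. *)
Lemma adapted_chain_odd n U : odd n -> adapted_chain Vs h n U ->
  exists U', adapted_chain Vs h n.+1 U'.
Proof.
move=> on UC; have [U0 Um Utop UE] := UC; pose g := h n.
have gVs x : Vs n.+1 x -> Vs n (g x) by apply: h_odd.
pose U' k := if k is k'.+1 then sub_cap (Vs n.+1) (sub_preim g (U k'))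
  else sub_null V.
have U'm k x : (k <= n.+1)%N -> U' k x -> U' k.+1 x.
  case: k => [|k] kn; first by move=> ->; apply: sub0.
  by case=> Vx gx; split=> //; rewrite sub_preimE; apply: Um.
have U'top : U' n.+2 = Vs n.+1.
  apply: subspace_ext => x; split=> [[]//|Vx]; split=> //.
  by rewrite sub_preimE Utop; apply: gVs.
exists U'; split=> // E' E'B.
have chain a m : (a + m <= n.+2)%N -> rel_basis (U' a) (U' (a + m)%N)
    (fun v => exists k, (a <= k < a + m)%N /\ E' k v) id.
  move=> am; apply: rel_basis_chain => [k x|k] kn; first by apply: U'm; lia.
  by apply: E'B; lia.
have E'all : rel_basis (sub_null V) (Vs n.+1)
    (fun v => exists k, (k <= n.+1)%N /\ E' k v) id.
  by have := chain 0%N n.+2 (leqnn _); rewrite add0n U'top.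
(* The vectors of levels 1 and higher together form a basis modulo U' 1, the kernel of g, so g
   separates them. *)
have g_inj j k v w : (j <= n)%N -> (k <= n)%N -> E' j.+1 v -> E' k.+1 w ->
    g v = g w -> v = w.
  move=> jn kn Ev Ew gvw; have [|W fr _] := chain 1%N n.+1; first by lia.
  have Pv : exists i, (1 <= i < 1 + n.+1)%N /\ E' i v by exists j.+1; split=> //; lia.
  have Pw : exists i, (1 <= i < 1 + n.+1)%N /\ E' i w by exists k.+1; split=> //; lia.
  apply: (rel_free_inj fr) => //; split.
    have := W _ Pv; have := W _ Pw; rewrite add1n U'top => ? ?; exact: subB.
  by rewrite sub_preimE linearB gvw subrr; apply: sub0.
(* l is the section of g on the images of levels 1 and higher; its value 0 elsewhere ends the
   string. *)
have /choice[l lP] (x : V) : exists v,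
    ((exists k, [/\ (k <= n)%N, E' k.+1 v & g v = x]) \/
     ((forall k u, (k <= n)%N -> E' k.+1 u -> g u <> x) /\ v = 0)).
  have [[v h1]|nv] := pselect (exists v, exists k, [/\ (k <= n)%N, E' k.+1 v & g v = x]).
    by exists v; left.
  exists 0; right; split=> // k u kn Eu gu; apply: nv.
  by exists u, k.
have l_sect k v : (k <= n)%N -> E' k.+1 v -> l (g v) = v.
  move=> kn Ev; case: (lP (g v)) => [[j [jn Ej gE]]|[nv _]].
    exact: g_inj Ej Ev gE.
  by case: (nv k v).
have l_neq0 x : l x != 0 -> exists k, [/\ (k <= n)%N, E' k.+1 (l x) & g (l x) = x].
  by case: (lP x) => [//|[_ ->]]; rewrite eqxx.
pose G k x := exists2 v, E' k.+1 v & x = g v.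
have /choice[E EP] (k : nat) : exists E : V -> Prop, (k <= n)%N ->
    (forall x, G k x -> E x) /\ rel_basis (U k) (U k.+1) E id.
  have [kn|kn] := leqP k n; last by exists (fun=> False) => kn'; lia.
  have [W fr _] := E'B k.+1 kn.
  have [||E [GE EB]] := @rel_free_extend _ _ (U k) (U k.+1) (G k).
  - by move=> _ [v Ev ->]; have [_] := W v Ev.
  - move=> s c us Gs Us x sx.
    have sl y : y \in s -> E' k.+1 (l y) /\ g (l y) = y.
      by move=> /Gs[v Ev ->]; rewrite (l_sect k).
    rewrite -(sl x sx).2; apply: (fr (map l s) (c \o g)) => [|y /mapP[z /sl[Ez _] ->] //||].
    + rewrite map_inj_in_uniq // => y z /sl[_ ly] /sl[_ lz] lyz.
      by rewrite -ly lyz lz.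
    + rewrite big_map; split.
        apply: sub_lin_seq => y /sl[Ey _]; apply: subZ.
        by have [] := W _ Ey.
      rewrite sub_preimE linear_sum; move: Us; congr (in_sub _ _).
      rewrite [LHS]big_seq [RHS]big_seq; apply: eq_bigr => y /sl[_ ly].
      by rewrite linearZ /= ly.
    exact: map_f.
  by exists E.
have [D [DB DE]] := UE E (fun k kn => (EP k kn).2).
apply: (string_basis_step (psi := l) DB DE E'all).
- apply/eqP; apply: contrapT => /negP/l_neq0[k [kn El gl]].
  have [_ fr _] := E'B k.+1 kn; have [W _ _] := E'B k.+1 kn.
  apply: (rel_free_notin fr El); split; first by have [] := W _ El.
  by rewrite sub_preimE gl; apply: sub0.
- by move=> v _ /l_neq0[k [kn El _]]; exists k.+1.
- move=> v w _ _ vw v0; have [_ [_ _ <-]] := l_neq0 v v0.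
  by rewrite vw in v0 *; have [_ [_ _]] := l_neq0 w v0.
- by rewrite on.
- by move=> _ v _ /l_neq0[k [_ _]].
(* A vector of level 0 is killed by g because U 0 is zero; one of a higher level is the value of l
   at its image, so it is not new. *)
move=> _ v [[|k] [kn Ev]] nv.
  have [W _ _] := E'B 0%N isT; have [_ gv] := W v Ev.
  exact: U0 gv.
case: (nv (g v)); last exact: (l_sect k).
by exists k; split=> //; apply: (EP k kn).1; exists v.
Qed.

Lemma adapted_chain_exists n : exists U, adapted_chain Vs h n U.
Proof.
elim: n => [|n [U UC]]; first exact: adapted_chain0.
have [on|on] := boolP (odd n); first exact: adapted_chain_odd UC.
exact: adapted_chain_even UC.
Qed.

Lemma string_basis_exists n : exists D, string_basis Vs h n D.
Proof.
have [U [_ _ _ UE]] := adapted_chain_exists n.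
have /choice[E EP] (k : nat) : exists E : V -> Prop, rel_basis (U k) (U k.+1) E id.
  exact: rel_basis_exists.
by have [D [DB _]] := UE E (fun k _ => EP k); exists D.
Qed.

End AdaptedChains.

(** * The decomposition theorem *)

Section LinearFacts.
Context {K : fieldType} {V : lmodType K}.
Implicit Types (U W M N : subspace V).

Lemma complement_exists U W : exists N : subspace V,
  [/\ forall x, N x -> W x, forall x, N x -> U x -> x = 0
    & forall x, W x -> sub_add U N x].
Proof.
have [E [EW fr sp]] := rel_basis_exists U W; exists (lspan E id); split=> // x.
  by apply: lspan_min.
case=> s [c [us Es ->]] /(fr _ _ us Es) c0; rewrite big_seq big1 // => i /c0 ->.
exact: scale0r.
Qed.

Lemma rel_basis_add (I : eqType) U M (P : I -> Prop) (e : I -> V) :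
  (forall x, M x -> U x -> x = 0) -> rel_basis (sub_null V) M P e ->
  rel_basis U (sub_add U M) P e.
Proof.
move=> MU B; apply: (@rel_basis_map _ _ _ idfun (sub_null V) M) B.
- by move=> x ->; apply: sub0.
- by move=> x Mx; apply: sub_addr.
- by move=> x Mx /(MU x Mx).
by move=> y [u [x [Uu Mx ->]]]; exists x => //; rewrite addrK.
Qed.

Lemma rel_basis_ext (I : eqType) U W (P Q : I -> Prop) (e : I -> V) :
  (forall i, P i <-> Q i) -> rel_basis U W P e -> rel_basis U W Q e.
Proof.
by move=> PQ; have -> : P = Q by apply/funext => i; apply/propext.
Qed.

End LinearFacts.

(** * Splitting off the squares *)

Section SplitSquares.
Context {K : fieldType} (A : dcomplex K).
Implicit Types (p q : int) (a x : A).
Local Notation comp := (dc_comp A).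
Local Notation d1 := (dc_d1 A).
Local Notation d2 := (dc_d2 A).

Let D : {linear A -> A} := d1 \o d2.

Let DE x : D x = d1 (d2 x). Proof. by []. Qed.

Lemma dc_d2d1 x : d2 (d1 x) = - d1 (d2 x).
Proof. by apply/eqP; rewrite -addr_eq0 addrC dc_anticomm. Qed.

Let D_comp p q x : comp p q x -> comp (p + 1) (q + 1) (D x).
Proof. by move=> Ax; apply/dc_d1_bideg/dc_d2_bideg. Qed.

Let DA p q := sub_im D (comp (p - 1) (q - 1)).

(** Two independent choices are made: [N] complements the image of [D] and cuts out the square-free
    part, while [W] below complements the kernel of [D] and generates the squares. *)
Let N_ex p q := complement_exists (DA p q) (comp p q).
Let N p q := sval (cid (N_ex p q)).
Let N_comp p q x : N p q x -> comp p q x.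
Proof. by have [h _ _] := svalP (cid (N_ex p q)); apply: h. Qed.
Let N_DA p q x : N p q x -> DA p q x -> x = 0.
Proof. by have [_ h _] := svalP (cid (N_ex p q)); apply: h. Qed.
Let N_dec p q x : comp p q x -> sub_add (DA p q) (N p q) x.
Proof. by have [_ _ h] := svalP (cid (N_ex p q)); apply: h. Qed.

Let D_DA p q x : comp p q x -> DA (p + 1) (q + 1) (D x).
Proof. by exists x; rewrite !addrK. Qed.

(* The largest double subcomplex contained in N: a complement of the sum of the
   squares spanned by the W p q. *)
Definition nosquare p q : subspace A :=
  sub_cap (sub_cap (N p q) (sub_preim d1 (N (p + 1) q)))
    (sub_cap (sub_preim d2 (N p (q + 1))) (sub_preim D (N (p + 1) (q + 1)))).

Lemma nosquare_comp p q x : nosquare p q x -> comp p q x.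
Proof. by case=> -[/N_comp]. Qed.

(** The element D x lies in [N] by definition of [nosquare] and in the image of [D], which [N] meets
    only in 0. *)
Lemma nosquare_D p q x : nosquare p q x -> d1 (d2 x) = 0.
Proof.
move=> Nx; have Ax := nosquare_comp Nx; case: Nx => _ [_ NDx].
by apply: (N_DA NDx); apply: D_DA.
Qed.

Lemma nosquare_d1 p q x : nosquare p q x -> nosquare (p + 1) q (d1 x).
Proof.
move=> Nx; have D0 := nosquare_D Nx; case: Nx => -[_ N1] _.
split; split; rewrite ?sub_preimE ?DE ?dc_d1d1 ?dc_d2d1 ?D0 ?oppr0 ?linear0 //;
  exact: sub0.
Qed.

Lemma nosquare_d2 p q x : nosquare p q x -> nosquare p (q + 1) (d2 x).
Proof.
move=> Nx; have D0 := nosquare_D Nx; case: Nx => _ [N2 _].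
split; split; rewrite ?sub_preimE ?DE ?dc_d2d2 ?D0 ?linear0 //; exact: sub0.
Qed.

Let kerD p q := sub_cap (comp p q) (sub_preim D (sub_null A)).
Let EW_ex p q := rel_basis_exists (kerD p q) (comp p q).

Definition square_top p q : A -> Prop := sval (cid (EW_ex p q)).

Let EW_basis p q : rel_basis (kerD p q) (comp p q) (square_top p q) id.
Proof. exact: svalP (cid (EW_ex p q)). Qed.

Let W p q := lspan (square_top p q) id.

Let W_comp p q x : W p q x -> comp p q x.
Proof. by have [h _ _] := EW_basis p q; apply: lspan_min. Qed.

Lemma square_top_comp p q x : square_top p q x -> comp p q x.
Proof. by have [h _ _] := EW_basis p q; apply: h. Qed.

Let W_ker p q x : W p q x -> D x = 0 -> x = 0.
Proof.
move=> Wx Dx; have kx : kerD p q x by split=> //; apply: W_comp.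
have [_ fr _] := EW_basis p q; move: Wx kx => [s [c [us Es ->]]].
move=> /(fr _ _ us Es) c0; rewrite big_seq big1 // => i /c0 ->.
exact: scale0r.
Qed.

Lemma square_top_D p q x : square_top p q x -> d1 (d2 x) <> 0.
Proof.
move=> Ex D0; have [_ fr _] := EW_basis p q; apply: (rel_free_notin fr Ex).
by split=> //; apply: square_top_comp.
Qed.

Let W_basis p q : rel_basis (sub_null A) (W p q) (square_top p q) id.
Proof.
split=> [x Ex|s c us Es s0|x Wx]; first exact: (@lspan_in _ _ _ _ id x).
  have [_ fr _] := EW_basis p q; apply: fr => //.
  by rewrite [X in in_sub _ X]s0; apply: sub0.
by apply: sub_addr.
Qed.

Let W_dec p q x : comp p q x -> exists2 w, W p q w & D x = D w.
Proof.
have [_ _ sp] := EW_basis p q; move=> /sp[k [w [[_ kD] Ww ->]]]; exists w => //.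
by rewrite linearD [D k]kD add0r.
Qed.

Let DA_W p q x : DA p q x -> exists2 w, W (p - 1) (q - 1) w & x = D w.
Proof. by case=> y [/W_dec[w Ww Dy] ->]; exists w. Qed.

Let W_img_basis p q (f : {linear A -> A}) : (forall x, W p q x -> f x = 0 -> x = 0) ->
  rel_basis (sub_null A) (sub_im f (W p q)) (square_top p q) f.
Proof.
move=> f_inj; apply: (@rel_basis_map _ _ _ f (sub_null A) (W p q)) (W_basis p q).
- by move=> x ->; apply: linear0.
- by move=> x Wx; exists x.
- exact: f_inj.
by move=> y [x [Wx ->]]; exists x => //; rewrite subrr; apply: sub0.
Qed.

Lemma square_basis p q :
  rel_basis (sub_null A) (lspan (square_top p q) id) (square_top p q) id.
Proof. exact: W_basis. Qed.

Lemma square_basis_D p q : rel_basis (sub_null A)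
  (sub_im D (lspan (square_top p q) id)) (square_top p q) D.
Proof. by apply: W_img_basis; apply: W_ker. Qed.

Lemma square_basis_d1 p q : rel_basis (sub_null A)
  (sub_im d1 (lspan (square_top p q) id)) (square_top p q) d1.
Proof.
apply: W_img_basis => x Wx dx0; apply: (W_ker Wx).
by apply: oppr_inj; rewrite DE -dc_d2d1 dx0 linear0 oppr0.
Qed.

Lemma square_basis_d2 p q : rel_basis (sub_null A)
  (sub_im d2 (lspan (square_top p q) id)) (square_top p q) d2.
Proof.
by apply: W_img_basis => x Wx dx0; apply: (W_ker Wx); rewrite DE dx0 linear0.
Qed.

Variables (p q : int) (I : eqType) (P1 P2 P3 P4 P5 : I -> Prop) (e : I -> A).
Hypotheses
  (B1 : rel_basis (sub_null A) (sub_im D (lspan (square_top (p - 1) (q - 1)) id)) P1 e)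
  (B2 : rel_basis (sub_null A) (sub_im d1 (lspan (square_top (p - 1) q) id)) P2 e)
  (B3 : rel_basis (sub_null A) (sub_im d2 (lspan (square_top p (q - 1)) id)) P3 e)
  (B4 : rel_basis (sub_null A) (lspan (square_top p q) id) P4 e)
  (B5 : rel_basis (sub_null A) (nosquare p q) P5 e).

Let U1 := sub_im D (W (p - 1) (q - 1)).
Let U2 := sub_add U1 (sub_im d1 (W (p - 1) q)).
Let U3 := sub_add U2 (sub_im d2 (W p (q - 1))).
Let U4 := sub_add U3 (W p q).

Let U1E x : U1 x -> exists2 t, W (p - 1) (q - 1) t & x = D t.
Proof. by case=> t [Wt ->]; exists t. Qed.
Let U2E x : U2 x -> exists t u,
  [/\ W (p - 1) (q - 1) t, W (p - 1) q u & x = D t + d1 u].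
Proof. by case=> _ [_ [[t [Wt ->]] [u [Wu ->]] ->]]; exists t, u. Qed.
Let U3E x : U3 x -> exists t u v, [/\ W (p - 1) (q - 1) t, W (p - 1) q u,
  W p (q - 1) v & x = D t + d1 u + d2 v].
Proof. by case=> _ [_ [/U2E[t [u [Wt Wu ->]]] [v [Wv ->]] ->]]; exists t, u, v. Qed.

Let d1D x : d1 (D x) = 0. Proof. exact: dc_d1d1. Qed.
Let d2D x : d2 (D x) = 0.
Proof. by rewrite DE dc_d2d1 dc_d2d2 linear0 oppr0. Qed.
Let DD x : D (D x) = 0. Proof. by rewrite [LHS]DE d2D linear0. Qed.
Let Dd1 x : D (d1 x) = 0. Proof. by rewrite DE dc_d2d1 linearN d1D oppr0. Qed.
Let Dd2 x : D (d2 x) = 0. Proof. by rewrite DE dc_d2d2 linear0. Qed.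
Let d2d1 x : d2 (d1 x) = - D x. Proof. exact: dc_d2d1. Qed.

(** A bidegree can be any of the four corners of a square; U1 to U4 add these contributions one at a
    time, and [nosquare] fills the rest. The five families share one index type, to be instantiated
    by strings. *)
Lemma square_chain_basis : rel_basis (sub_null A) (comp p q)
  (fun i => P1 i \/ P2 i \/ P3 i \/ P4 i \/ P5 i) e.
Proof.
(* In this claim and the next two, d2, d1 and [D] respectively kill all earlier terms, and on the
   new term they yield, up to sign, a value of [D] on an element of [W], which determines that
   element. *)
have N1 x : sub_im d1 (W (p - 1) q) x -> U1 x -> x = 0.
  move=> [u [Wu ->]] /U1E[t _ e1]; suff -> : u = 0 by rewrite linear0.
  apply: (W_ker Wu); apply: oppr_inj; rewrite oppr0 -d2d1 e1; exact: d2D.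
have N2 x : sub_im d2 (W p (q - 1)) x -> U2 x -> x = 0.
  move=> [v [Wv ->]] /U2E[t [u [_ _ e2]]]; suff -> : v = 0 by rewrite linear0.
  by apply: (W_ker Wv); rewrite DE e2 linearD d1D dc_d1d1 addr0.
have N3 x : W p q x -> U3 x -> x = 0.
  move=> Wx /U3E[t [u [v [_ _ _ e3]]]].
  by apply: (W_ker Wx); rewrite e3 !linearD DD Dd1 Dd2 !addr0.
(* Applying [D] removes w. Then d1 x = D v, d2 x = - D u and finally x = D t lie both in [N] and in
   the image of [D], so they vanish in turn. *)
have N4 x : nosquare p q x -> U4 x -> x = 0.
  move=> Nx [_ [w [/U3E[t [u [v [Wt Wu Wv ->]]]] Ww xE]]].
  have D0 : D x = 0 := nosquare_D Nx; have [[Nx0 Nx1] [Nx2 _]] := Nx.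
  have w0 : w = 0.
    apply: (W_ker Ww); rewrite -D0 xE !linearD.
    by rewrite DD Dd1 Dd2 !addr0 add0r.
  rewrite w0 addr0 in xE.
  have v0 : v = 0.
    apply: (W_ker Wv); have e1 : d1 x = D v.
      by rewrite xE !linearD d1D dc_d1d1 !add0r.
    rewrite -e1; apply: (N_DA Nx1); rewrite e1; exists v.
    by rewrite addrK; split=> //; apply: W_comp.
  have u0 : u = 0.
    apply: (W_ker Wu); have e1 : d2 x = - D u.
      by rewrite xE v0 linear0 addr0 linearD d2D d2d1 add0r.
    apply: oppr_inj; rewrite oppr0 -e1; apply: (N_DA Nx2); rewrite e1.
    apply: subN; exists u.
    by rewrite addrK; split=> //; apply: W_comp.
  apply: (N_DA Nx0); rewrite xE u0 v0 !linear0 !addr0; exists t.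
  by split=> //; apply: W_comp.
have full : comp p q = sub_add U4 (nosquare p q).
  apply: subspace_ext => x; split=> [Ax|]; last first.
    case=> _ [y [[_ [w [/U3E[t [u [v [Wt Wu Wv ->]]]] Ww ->]]] Ny ->]].
    apply: subD; last exact: nosquare_comp.
    apply: subD; last exact: W_comp.
    apply: subD; [apply: subD|].
    - by have := D_comp (W_comp Wt); rewrite !subrK.
    - by have := dc_d1_bideg (W_comp Wu); rewrite subrK.
    by have := dc_d2_bideg (W_comp Wv); rewrite subrK.
  (* Four corrections lead from x to n0: w makes [D] vanish, d1 u brings d2 into [N], d2 v brings d1
     into [N], and D t brings the element itself into [N]. None of them spoils what the earlier ones
     achieved. *)
  have [w Ww Dxw] := W_dec Ax; pose a1 := x - w.
  have Aa1 : comp p q a1 by apply: subB => //; apply: W_comp.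
  have Da1 : D a1 = 0 by rewrite linearB Dxw subrr.
  have [_ [n2 [/DA_W[u + ->] Nn2 e2]]] := N_dec (dc_d2_bideg Aa1).
  rewrite addrK => Wu; pose a2 := a1 + d1 u.
  have Aa2 : comp p q a2.
    by apply: subD => //; have := dc_d1_bideg (W_comp Wu); rewrite subrK.
  have d2a2 : d2 a2 = n2 by rewrite linearD e2 d2d1 addrAC subrr add0r.
  have [_ [n1 [/DA_W[v + ->] Nn1 e1]]] := N_dec (dc_d1_bideg Aa2).
  rewrite addrK => Wv; pose a3 := a2 - d2 v.
  have Aa3 : comp p q a3.
    by apply: subB => //; have := dc_d2_bideg (W_comp Wv); rewrite subrK.
  have d1a3 : d1 a3 = n1 by rewrite linearB e1 addrAC subrr add0r.
  have d2a3 : d2 a3 = n2 by rewrite linearB d2a2 dc_d2d2 subr0.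
  have [_ [n0 [/DA_W[t Wt ->] Nn0 e0]]] := N_dec Aa3.
  have d1n0 : d1 n0 = n1 by rewrite -d1a3 e0 linearD d1D add0r.
  have d2n0 : d2 n0 = n2 by rewrite -d2a3 e0 linearD d2D add0r.
  have Da3 : D a3 = 0 by rewrite /a3 linearB Dd2 subr0 /a2 linearD Dd1 addr0.
  have Dn0 : D n0 = 0 by rewrite [D n0]DE d2n0 -d2a3.
  exists (D t + d1 (- u) + d2 v + w), n0; split.
  - exists (D t + d1 (- u) + d2 v), w; split=> //.
    exists (D t + d1 (- u)), (d2 v); split=> //; last by exists v.
    exists (D t), (d1 (- u)); split=> //; first by exists t.
    by exists (- u); split=> //; apply: subN.
  - split; split; rewrite ?sub_preimE ?d1n0 ?d2n0 ?Dn0 //; exact: sub0.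
  have xE : x = a1 + w by rewrite subrK.
  have a1E : a1 = a2 - d1 u by rewrite addrK.
  have a2E : a2 = a3 + d2 v by rewrite subrK.
  rewrite {1}xE a1E a2E {1}e0 linearN.
  by rewrite (addrAC (D t) n0) (addrAC _ n0 (- d1 u)) (addrAC (D t) (d2 v)) (addrAC _ n0 w).
rewrite full.
have C5 := rel_basis_add N4 B5; have C4 := rel_basis_add N3 B4.
have C3 := rel_basis_add N2 B3; have C2 := rel_basis_add N1 B2.
have C45 := rel_basis_trans (@sub_addl _ _ _ _) (@sub_addl _ _ _ _) C4 C5.
have C35 := rel_basis_trans (@sub_addl _ _ _ _)
  (fun x Ux => sub_addl _ (sub_addl _ Ux)) C3 C45.
have C25 := rel_basis_trans (@sub_addl _ _ _ _)
  (fun x Ux => sub_addl _ (sub_addl _ (sub_addl _ Ux))) C2 C35.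
apply: rel_basis_trans B1 C25; last first.
  by move=> x Ux; do 4!apply: sub_addl.
by move=> x ->; apply: sub0.
Qed.

End SplitSquares.

(** * The square-free part, arranged along lines *)

Section Lines.
Context {K : fieldType} (A : dcomplex K).
Hypothesis A_bounded : bounded A.
Implicit Types (p q n : int).
Local Notation comp := (dc_comp A).
Local Notation d1 := (dc_d1 A).
Local Notation d2 := (dc_d2 A).

(** Both differentials vanish here because d1 d2 = 0 on [nosquare]. After choosing a complement, the
    square-free part consists of tops mapped into bottoms. *)
Definition line_bottom p q : subspace A :=
  sub_add (sub_im d1 (nosquare A (p - 1) q)) (sub_im d2 (nosquare A p (q - 1))).

Lemma line_bottom_nosquare p q x : line_bottom p q x -> nosquare A p q x.
Proof.
case=> _ [_ [[y [Ny ->]] [z [Nz ->]] ->]]; apply: subD.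
  by have := nosquare_d1 Ny; rewrite subrK.
by have := nosquare_d2 Nz; rewrite subrK.
Qed.

Lemma line_bottom_d1 p q x : line_bottom p q x -> d1 x = 0.
Proof.
case=> _ [_ [[y [_ ->]] [z [Nz ->]] ->]].
by rewrite linearD dc_d1d1 add0r; apply: nosquare_D Nz.
Qed.

Lemma line_bottom_d2 p q x : line_bottom p q x -> d2 x = 0.
Proof.
case=> _ [_ [[y [Ny ->]] [z [_ ->]] ->]].
by rewrite linearD dc_d2d2 addr0 dc_d2d1 (nosquare_D Ny) oppr0.
Qed.

Let T_ex p q := complement_exists (line_bottom p q) (nosquare A p q).
Definition line_top p q : subspace A := sval (cid (T_ex p q)).

Lemma line_top_nosquare p q x : line_top p q x -> nosquare A p q x.
Proof. by have [h _ _] := svalP (cid (T_ex p q)); apply: h. Qed.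

Let line_top_bottom p q x : line_top p q x -> line_bottom p q x -> x = 0.
Proof. by have [_ h _] := svalP (cid (T_ex p q)); apply: h. Qed.

Lemma line_basis (I : eqType) p q (P Q : I -> Prop) (e : I -> A) :
  rel_basis (sub_null A) (line_bottom p q) P e ->
  rel_basis (sub_null A) (line_top p q) Q e ->
  rel_basis (sub_null A) (nosquare A p q) (fun i => P i \/ Q i) e.
Proof.
move=> BP BQ; have -> : nosquare A p q = sub_add (line_bottom p q) (line_top p q).
  apply: subspace_ext => x; split=> [|[y [z [By Tz ->]]]].
    by have [_ _ h] := svalP (cid (T_ex p q)); apply: h.
  by apply: subD; [apply: line_bottom_nosquare|apply: line_top_nosquare].
apply: (rel_basis_trans _ (@sub_addl _ _ _ _) BP) (rel_basis_add _ BQ).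
  by move=> x ->; apply: sub0.
exact: line_top_bottom.
Qed.

Let bnd := boundedP A_bounded.
Definition box_radius : int := sval (cid bnd).
Local Notation M := box_radius.

Lemma box_radius_ge0 : 0 <= M.
Proof. by have [] := svalP (cid bnd). Qed.

Lemma box_out p q x : (M <= `|p|) || (M <= `|q|) -> comp p q x -> x = 0.
Proof. by have [_ h] := svalP (cid bnd); move=> pqM; apply: (h p q pqM x). Qed.

(** The sign alternates with the column, so that unit coefficients along d1 and [dsign] along d2
    anticommute around a square. *)
Definition dsign p : K := (-1) ^+ (absz p).

(* The n-th line joins the T^(p, n - p) and B^(p + 1, n - p) alternately, in the
   order of increasing p, starting from p = - M. *)
Definition line_pos n (k : nat) : int * int :=
  (- M + (uphalf k)%:Z, n + M - (k./2)%:Z).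

Definition line_space n (k : nat) : subspace A :=
  if odd k then line_bottom (line_pos n k).1 (line_pos n k).2
  else line_top (line_pos n k).1 (line_pos n k).2.

Definition line_map n (k : nat) : {linear A -> A} :=
  if odd k then (dsign (line_pos n k).1 \*: d2 : {linear A -> A}) else d1.

Lemma line_map_even n k x : ~~ odd k -> line_space n k x ->
  line_space n k.+1 (line_map n k x).
Proof.
rewrite /line_space /line_map /line_pos /= uphalf_half => /[dup] /negbTE -> ok.
move/line_top_nosquare; rewrite add0n => Nx; apply: sub_addl.
exists x; split=> //; move: Nx; congr (nosquare A _ _ _) => /=; lia.
Qed.

Lemma line_map_odd n k x : odd k -> line_space n k.+1 x ->
  line_space n k (line_map n k x).
Proof.
move=> ok; rewrite /line_space /line_map oddS ok => /line_top_nosquare Nx.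
apply: sub_addr; exists (dsign (line_pos n k).1 *: x); split; last first.
  by rewrite linearZ.
apply: subZ; move: Nx; congr (nosquare A _ _ _); rewrite /line_pos /=.
  by rewrite uphalf_half ok.
by lia.
Qed.

(** Position 0 lies in column - M and position 4M + 2 in column M + 1, both outside the box; every
    string therefore has its two ends strictly in between. *)
Definition line_length : nat := absz (4 * M + 2)%R.

Let D_ex n := string_basis_exists (@line_map_even n) (@line_map_odd n) line_length.
Definition line_strings n : (nat -> A) -> Prop := sval (cid (D_ex n)).

Lemma line_stringsP n :
  string_basis (line_space n) (line_map n) line_length (line_strings n).
Proof. exact: svalP (cid (D_ex n)). Qed.

Definition spread n (z : nat -> A) (x : int * int) : A :=
  if (x.1 + x.2 == n) && (- M <= x.1) then z (2 * absz (x.1 + M)%R)%N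
  else if (x.1 + x.2 == n + 1) && (- M < x.1)
  then z (2 * absz (x.1 + M)%R - 1)%N else 0.

Lemma spread_pos n z k : spread n z (line_pos n k) = z k.
Proof.
rewrite /spread /line_pos /=; case: ifP => [h|h0]; first by congr z; lia.
by case: ifP => h; [congr z; lia|exfalso; lia].
Qed.

Lemma spreadP n z x : (exists2 k, x = line_pos n k & spread n z x = z k) \/
  ((forall k, x != line_pos n k) /\ spread n z x = 0).
Proof.
have [[k ->]|nk] := pselect (exists k, x = line_pos n k).
  by left; exists k => //; apply: spread_pos.
right; split=> [k|]; first by apply/eqP => xk; apply: nk; exists k.
rewrite /spread; case: ifP => [h|_].
  case: nk; exists (2 * absz (x.1 + M)%R)%N; case: x h => a b /= h.
  by rewrite /line_pos; congr pair; lia.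
case: ifP => // h; case: nk; exists (2 * absz (x.1 + M)%R - 1)%N; case: x h => a b /= h.
by rewrite /line_pos; congr pair; lia.
Qed.

(* Z is the image of the standard basis of the model of C(S) in which d2 carries
   the sign [dsign] of the column. *)
Definition model_string (S : {fset int * int}) (Z : int * int -> A) :=
  [/\ forall p q, (Z (p, q) != 0) = ((p, q) \in S),
      forall p q, comp p q (Z (p, q)),
      forall p q, (p, q) \in S -> d1 (Z (p, q)) = Z (p + 1, q)
    & forall p q, (p, q) \in S -> d2 (Z (p, q)) = dsign p *: Z (p, q + 1)].

End Lines.

Section ModelStrings.
Context {K : fieldType} (A : dcomplex K).
Hypothesis A_bounded : bounded A.
Implicit Types (p q n : int) (S : {fset int * int}).
Local Notation comp := (dc_comp A).
Local Notation d1 := (dc_d1 A).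
Local Notation d2 := (dc_d2 A).
Local Notation M := (box_radius A_bounded).
Local Notation pos := (line_pos A_bounded).
Local Notation spread := (spread A_bounded).
Local Notation strings_on := (line_strings A_bounded).

Lemma dsignK p : @dsign K p * @dsign K p = 1.
Proof. by rewrite /dsign -expr2 sqrr_sign. Qed.

Lemma dsign_neq0 p : @dsign K p != 0.
Proof. by rewrite /dsign signr_eq0. Qed.

Lemma dsignS p : @dsign K (p + 1) = - @dsign K p.
Proof.
rewrite /dsign -signr_odd -[in RHS]signr_odd.
have -> : odd (absz (p + 1)%R) = ~~ odd (absz p) by lia.
by case: odd; rewrite /= ?expr0 ?expr1 ?opprK.
Qed.

(** Even positions are tops, odd ones bottoms. Two tops as ends give an odd zigzag for degree n, two
    bottoms one for degree n + 1; a top on the left and a bottom on the right give [even_shape1],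
    the reverse [even_shape2]. *)
Lemma line_shape n (m : int) (a b : nat) : (a <= b)%N -> exists S, is_shape S /\
  forall x y : int, ((x, y) \in S) =
    (x + y == n) && (- m <= x) && (a <= 2 * absz (x + m)%R <= b)%N ||
    (x + y == n + 1) && (- m < x) && (a <= 2 * absz (x + m)%R - 1 <= b)%N.
Proof.
move=> ab; have [oa|oa] := boolP (odd a); have [ob|ob] := boolP (odd b).
- exists (odd_shape (n + 1) (- m + (b./2)%:Z + 1) (n + m - (a./2)%:Z)).
  split; first by right; right; do 3!eexists.
  by move=> x y; rewrite mem_odd_shape; case: ifP; lia.
- exists (even_shape2 (b./2 - a./2) (- m + (b./2)%:Z) (n + m - (b./2)%:Z)).
  split; last by move=> x y; rewrite mem_even_shape2; lia.
  right; left; do 3!eexists; split; last by right.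
  by lia.
- exists (even_shape1 (b./2 - a./2).+1 (- m + (a./2)%:Z) (n + m - (a./2)%:Z)).
  split; last by move=> x y; rewrite mem_even_shape1; lia.
  right; left; do 3!eexists; split; last by left.
  by lia.
exists (odd_shape n (- m + (a./2)%:Z) (n + m - (b./2)%:Z)).
split; first by right; right; do 3!eexists.
by move=> x y; rewrite mem_odd_shape; case: ifP; lia.
Qed.

Lemma line_space_comp n k x : line_space A_bounded n k x ->
  comp (pos n k).1 (pos n k).2 x.
Proof.
rewrite /line_space; case: ifP => _; [move/line_bottom_nosquare|move/line_top_nosquare];
  exact: nosquare_comp.
Qed.

Lemma spread_model n z : strings_on n z ->
  exists S, is_shape S /\ model_string S (spread n z).
Proof.
have [Dstr DB] := line_stringsP A_bounded n; move=> Dz.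
have Sz := Dstr z Dz; have [[a [b [/andP[ab bN] zE]]] zL] := Sz.
have M0 := box_radius_ge0 A_bounded.
set N := line_length A_bounded in Sz bN zL Dstr DB.
have NE : N = absz (4 * M + 2)%R by [].
(* The definition of a string does not say that its entries lie in the right spaces; this comes from
   its belonging to the bases. *)
have zV k : line_space A_bounded n k (z k).
  have [kN|kN] := leqP k N; last by rewrite (string_out Sz) //; apply: sub0.
  have [zk|zk] := eqVneq (z k) 0; first by rewrite zk; apply: sub0.
  by have [W _ _] := DB k kN; apply: (W z).
have z_out k : (k == 0%N) || (N <= k)%N -> z k = 0.
  move=> kN; apply: (box_out (A_bounded := A_bounded) _ (line_space_comp (zV k))).
  by rewrite /line_pos /=; lia.
have a0 : (0 < a)%N.
  rewrite lt0n; apply/eqP => a0; have := zE 0%N; rewrite z_out // eqxx.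
  by lia.
have {bN} bN : (b < N)%N.
  rewrite ltnNge; apply/negP => Nb; have := zE b.
  by rewrite z_out ?eqxx ?Nb ?orbT //; lia.
have [S [Ssh SE]] := line_shape n M ab; exists S; split=> //.
have ZE p q : (spread n z (p, q) != 0) = ((p, q) \in S).
  rewrite SE /spread /=; case: ifP => h1; first by rewrite zE; lia.
  case: ifP => h2; first by rewrite zE; lia.
  by rewrite eqxx; lia.
have onS p q : (p, q) \in S -> exists k, [/\ (p, q) = pos n k, z k != 0,
    (0 < k)%N & (k < N)%N].
  rewrite -ZE; case: (spreadP A_bounded n z (p, q)) => [[k kE ->]|[_ ->]].
    by move=> zk; exists k; split=> //; move: zk; rewrite zE; lia.
  by rewrite eqxx.
have off p q : p + q = n + 2 -> spread n z (p, q) = 0.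
  by move=> pq; rewrite /spread /=; case: ifP => h; [lia|case: ifP => // h'; lia].
split=> // p q.
- have := spreadP A_bounded n z (p, q) => -[[k kE ->]|[_ ->]]; last exact: sub0.
  by have := line_space_comp (zV k); rewrite -kE.
- move=> /onS[k [kE zk k0 kN]]; rewrite {1}kE spread_pos.
  have := zL k kN; have := zV k; rewrite /link /line_space /line_map.
  case: ifP => ok.
    move=> /line_bottom_d1 -> _; rewrite off //.
    by move: kE; rewrite /line_pos => -[]; lia.
  move=> _ /(_ zk) <-; rewrite (_ : (p + 1, q) = pos n k.+1) ?spread_pos //.
  by move: kE; rewrite /line_pos => -[-> ->]; congr pair; lia.
move=> /onS[k [kE zk k0 kN]]; rewrite {1}kE spread_pos.
have [ok|ok] := boolP (odd k).
  have := zV k; rewrite /line_space ok => /line_bottom_d2 ->.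
  rewrite off ?scaler0 //.
  by move: kE; rewrite /line_pos => -[]; lia.
(* At a top, d1 is given by link k and d2 by link k - 1, the one that carries the sign; the sign
   squares to 1. *)
have k1 : k = k.-1.+1 by lia.
have := zL k.-1; rewrite /link /line_map -k1.
have -> : odd k.-1 by lia.
move=> /(_ _ zk) zk1.
have -> : (p, q + 1) = pos n k.-1.
  by move: kE; rewrite /line_pos => -[-> ->]; congr pair; lia.
rewrite spread_pos zk1 /=; last by lia.
have -> : (- M + (uphalf k.-1)%:Z) = p.
  by move: kE; rewrite /line_pos => -[-> _]; lia.
by rewrite scalerA dsignK scale1r.
Qed.

Definition square_string p q (w : A) (x : int * int) : A :=
  if x == (p, q) then w else if x == (p + 1, q) then d1 w
  else if x == (p, q + 1) then @dsign K p *: d2 w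
  else if x == (p + 1, q + 1) then @dsign K p *: d1 (d2 w) else 0.

Lemma square_stringE p q w : [/\ square_string p q w (p, q) = w,
  square_string p q w (p + 1, q) = d1 w,
  square_string p q w (p, q + 1) = @dsign K p *: d2 w
  & square_string p q w (p + 1, q + 1) = @dsign K p *: d1 (d2 w)].
Proof.
have neq (m : int) : (m + 1 == m) = false by lia.
have neq' (m : int) : (m == m + 1) = false by lia.
by rewrite /square_string !xpair_eqE !eqxx !neq !neq'.
Qed.

Lemma square_string_out p q w x : x \notin square_shape (p + 1) (q + 1) ->
  square_string p q w x = 0.
Proof.
case: x => a b; rewrite mem_square_shape /square_string !xpair_eqE => h.
by do 4![case: ifP => [?|_]; first by lia].
Qed.

Lemma square_string_model p q w : @square_top K A p q w ->
  model_string (square_shape (p + 1) (q + 1)) (square_string p q w).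
Proof.
move=> Ew; have Aw := square_top_comp Ew; have Dw := square_top_D Ew.
have [E1 E2 E3 E4] := square_stringE p q w.
have corner a b : (a, b) \in square_shape (p + 1) (q + 1) ->
    [\/ a = p /\ b = q, a = p + 1 /\ b = q, a = p /\ b = q + 1
      | a = p + 1 /\ b = q + 1].
  rewrite mem_square_shape; have [->|ap] := eqVneq a p; have [->|bq] := eqVneq b q.
  - by constructor 1.
  - by move=> h; constructor 3; split=> //; lia.
  - by move=> h; constructor 2; split=> //; lia.
  by move=> h; constructor 4; split; lia.
have out a b : (p + 1 < a) || (q + 1 < b) -> square_string p q w (a, b) = 0.
  by move=> ab; apply: square_string_out; rewrite mem_square_shape; lia.
split=> a b.
- have [/corner|nS] := boolP ((a, b) \in _); last first.
    by rewrite square_string_out ?eqxx.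
  case=> -[-> ->]; rewrite ?E1 ?E2 ?E3 ?E4.
  + by apply/eqP => w0; apply: Dw; rewrite w0 !linear0.
  + apply/eqP => w0; apply: Dw; apply: oppr_inj.
    by rewrite -dc_d2d1 w0 linear0 oppr0.
  + by rewrite scaler_eq0 negb_or dsign_neq0; apply/eqP => w0; apply: Dw; rewrite w0 linear0.
  by rewrite scaler_eq0 negb_or dsign_neq0; apply/eqP.
- have [/corner|nS] := boolP ((a, b) \in square_shape (p + 1) (q + 1)); last first.
    by rewrite square_string_out //; apply: sub0.
  case=> -[-> ->]; rewrite ?E1 ?E2 ?E3 ?E4 //.
  + exact: dc_d1_bideg.
  + exact/subZ/dc_d2_bideg.
  exact/subZ/dc_d1_bideg/dc_d2_bideg.
- move/corner; case=> -[-> ->]; rewrite ?E1 ?E2 ?E3 ?E4 //.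
  + by rewrite dc_d1d1 out //; lia.
  + by rewrite linearZ.
  by rewrite linearZ /= dc_d1d1 scaler0 out //; lia.
move/corner; case=> -[-> ->]; rewrite ?E1 ?E2 ?E3 ?E4 //.
+ by rewrite scalerA dsignK scale1r.
+ by rewrite dc_d2d1 dsignS scaleNr scalerA dsignK scale1r.
+ by rewrite linearZ /= dc_d2d2 scaler0 out ?scaler0 //; lia.
by rewrite linearZ /= dc_d2d1 dc_d2d2 linear0 oppr0 scaler0 out ?scaler0 //; lia.
Qed.

(** Squares and zigzags are merged into one type of strings, so that the same index set serves in
    all bidegrees. *)
Definition complex_strings (Z : int * int -> A) : Prop :=
  (exists p q w, @square_top K A p q w /\ Z = square_string p q w) \/
  (exists n z, strings_on n z /\ Z = spread n z).

Lemma complex_strings_model Z : complex_strings Z ->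
  exists S, is_shape S /\ model_string S Z.
Proof.
case=> [[p [q [w [Ew ->]]]]|[n [z [Dz ->]]]]; last exact: spread_model.
exists (square_shape (p + 1) (q + 1)); split; last exact: square_string_model.
by left; do 2!eexists.
Qed.

Lemma rel_basis_scale (V : lmodType K) (I : eqType) (U W : subspace V)
    (P : I -> Prop) (e : I -> V) (c : K) : c != 0 ->
  rel_basis U W P e -> rel_basis U W P (fun i => c *: e i).
Proof.
move=> c0 B; apply: (@rel_basis_map _ _ _ (c \*: idfun) U W U W) B.
- by move=> x; apply: subZ.
- by move=> x; apply: subZ.
- by move=> x _ Ux; rewrite -[x]scale1r -(mulVf c0) -scalerA; apply: subZ.
move=> y Wy; exists (c^-1 *: y); first exact: subZ.
by rewrite /= scalerA mulfV // scale1r subrr; apply: sub0.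
Qed.

(** Inside the box, (p, q) is reached by four families of squares, by the line p + q at the even
    position [kT], and by the line p + q - 1 at the odd position [kB]. The splittings into squares,
    bottoms and tops assemble these six bases. *)
Lemma complex_strings_basis p q : rel_basis (sub_null A) (comp p q)
  (fun Z => complex_strings Z /\ Z (p, q) != 0) (fun Z => Z (p, q)).
Proof.
have [out|inb] := boolP ((M <= `|p|) || (M <= `|q|)).
  have comp0 x : comp p q x -> x = 0 by apply: box_out out.
  have Z0 Z : complex_strings Z -> Z (p, q) = 0.
    by case/complex_strings_model => S [_ [_ ZA _ _]]; apply: comp0.
  split=> [Z [/Z0 ->]|s c _ Ps _ Z /Ps[/Z0 ->]|x /comp0 ->].
  - by rewrite eqxx.
  - by rewrite eqxx.
  exact: sub0.
have M0 := box_radius_ge0 A_bounded.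
pose Sq a b Z := exists2 w, @square_top K A a b w & Z = square_string a b w.
have Sq_inj a b Z Z' : Sq a b Z -> Sq a b Z' -> Z (a, b) = Z' (a, b) -> Z = Z'.
  case=> w _ -> [w' _ ->].
  by have [-> _ _ _] := square_stringE a b w; have [-> _ _ _] := square_stringE a b w' => ->.
have Sq_basis a b (W : subspace A) (e : A -> A) :
    rel_basis (sub_null A) W (@square_top K A a b) e ->
    (forall w, square_string a b w (p, q) = e w) ->
    rel_basis (sub_null A) W (Sq a b) (fun Z => Z (p, q)).
  move=> B eE; apply: (rel_basis_reindex (phi := fun Z => Z (a, b)) _ _ _ B).
  - by move=> _ [w Ew ->]; have [-> _ _ _] := square_stringE a b w; split.
  - by move=> Z Z'; apply: Sq_inj.
  move=> w Ew; exists (square_string a b w); first by exists w.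
  by have [] := square_stringE a b w.
have B1 := Sq_basis _ _ _ _
  (rel_basis_scale (dsign_neq0 (p - 1)) (square_basis_D A (p - 1) (q - 1))).
have B2 := Sq_basis _ _ _ _ (square_basis_d1 A (p - 1) q).
have B3 := Sq_basis _ _ _ _
  (rel_basis_scale (dsign_neq0 p) (square_basis_d2 A p (q - 1))).
have B4 := Sq_basis _ _ _ _ (square_basis A p q).
pose Ln n k Z := exists z, [/\ strings_on n z, Z = spread n z & z k != 0].
have Ln_basis n k : (k <= line_length A_bounded)%N -> pos n k = (p, q) ->
    rel_basis (sub_null A) (line_space A_bounded n k) (Ln n k) (fun Z => Z (p, q)).
  move=> kN kE; have [_ /(_ k kN) B] := line_stringsP A_bounded n.
  pose phi (Z : int * int -> A) j := Z (pos n j).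
  have phiK z : phi (spread n z) = z by apply/funext => j; apply: spread_pos.
  apply: (rel_basis_reindex (phi := phi) _ _ _ B).
  - by move=> _ [z [Dz -> zk]]; rewrite phiK -kE spread_pos.
  - by move=> _ _ [z [_ -> _]] [w [_ -> _]]; rewrite !phiK => ->.
  by move=> z [Dz zk]; exists (spread n z); [exists z|apply: phiK].
pose kT := (2 * absz (p + M)%R)%N; pose kB := (2 * absz (p + M)%R - 1)%N.
have kTE : pos (p + q) kT = (p, q) by rewrite /line_pos /kT; congr pair; lia.
have kBE : pos (p + q - 1) kB = (p, q) by rewrite /line_pos /kB; congr pair; lia.
have BT : rel_basis (sub_null A) (line_top A p q) (Ln (p + q) kT) (fun Z => Z (p, q)).
  have := Ln_basis (p + q) kT; rewrite /line_space kTE.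
  have -> : odd kT = false by rewrite /kT; lia.
  by apply=> //; rewrite /kT /line_length; lia.
have BB : rel_basis (sub_null A) (line_bottom A p q) (Ln (p + q - 1) kB)
    (fun Z => Z (p, q)).
  have := Ln_basis (p + q - 1) kB; rewrite /line_space kBE.
  have -> : odd kB by rewrite /kB; lia.
  by apply=> //; rewrite /kB /line_length; lia.
have e1 w : square_string (p - 1) (q - 1) w (p, q) =
    @dsign K (p - 1) *: (d1 \o d2) w.
  by have [_ _ _] := square_stringE (p - 1) (q - 1) w; rewrite !subrK.
have e2 w : square_string (p - 1) q w (p, q) = d1 w.
  by have [_ + _ _] := square_stringE (p - 1) q w; rewrite !subrK.
have e3 w : square_string p (q - 1) w (p, q) = @dsign K p *: d2 w.
  by have [_ _ + _] := square_stringE p (q - 1) w; rewrite !subrK.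
have e4 w : square_string p q w (p, q) = w by have [] := square_stringE p q w.
have C := square_chain_basis (B1 e1) (B2 e2) (B3 e3) (B4 e4) (line_basis BB BT).
apply: rel_basis_ext C => Z; split.
  have nz a b w : @square_top K A a b w -> (p, q) \in square_shape (a + 1) (b + 1) ->
      square_string a b w (p, q) != 0.
    by move=> Ew pqS; have [-> _ _ _] := square_string_model Ew.
  have sq a b : (p, q) \in square_shape (a + 1) (b + 1) -> Sq a b Z ->
      complex_strings Z /\ Z (p, q) != 0.
    by move=> pqS [w Ew ->]; split; [left; exists a, b, w|apply: nz].
  have ln n k : pos n k = (p, q) -> Ln n k Z -> complex_strings Z /\ Z (p, q) != 0.
    by move=> kE [z [Dz -> zk]]; split; [right; exists n, z|rewrite -kE spread_pos].
  case=> [|[|[|[|[]]]]].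
  - by apply: sq; rewrite mem_square_shape; lia.
  - by apply: sq; rewrite mem_square_shape; lia.
  - by apply: sq; rewrite mem_square_shape; lia.
  - by apply: sq; rewrite mem_square_shape; lia.
  - exact: ln.
  exact: ln.
case=> -[[a [b [w [Ew ->]]]]|[n [z [Dz ->]]]] Z0.
  have : (p, q) \in square_shape (a + 1) (b + 1).
    by have [<- _ _ _] := square_string_model Ew.
  rewrite mem_square_shape => ab.
  have [ap|ap] := eqVneq a p; have [bq|bq] := eqVneq b q.
  - by do 3!right; left; exists w; rewrite -?ap -?bq.
  - right; right; left; have -> : q - 1 = b by lia.
    by exists w; rewrite -?ap.
  - right; left; have -> : p - 1 = a by lia.
    by exists w; rewrite -?bq.
  left; have -> : p - 1 = a by lia.
  have -> : q - 1 = b by lia.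
  by exists w.
do 4!right; move: Z0; have [[k kE ->]|[_ ->]] := spreadP A_bounded n z (p, q); last first.
  by rewrite eqxx.
move=> zk; have [ok|ok] := boolP (odd k); [left|right].
  have -> : p + q - 1 = n by move: kE; rewrite /line_pos => -[-> ->]; lia.
  have -> : kB = k by move: kE; rewrite /line_pos /kB => -[-> _]; lia.
  by exists z.
have -> : p + q = n by move: kE; rewrite /line_pos => -[-> ->]; lia.
have -> : kT = k by move: kE; rewrite /line_pos /kT => -[-> _]; lia.
by exists z.
Qed.

End ModelStrings.

(** * The standard model of C(S) *)

Section ModelComplex.
Context {K : fieldType}.
Variable S : {fset int * int}.
Implicit Types (p q : int) (x : int * int).

Let C := {ffun S -> K^o}.

(** It is 0 for x outside S, so the formulas for the differentials need no case distinction on the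
    target. *)
Definition model_delta x : C := [ffun u => (val u == x)%:R].
Local Notation delta := model_delta.

Lemma model_delta_out x : x \notin S -> delta x = 0.
Proof.
move=> xS; apply/ffunP => u; rewrite !ffunE; case: eqP => // ux.
by case/negP: xS; rewrite -ux; apply: valP.
Qed.

Lemma model_delta_neq0 x : x \in S -> delta x <> 0.
Proof.
move=> xS /ffunP/(_ [` xS]%fset); rewrite !ffunE eqxx => /eqP.
by rewrite oner_eq0.
Qed.

Lemma model_delta_dec (f : C) : f = \sum_(u : S) f u *: delta (val u).
Proof.
apply/ffunP => v; rewrite sum_ffunE (bigD1 v) //= big1 => [|u uv].
  by rewrite addr0 !ffunE eqxx /= [_ *: _]mulr1.
rewrite !ffunE; case: eqP => [/val_inj vu|_]; first by rewrite vu eqxx in uv.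
exact: mulr0.
Qed.

Section LinearExtension.
Context {V : lmodType K} (g : int * int -> V).

Let ext (f : C) : V := \sum_(u : S) f u *: g (val u).

Let ext_linear : linear ext.
Proof.
move=> a f f'; rewrite /ext scaler_sumr -big_split; apply: eq_bigr => u _ /=.
by rewrite !ffunE scalerDl scalerA.
Qed.

Let ext_ex : exists G : {linear C -> V}, forall f, G f = ext f.
Proof.
pose G : {linear C -> V} :=
  HB.pack ext (GRing.isLinear.Build K C V *:%R ext ext_linear).
by exists G.
Qed.

Definition model_ext : {linear C -> V} := sval (cid ext_ex).

Lemma model_extE f : model_ext f = \sum_(u : S) f u *: g (val u).
Proof. exact: svalP (cid ext_ex) f. Qed.

Lemma model_ext_delta x : model_ext (delta x) = if x \in S then g x else 0.
Proof.
rewrite model_extE; case: ifP => xS; last first.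
  by rewrite model_delta_out ?xS // big1 // => u _; rewrite ffunE scale0r.
rewrite (bigD1 [` xS]%fset) //= big1 => [|u ux].
  by rewrite addr0 ffunE eqxx scale1r.
rewrite ffunE; case: eqP => [e|_]; last exact: scale0r.
by case/eqP: ux; apply: val_inj.
Qed.

End LinearExtension.

Lemma model_linear_eq (V : lmodType K) (f g : {linear C -> V}) :
  (forall x, x \in S -> f (delta x) = g (delta x)) -> f =1 g.
Proof.
move=> fg y; rewrite (model_delta_dec y) !linear_sum; apply: eq_bigr => u _.
by rewrite !linearZ fg //; apply: valP.
Qed.

Definition model_comp p q : subspace C.
Proof.
exists (fun f => exists a, f = a *: delta (p, q)); first by exists 0; rewrite scale0r.
by move=> a _ _ [b ->] [c ->]; exists (a * b + c); rewrite scalerDl scalerA.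
Defined.

Lemma model_direct : direct_sum (fun x : int * int => model_comp x.1 x.2).
Proof.
split=> [f|s w us Cw w0 i si].
  rewrite (model_delta_dec f); apply: sub_lin => u _.
  by apply: (@sub_sum_in _ _ _ _ _ (val u)) => //=; exists (f u); case: (val u).
have /choice[a aE] (j : int * int) : exists a, j \in s -> w j = a *: delta j.
  case: (boolP (j \in s)) => [js|]; last by exists 0.
  by have [a ->] := Cw j js; exists a; case: (j).
have [iS|iS] := boolP (i \in S); last by rewrite aE // model_delta_out ?scaler0.
have /ffunP/(_ [` iS]%fset) := w0; rewrite sum_ffunE (bigD1_seq i) //=.
rewrite big_seq_cond big1 => [|j /andP[js ji]].
  rewrite addr0 aE // !ffunE eqxx => /eqP; rewrite [_ *: _]mulr1 => /eqP ->.
  exact: scale0r.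
by rewrite aE // !ffunE eq_sym (negbTE ji); apply: mulr0.
Qed.

Definition model_d1 := model_ext (fun x => delta (x.1 + 1, x.2)).
Definition model_d2 :=
  model_ext (fun x => @dsign K x.1 *: delta (x.1, x.2 + 1)).

Lemma model_d1E p q : (p, q) \in S -> model_d1 (delta (p, q)) = delta (p + 1, q).
Proof. by move=> pqS; rewrite model_ext_delta pqS. Qed.

Lemma model_d2E p q : (p, q) \in S ->
  model_d2 (delta (p, q)) = @dsign K p *: delta (p, q + 1).
Proof. by move=> pqS; rewrite model_ext_delta pqS. Qed.

Lemma model_d1_bideg p q f : model_comp p q f -> model_comp (p + 1) q (model_d1 f).
Proof.
case=> a ->; rewrite linearZ; apply: subZ; have [pqS|pqS] := boolP ((p, q) \in S).
  by rewrite model_d1E //; exists 1; rewrite scale1r.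
by rewrite model_delta_out // linear0; apply: sub0.
Qed.

Lemma model_d2_bideg p q f : model_comp p q f -> model_comp p (q + 1) (model_d2 f).
Proof.
case=> a ->; rewrite linearZ; apply: subZ; have [pqS|pqS] := boolP ((p, q) \in S).
  by rewrite model_d2E //; exists (@dsign K p).
by rewrite model_delta_out // linear0; apply: sub0.
Qed.

Hypothesis S_shape : is_shape S.

(** This is what a subset of the grid must satisfy for the model to be a double complex: no three
    consecutive bidegrees in a row or column, and for opposite corners both or neither of the paths
    between them. *)
Lemma shape_sparse p q : (p, q) \in S ->
  [/\ (p + 1, q) \in S -> (p + 1 + 1, q) \notin S,
      (p, q + 1) \in S -> (p, q + 1 + 1) \notin S
    & (p + 1, q + 1) \in S -> ((p + 1, q) \in S) = ((p, q + 1) \in S)].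
Proof.
case: S_shape => [[a [b ->]]|[[r [a [b [_ [->|->]]]]]|[d [a [b ->]]]]].
- by rewrite !mem_square_shape => h; split; lia.
- by rewrite !mem_even_shape1 => h; split; lia.
- by rewrite !mem_even_shape2 => h; split; lia.
by rewrite !mem_odd_shape; case: ifP => h h'; split; lia.
Qed.

Lemma model_d1d1 f : model_d1 (model_d1 f) = 0.
Proof.
apply: (@model_linear_eq _ (model_d1 \o model_d1) \0) => -[p q] pqS /=.
rewrite model_d1E //; have [pS|pS] := boolP ((p + 1, q) \in S).
  by rewrite model_d1E // model_delta_out //; have [->] := shape_sparse pqS.
by rewrite model_delta_out // linear0.
Qed.

Lemma model_d2d2 f : model_d2 (model_d2 f) = 0.
Proof.
apply: (@model_linear_eq _ (model_d2 \o model_d2) \0) => -[p q] pqS /=.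
rewrite model_d2E //; have [pS|pS] := boolP ((p, q + 1) \in S).
  by rewrite linearZ /= model_d2E // model_delta_out ?scaler0 //;
    have [_ ->] := shape_sparse pqS.
by rewrite model_delta_out // scaler0 linear0.
Qed.

Lemma model_anticomm f : model_d1 (model_d2 f) + model_d2 (model_d1 f) = 0.
Proof.
apply: (@model_linear_eq _ ((model_d1 \o model_d2) \+ (model_d2 \o model_d1)) \0).
move=> -[p q] pqS /=; rewrite model_d2E // model_d1E // linearZ /=.
have [S3|S3] := boolP ((p + 1, q + 1) \in S); last first.
  have -> : model_d1 (delta (p, q + 1)) = 0.
    have [S2|S2] := boolP ((p, q + 1) \in S); first by rewrite model_d1E // model_delta_out.
    by rewrite (model_delta_out S2) linear0.
  have -> : model_d2 (delta (p + 1, q)) = 0.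
    have [S2|S2] := boolP ((p + 1, q) \in S).
      by rewrite model_d2E // model_delta_out // scaler0.
    by rewrite (model_delta_out S2) linear0.
  by rewrite scaler0 addr0.
have [_ _ /(_ S3) e] := shape_sparse pqS; have [S1|S1] := boolP ((p + 1, q) \in S).
  rewrite model_d1E -?e // model_d2E // dsignS -scalerDl subrr.
  exact: scale0r.
have S2 : (p, q + 1) \notin S by rewrite -e.
by rewrite (model_delta_out S1) (model_delta_out S2) !linear0 ?scaler0 addr0.
Qed.

Definition model_complex : dcomplex K := @DComplex K C model_comp model_direct
  model_d1 model_d2 model_d1_bideg model_d2_bideg model_d1d1 model_d2d2
  model_anticomm.

Lemma model_is_C : is_C S model_complex.
Proof.
split=> p q.
- have [pqS|pqS] := boolP ((p, q) \in S); last first.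
    exists (fun=> 0); split=> [[]//|x [a ->]]; exists 0; split=> [|c _].
      by rewrite big_ord0 model_delta_out // scaler0.
    by apply/matrixP => i [].
  exists (fun=> delta (p, q)); split=> [i|_ [a ->]].
    by exists 1; rewrite scale1r.
  exists (const_mx a); split=> [|c]; first by rewrite big_ord1 mxE.
  rewrite big_ord1 => /eqP; rewrite -subr_eq0 -scalerBl => /eqP ac.
  apply/matrixP => i j; rewrite mxE !ord1; apply/eqP; rewrite -subr_eq0.
  apply: contrapT => /negP ac0; apply: (model_delta_neq0 pqS).
  by rewrite -[LHS]scale1r -(mulVf ac0) -scalerA ac scaler0.
- move=> pqS pS _ [a ->]; exists (a *: delta (p, q)); split.
    split; first by exists a.
    by rewrite linearZ /= model_d1E.
  move=> _ [[b ->]]; rewrite linearZ /= model_d1E // => /eqP.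
  rewrite -subr_eq0 -scalerBl => /eqP ab; congr (_ *: _); apply/eqP.
  rewrite eq_sym -subr_eq0; apply: contrapT => /negP ab0.
  apply: (model_delta_neq0 pS).
  by rewrite -[LHS]scale1r -(mulVf ab0) -scalerA ab scaler0.
(* The sign is its own inverse, so this is the preimage of a times the generator. *)
move=> pqS pS _ [a ->]; exists (a * @dsign K p *: delta (p, q)); split.
  split; first by exists (a * @dsign K p).
  by rewrite linearZ /= model_d2E // scalerA -mulrA dsignK mulr1.
move=> _ [[b ->]]; rewrite linearZ /= model_d2E // scalerA => /eqP.
rewrite -subr_eq0 -scalerBl => /eqP ab; congr (_ *: _).
suff <- : b * @dsign K p = a by rewrite -mulrA dsignK mulr1.
apply/eqP; rewrite -subr_eq0; apply: contrapT => /negP ab0.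
apply: (model_delta_neq0 pS).
by rewrite -[LHS]scale1r -(mulVf ab0) -scalerA ab scaler0.
Qed.

(** The last clause confines every component of the image to the line spanned by the corresponding
    entry of Z; independence of different copies is tested on it. *)
Lemma model_embedding (A : dcomplex K) (Z : int * int -> A) : model_string S Z ->
  exists f : {linear model_complex -> A}, [/\ dc_morphism f, injective f,
    forall x, x \in S -> exists y, f y = Z x
    & forall y x, exists c, dc_pr A x (f y) = c *: Z x].
Proof.
case=> ZS ZA Zd1 Zd2; pose f : {linear model_complex -> A} := model_ext Z.
have Z0 x : x \notin S -> Z x = 0.
  by case: x => p q; rewrite -ZS negbK => /eqP.
have fdelta x : f (delta x) = Z x.
  by rewrite model_ext_delta; case: ifP => // /negbT /Z0.
have prZ x y : x != y -> dc_pr A x (Z y) = 0.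
  by case: y => p q /(dc_pr_neq (ZA p q)).
have prZZ x : dc_pr A x (Z x) = Z x by case: x => p q; apply: dc_pr_id.
have prf (y : C) (u : S) : dc_pr A (val u) (f y) = y u *: Z (val u).
  rewrite model_extE linear_sum (bigD1 u) //= big1 => [|v vu].
    by rewrite addr0 linearZ /= prZZ.
  rewrite linearZ /= prZ ?scaler0 //.
  by apply: contraNneq vu => /val_inj ->.
exists f; split.
- split=> [p q _ [a ->]|y|y].
  + by rewrite linearZ fdelta; apply: subZ.
  + apply: (@model_linear_eq _ (f \o model_d1) (dc_d1 A \o f)) => -[p q] pqS /=.
    by rewrite model_d1E // !fdelta Zd1.
  apply: (@model_linear_eq _ (f \o model_d2) (dc_d2 A \o f)) => -[p q] pqS /=.
  by rewrite model_d2E // linearZ /= !fdelta Zd2.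
- move=> y y' fyy; apply/ffunP => u; apply/eqP; rewrite -subr_eq0.
  apply: contrapT => /negP yu0; have : Z (val u) = 0.
    rewrite -[LHS]scale1r -(mulVf yu0) -scalerA scalerBl -!prf fyy subrr.
    exact: scaler0.
  by apply/eqP; have := valP u; case: (val u) => p q; rewrite ZS.
- by move=> x xS; exists (delta x); apply: fdelta.
move=> y x; have [xS|xS] := boolP (x \in S).
  by exists (y [` xS]%fset); rewrite -prf.
exists 0; rewrite scale0r model_extE linear_sum big1 // => u _.
rewrite linearZ /= prZ ?scaler0 //.
by apply: contraNneq xS => ->; apply: valP.
Qed.

End ModelComplex.

Section Decomposition.
Context {K : fieldType} (A : dcomplex K).
Hypothesis A_bounded : bounded A.
Implicit Types (S : {fset int * int}) (Z : int * int -> A).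

Let generator S Z :=
  `[< [/\ complex_strings A_bounded Z, is_shape S & model_string S Z] >].

Definition generators S : eqType := {Z : int * int -> A | generator S Z}.

(** A complex is required for every finite set, so [A] serves as a placeholder when S is not a
    shape. For a shape, one model must receive all strings supported on S. *)
Let C_ex S : exists X : dcomplex K, is_shape S -> is_C S X /\
  forall Z, model_string S Z -> exists f : {linear X -> A},
    [/\ dc_morphism f, injective f, forall x, x \in S -> exists y, f y = Z x
      & forall y x, exists c, dc_pr A x (f y) = c *: Z x].
Proof.
have [Ssh|nS] := pselect (is_shape S); last by exists A.
exists (model_complex Ssh) => _; split; first exact: model_is_C.
by move=> Z; apply: model_embedding.
Qed.

Let C S := sval (cid (C_ex S)).

Let I := {S : {fset int * int} & generators S}.
Let string_of (i : I) : int * int -> A := val (tagged i).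

Let string_ofP (i : I) :
  [/\ complex_strings A_bounded (string_of i), is_shape (tag i)
    & model_string (tag i) (string_of i)].
Proof. by apply/asboolP; apply: (valP (tagged i)). Qed.

Let string_of_inj i j : string_of i = string_of j -> i = j.
Proof.
have [_ _ [Si _ _ _]] := string_ofP i; have [_ _ [Sj _ _ _]] := string_ofP j.
move=> ij; have : tag i = tag j.
  by apply/fsetP => -[p q]; rewrite -Si -Sj ij.
case: i j ij {Si Sj} => S Zi [S' Zj] /= ij SS; case: _ / SS in Zj ij *.
by congr Tagged; apply: val_inj.
Qed.

Let f_ex (i : I) : exists f : {linear C (tag i) -> A},
  [/\ dc_morphism f, injective f,
      forall x, x \in tag i -> exists y, f y = string_of i x
    & forall y x, exists c, dc_pr A x (f y) = c *: string_of i x].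
Proof.
by have [_ Ssh Zi] := string_ofP i; have [_] := svalP (cid (C_ex (tag i))) Ssh; apply.
Qed.

(** The copies of C(S) are indexed by the strings supported on S. As a string determines its
    support, pairs of a shape and a string are the same as strings, and [complex_strings_basis]
    gives spanning and independence bidegree by bidegree. *)
Lemma multiplicities_exist : exists m, multiplicities A m.
Proof.
exists generators; split=> [S nS [Z /asboolP[_ ]]|] //.
exists C; split=> [S Ssh|]; first by have [] := svalP (cid (C_ex S)) Ssh.
pose f i := sval (cid (f_ex i)).
have fP i : [/\ dc_morphism (f i), injective (f i),
    forall x, x \in tag i -> exists y, f i y = string_of i x
  & forall y x, exists c, dc_pr A x (f i y) = c *: string_of i x].
  exact: svalP (cid (f_ex i)).
have basis p q : rel_basis (sub_null A) (dc_comp A p q)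
    (fun i : I => string_of i (p, q) != 0) (fun i => string_of i (p, q)).
  apply: (rel_basis_reindex (phi := string_of) _ _ _ (complex_strings_basis A_bounded p q)).
  - by move=> i i0; split=> //; split=> //; have [] := string_ofP i.
  - by move=> i j _ _; apply: string_of_inj.
  move=> Z [strZ Z0]; have [S [Ssh SZ]] := complex_strings_model strZ.
  have gZ : generator S Z by apply/asboolP.
  by exists (Tagged generators (exist _ Z gZ : generators S)).
exists f; split; [by move=> i; have [] := fP i|by move=> i; have [] := fP i|].
split=> [x|s w us fw w0 i si].
  have [t [_ _ ->]] := dc_pr_dec x; apply: sub_lin => -[p q] _.
  have [_ _ /(_ _ (dc_pr_in p q x))[_ [y [-> Ly ->]]]] := basis p q.
  rewrite add0r; move: y Ly; apply: lspan_min => i i0.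
  have [_ _ [SE _ _ _]] := string_ofP i; have [_ _ fim _] := fP i.
  apply: (@sub_sum_in _ _ _ _ _ i) => //.
  have [|y yE] := fim (p, q); first by rewrite -SE.
  by exists y.
apply: dc_pr_eq0 => -[p q]; have [_ fr _] := basis p q.
have /choice[c cE] (j : I) : exists c, j \in s ->
    dc_pr A (p, q) (w j) = c *: string_of j (p, q).
  case: (boolP (j \in s)) => [js|]; last by exists 0.
  have [y [_ ->]] := fw j js; have [_ _ _ /(_ y (p, q))[c e]] := fP j.
  by exists c.
have [Z0|Z0] := eqVneq (string_of i (p, q)) 0; first by rewrite cE // Z0 scaler0.
(* Strings that vanish at (p, q) are no members of the basis there and contribute nothing to the
   relation, so they are filtered out first. *)
rewrite cE // (fr [seq j <- s | string_of j (p, q) != 0] c) ?scale0r //.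
- exact: filter_uniq.
- by move=> j; rewrite mem_filter => /andP[].
- rewrite big_filter; have := congr1 (dc_pr A (p, q)) w0; rewrite linear0 linear_sum.
  rewrite (bigID (fun j => string_of j (p, q) != 0)) /= addrC big1_seq ?add0r.
    move=> e; apply: etrans e; rewrite big_seq_cond [RHS]big_seq_cond.
    by apply: eq_bigr => j /andP[js _]; rewrite cE.
  by move=> j /andP[/negPn/eqP j0 js]; rewrite cE // j0 scaler0.
by rewrite mem_filter Z0.
Qed.

End Decomposition.

(** * Dimensions *)

Section RelativeDimension.
Context {K : fieldType} {V : lmodType K}.
Implicit Types (U W : subspace V) (n m : nat).

(* U need not be contained in W: this is dim (W / (U :&: W)) = n. *)
Definition rdim U W n :=
  exists (I : finType) (e : I -> V), #|I| = n /\ rel_basis U W (fun=> True) e.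

Lemma rel_free_fin (I : finType) U (e : I -> V) (c : I -> K) :
  rel_free U (fun=> True) e -> U (\sum_i c i *: e i) -> forall i, c i = 0.
Proof.
move=> fr Uc i; apply: (fr (enum I) c); rewrite ?enum_uniq ?mem_enum //.
by rewrite big_enum.
Qed.

Lemma rel_span_fin (I : finType) U W (e : I -> V) x :
  rel_basis U W (fun=> True) e -> W x -> exists c, U (x - \sum_i c i *: e i).
Proof.
case=> _ _ sp /sp[u [v [Uu [s [c [us _ ->]]] ->]]].
exists (fun i => if i \in s then c i else 0).
rewrite (_ : \sum_i _ = \sum_(i <- s) c i *: e i) ?addrK //.
rewrite -big_enum (@big_uniq_widen _ _ s) ?enum_uniq //.
- by rewrite big_seq [RHS]big_seq; apply: eq_bigr => i ->.
- by move=> i; rewrite mem_enum.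
by move=> i /negbTE ->; rewrite scale0r.
Qed.

Lemma rdim_exchange U W n (J : finType) (f : J -> V) : rdim U W n ->
  (forall j, W (f j)) -> rel_free U (fun=> True) f -> (#|J| <= n)%N.
Proof.
case=> I [e [<- B]] Wf fr; rewrite leqNgt; apply/negP => IJ.
have /choice[c cE] (j : J) : exists c, U (f j - \sum_i c i *: e i).
  exact: rel_span_fin B (Wf j).
pose X : 'M[K]_(#|J|, #|I|) := \matrix_(j, i) c (enum_val j) (enum_val i).
(* X has more rows than columns, so its rows satisfy a nontrivial relation v; the combination of the
   f j with coefficients v then lies in U, against their independence. *)
have : kermx X != 0.
  rewrite kermx_eq0 -row_leq_rank -ltnNge; exact: leq_ltn_trans (rank_leq_col X) IJ.
case/rowV0Pn => v /sub_kermxP vX v0; case/eqP: v0; apply/rowP => j.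
rewrite mxE -(enum_valK j); move: (enum_val j) => {}j.
apply: (rel_free_fin (c := fun j => v 0 (enum_rank j)) fr _ j).
have -> : \sum_j v 0 (enum_rank j) *: f j =
    \sum_j v 0 (enum_rank j) *: (f j - \sum_i c j i *: e i).
  under [RHS]eq_bigr do rewrite scalerBr; rewrite sumrB.
  rewrite [X in _ - X](_ : _ = 0) ?subr0 //.
  under eq_bigr do rewrite scaler_sumr; rewrite exchange_big big1 //= => i _.
  under eq_bigr do rewrite scalerA; rewrite -scaler_suml.
  rewrite (_ : \sum_j v 0 (enum_rank j) * c j i = (v *m X) 0 (enum_rank i)).
    by rewrite vX mxE scale0r.
  rewrite mxE (reindex (@enum_rank J)) /=; last first.
    by apply: onW_bij; apply: enum_rank_bij.
  by apply: eq_bigr => k _; rewrite mxE !enum_rankK.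
by apply: sub_lin => k _; apply: subZ.
Qed.

Lemma rdim_uniq U W n m : rdim U W n -> rdim U W m -> n = m.
Proof.
move=> dn dm; have [I [e [In [We fe _]]]] := dn; have [J [f [Jm [Wf ff _]]]] := dm.
apply/eqP; rewrite eqn_leq -{1}In -{2}Jm.
rewrite (rdim_exchange dm (fun i => We i Logic.I) fe).
by rewrite (rdim_exchange dn (fun i => Wf i Logic.I) ff).
Qed.

(** In a basis supplied by Zorn's lemma, a finite list of maximal length must contain every basis
    vector. *)
Lemma rdim_bounded U W n :
  (forall s : seq V, uniq s -> (forall v, v \in s -> W v) ->
     rel_free U (fun v => v \in s) id -> (size s <= n)%N) ->
  exists m, rdim U W m.
Proof.
move=> bnd; have [E B] := rel_basis_exists U W; have [We fr sp] := B.
pose P k := `[< exists s : seq V,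
  [/\ uniq s, forall v, v \in s -> E v & size s = k] >].
have P0 : exists k, P k by exists 0%N; apply/asboolP; exists [::].
have Pn k : P k -> (k <= n)%N.
  move=> /asboolP[s [us Es <-]]; apply: bnd => // [v /Es/We//|t c ut ts].
  by apply: fr => // v /ts/Es.
case: (ex_maxnP P0 Pn) => k /asboolP[s [us Es sk]] kmax.
exists #|{: seq_sub s}|, (seq_sub s : finType), val; split=> //.
apply: (rel_basis_reindex (phi := val) _ _ _ B).
- by move=> u _; split=> //; apply/Es/valP.
- by move=> u v _ _; apply: val_inj.
move=> v Ev; have vs : v \in s.
  apply: contraT => vs; have /kmax : P k.+1; last by rewrite ltnn.
  apply/asboolP; exists (v :: s); split=> /=; rewrite ?vs ?sk //.
  by move=> u; rewrite inE => /orP[/eqP ->|/Es].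
by exists (SeqSub vs).
Qed.

Lemma rel_free_seq_sub U (s : seq V) : rel_free U (fun v => v \in s) id ->
  rel_free U (fun=> True) (val : seq_sub s -> V).
Proof.
move=> fr t c ut _ Ut i it; pose c' v := if insub v is Some u then c u else 0.
have c'E (u : seq_sub s) : c' (val u) = c u by rewrite /c' valK.
rewrite -c'E; apply: (fr (map val t)) => [|v /mapP[u _ ->]||].
- by rewrite map_inj_uniq //; apply: val_inj.
- exact: valP.
- by rewrite big_map; under eq_bigr do rewrite c'E.
exact: map_f.
Qed.

Lemma rdim_sub U W U1 W1 n : (forall x, U x -> U1 x) -> (forall x, W1 x -> W x) ->
  rdim U W n -> exists m, rdim U1 W1 m.
Proof.
move=> UU WW dn; apply: (@rdim_bounded _ _ n) => s us Ws fr.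
rewrite -(card_seq_sub us); apply: (@rdim_exchange U W n _ val dn).
  by move=> u; apply/WW/Ws/valP.
by apply: rel_free_seq_sub => t c ut ts Ut; apply: fr => //; apply: UU.
Qed.

Lemma rel_basis_embed (I J : eqType) U W (k : J -> I) (e : I -> V) :
  injective k -> rel_basis U W (fun=> True) (e \o k) ->
  rel_basis U W (fun i => exists j, k j = i) e.
Proof.
move=> k_inj B; have [[j0 _]|nJ] := pselect (exists j : J, True).
  have /choice[phi phiE] i : exists j, (exists j', k j' = i) -> k j = i.
    have [[j <-]|ni] := pselect (exists j', k j' = i); first by exists j.
    by exists j0 => /ni.
  apply: (rel_basis_reindex (phi := phi) _ _ _ B) => [i /phiE /= ->//|i i' Pi Pi'|j _].
    by move=> e_phi; rewrite -(phiE i Pi) e_phi phiE.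
  by exists (k j); [exists j|apply/k_inj/phiE; exists j].
have [_ _ sp] := B; split=> [i [j _]|s c us Ps _ i /Ps[j _]|x /sp].
- by case: nJ; exists j.
- by case: nJ; exists j.
case=> u [v [Uu [s [c [_ _ ->]]] ->]]; rewrite big1 ?addr0; first exact: sub_addl.
by move=> j; case: nJ; exists j.
Qed.

Lemma rdim_trans U0 U1 U2 n m : (forall x, U0 x -> U1 x) -> (forall x, U1 x -> U2 x) ->
  rdim U0 U1 n -> rdim U1 U2 m -> rdim U0 U2 (n + m).
Proof.
move=> U01 U12 [I [e [<- Be]]] [J [f [<- Bf]]].
pose g (s : I + J) := match s with inl i => e i | inr j => f j end.
exists (I + J)%type, g; split; first exact: card_sum.
have inlI : injective (@inl I J) by move=> i i' [].
have inrI : injective (@inr I J) by move=> j j' [].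
have B1 := rel_basis_embed (e := g) inlI Be.
have B2 := rel_basis_embed (e := g) inrI Bf.
apply: rel_basis_ext (rel_basis_trans U01 U12 B1 B2) => -[i|j]; split=> // _.
  by left; exists i.
by right; exists j.
Qed.

Lemma rdim_iso U W U' W' n : (forall x, U x -> U' x) -> (forall x, W x -> W' x) ->
  (forall x, W x -> U' x -> U x) ->
  (forall y, W' y -> exists2 x, W x & U' (y - x)) -> rdim U W n -> rdim U' W' n.
Proof.
move=> UU WW U'U W'W [I [e [In B]]]; exists I, e; split=> //.
exact: (@rel_basis_map _ _ _ idfun U W U' W').
Qed.

Lemma rdim0 U W : rdim U W 0 <-> (forall x, W x -> U x).
Proof.
split=> [[I [e [/card0_eq I0 [_ _ sp]]]] x /sp[u [v [Uu [s [c [_ _ ->]]] ->]]]|WU].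
  by rewrite big1 ?addr0 // => i; have := I0 i.
exists void, (@of_void V); split; first exact: card_void.
by split=> [[]|s c _ _ _ []|x /WU Ux]; apply: sub_addl.
Qed.

Lemma has_dimP W n : has_dim W n <-> rdim (sub_null V) W n.
Proof.
split=> [[e [We sp]]|[I [e [In B]]]].
  exists 'I_n, e; split; first exact: card_ord.
  split=> // [s c us _ s0 i si|x Wx].
    have [b [_ bu]] := sp 0 (sub0 _).
    pose r : 'rV[K]_n := \row_j if j \in s then c j else 0.
    have r0 : 0 = \sum_j r 0 j *: e j.
      rewrite -[LHS]s0 -big_enum (@big_uniq_widen _ _ s (enum 'I_n)) ?enum_uniq //.
      - rewrite [LHS]big_seq [RHS]big_seq; apply: eq_bigr => j js.
        by rewrite mxE js.
      - by move=> j; rewrite mem_enum.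
      by move=> j js; rewrite mxE (negbTE js) scale0r.
    have b0 : b = 0 by apply: bu; rewrite big1 // => j _; rewrite mxE scale0r.
    have := bu r r0; rewrite b0 => /rowP/(_ i).
    by rewrite !mxE si => <-.
  apply: sub_addr; have [c [-> _]] := sp x Wx; exists (enum 'I_n), (c 0).
  by rewrite enum_uniq big_enum.
have [We fr _] := B; case: _ / In.
exists (e \o enum_val); split=> [i|x Wx]; first exact: We.
have [c cE] := rel_span_fin B Wx.
have sumE (b : 'rV[K]_#|I|) : \sum_i b 0 i *: e (enum_val i) =
    \sum_i b 0 (enum_rank i) *: e i.
  rewrite (reindex (@enum_rank I)) /=; last by apply: onW_bij; apply: enum_rank_bij.
  by apply: eq_bigr => i _; rewrite enum_rankK.
exists (\row_i c (enum_val i)); split=> [|b xE].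
  rewrite sumE; apply/eqP; rewrite -subr_eq0; apply/eqP; rewrite -[RHS]cE.
  by congr (_ - _); apply: eq_bigr => i _; rewrite mxE enum_rankK.
apply/rowP => i; rewrite mxE -[i in RHS]enum_valK; move: (enum_val i) => {}i.
apply/eqP; rewrite -subr_eq0; apply/eqP.
apply: (rel_free_fin (c := fun i => c i - b 0 (enum_rank i)) fr).
under eq_bigr do rewrite scalerBl; rewrite sumrB -sumE -xE -opprB.
by rewrite [x - _]cE; apply: subN; apply: sub0.
Qed.

Lemma sdimE W n : rdim (sub_null V) W n -> sdim W = n.
Proof.
move=> dn; rewrite /sdim; case: xgetP => [m _ /has_dimP dm|/(_ n)].
  exact: rdim_uniq dm dn.
by case; apply/has_dimP.
Qed.

Lemma rdim_chain (G : int -> subspace V) (g : int -> nat) (a : int) (k : nat) :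
  (forall (j : int) x, G (j + 1) x -> G j x) ->
  (forall j, a <= j < a + k%:Z -> rdim (G (j + 1)) (G j) (g j)) ->
  rdim (G (a + k%:Z)) (G a) (\sum_(i < k) g (a + i%:Z)%R)%N.
Proof.
move=> Gd dg; elim: k dg => [|k IH] dg.
  have -> : a + 0%N = a by lia.
  by rewrite big_ord0; apply/rdim0.
have GG : forall x, G (a + k%:Z) x -> G a x.
  move=> x; elim: {IH dg} k => [|k IH]; first by have -> : a + 0%N = a by lia.
  have -> : a + k.+1%:Z = a + k%:Z + 1 by lia.
  by move=> /Gd.
rewrite big_ord_recr /= addnC.
have akE : a + k.+1%:Z = a + k%:Z + 1 by lia.
rewrite akE; apply: (rdim_trans (Gd _) GG).
  by apply: dg; lia.
by apply: IH => j jk; apply: dg; lia.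
Qed.

End RelativeDimension.

Section SubquotientDimension.
Context {K : fieldType} {V : lmodType K} (Z B : subspace V).
Local Notation cls := (sq_class Z B).

Lemma sq_class_sum (I : eqType) (s : seq I) (c : I -> K) (e : I -> V) :
  (forall i, i \in s -> Z (e i)) ->
  cls (\sum_(i <- s) c i *: e i) = \sum_(i <- s) c i *: cls (e i).
Proof.
elim: s => [|i s IH] Ze; rewrite ?big_nil // !big_cons sq_classP; first last.
- apply: sub_lin_seq => j js; apply/subZ/Ze; by rewrite inE js orbT.
- by apply: Ze; rewrite mem_head.
by rewrite IH // => j js; apply: Ze; rewrite inE js orbT.
Qed.

(** This pulls a filtration induced on a subquotient back to V; all dimensions of subquotients are
    then counted in V. *)
Lemma sq_induced_class (W : subspace V) x : Z x ->
  sq_induced Z B W (cls x) <-> sub_add (sub_cap W Z) B x.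
Proof.
move=> Zx; split=> [[y [Wy Zy /(sq_class_eq _ Zx Zy) Bxy]]|[y [b [[Wy Zy] Bb xE]]]].
  by exists y, (x - y); split=> //; rewrite addrC subrK.
by exists y; split=> //; apply/sq_class_eq => //; rewrite xE addrC addKr.
Qed.

Lemma sq_basis (W' W : subspace V) (I : eqType) (P : I -> Prop) (e : I -> V) :
  (forall i, P i -> sub_cap W Z (e i)) ->
  rel_basis (sub_add (sub_cap W' Z) B) (sub_cap W Z) P e <->
  rel_basis (sq_induced Z B W') (sq_induced Z B W) P (fun i => cls (e i)).
Proof.
move=> We; have Ze i : P i -> Z (e i) by move=> /We[].
have Zs (s : seq I) c : (forall i, i \in s -> P i) -> Z (\sum_(i <- s) c i *: e i).
  by move=> Ps; apply: sub_lin_seq => i /Ps/Ze; apply: subZ.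
split=> -[_ fr sp]; split=> //.
- by move=> i /We[Wei Zei]; exists (e i).
- move=> s c us Ps; rewrite -sq_class_sum => [|i /Ps/Ze //].
  by move=> /(sq_induced_class _ (Zs s c Ps)); apply: fr.
- move=> _ [x [Wx Zx ->]]; have [//|u [v [Uu [s [c [us Ps vE]]] xE]]] := sp x _.
  have Zv : Z v by rewrite vE; apply: Zs.
  have Zu : Z u by apply: (sub_subE (y := - v)); rewrite ?opprK -?xE //; apply: subN.
  exists (cls u), (cls v); split; first exact/sq_induced_class.
    exists s, c; split=> //; rewrite vE sq_class_sum // => i /Ps; exact: Ze.
  by rewrite xE -[u]scale1r sq_classP // !scale1r.
- move=> s c us Ps /(sq_induced_class _ (Zs s c Ps)).
  by rewrite sq_class_sum => [|i /Ps/Ze //]; apply: fr.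
move=> x [Wx Zx]; have [|u [v [Uu [s [c [us Ps vE]]] xE]]] := sp (cls x).
  by exists x.
exists (x - \sum_(i <- s) c i *: e i), (\sum_(i <- s) c i *: e i).
split; [|by exists s, c|by rewrite subrK].
apply/sq_induced_class; first by apply: subB => //; apply: Zs.
have -> : cls (x - \sum_(i <- s) c i *: e i) = u; last by [].
rewrite addrC -scaleN1r sq_classP ?sq_class_sum //; last 2 first.
- by move=> i /Ps/Ze.
- exact: Zs.
by rewrite xE vE scaleN1r addrC addrK.
Qed.

Lemma sq_rdim_induced (W' W : subspace V) n :
  rdim (sub_add (sub_cap W' Z) B) (sub_cap W Z) n ->
  rdim (sq_induced Z B W') (sq_induced Z B W) n.
Proof.
case=> I [e [In Be]]; exists I, (fun i => cls (e i)); split=> //.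
by apply/sq_basis => //; case: Be.
Qed.

Lemma sq_rdim_full n : rdim (sub_null _) (sub_full (subquot Z B)) n <-> rdim B Z n.
Proof.
have fullE : sub_full (subquot Z B) = sq_induced Z B (sub_full V).
  apply: subspace_ext => c; split=> // _; exists (sq_repr c).
  by rewrite sq_reprK; split=> //; apply: sq_reprP.
have nullE : sub_null (subquot Z B) = sq_induced Z B (sub_null V).
  apply: subspace_ext => c; split=> [->|[x [-> _ ->]]] //; exact: sub0.
have ZE : Z = sub_cap (sub_full V) Z by apply: subspace_ext => x; split=> // -[].
have BE : B = sub_add (sub_cap (sub_null V) Z) B.
  apply: subspace_ext => x; split=> [|[_ [y [[-> _] By ->]]]]; first exact: sub_addr.
  by rewrite add0r.
rewrite fullE nullE; split=> [[I [e [In Be]]]|].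
  exists I, (fun i => sq_repr (e i)); split=> //.
  suff : rel_basis (sub_add (sub_cap (sub_null V) Z) B) (sub_cap (sub_full V) Z)
      (fun=> True) (fun i => sq_repr (e i)) by rewrite -ZE -BE.
  apply/sq_basis => [i _|]; first by split=> //; apply: sq_reprP.
  have -> : (fun i => sq_class Z B (sq_repr (e i))) = e.
    by apply/funext => i; apply: sq_reprK.
  by [].
move=> dn; apply: sq_rdim_induced.
by rewrite -ZE -BE.
Qed.

End SubquotientDimension.

Lemma fsbig_zrange (f : int -> nat) (L : int) :
  (forall m : int, L < `|m| -> f m = 0%N) ->
  \sum_(m \in [set: int]) f m = \sum_(m <- zrange (- L) L) f m.
Proof.
move=> f0; rewrite [RHS]fsbig_seq ?zrange_uniq //; apply/esym/fsbig_widen => //.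
move=> m /= [_ mL]; apply: f0; rewrite ltNge; apply/negP => Lm; apply: mL.
by rewrite mem_zrange; lia.
Qed.

Lemma big_ord_zrange (f : int -> nat) (a : int) (k : nat) :
  (\sum_(i < k) f (a + i%:Z)%R)%N = \sum_(m <- zrange a (a + k%:Z - 1)) f m.
Proof.
rewrite /zrange big_map (_ : absz _ = k); last by lia.
rewrite -(big_mkord xpredT (fun i : nat => f (a + i%:Z))) /index_iota subn0.
by [].
Qed.

Lemma fsbig_zrange2 (f : int * int -> nat) (s : int * int -> int * int) (L : int) :
  injective s ->
  (forall x : int * int, (forall a n : int, `|a| <= L -> `|n| <= L -> x != s (a, n)) ->
     f x = 0%N) ->
  \sum_(x \in [set: int * int]) f x =
  \sum_(n <- zrange (- L) L) \sum_(a <- zrange (- L) L) f (s (a, n)).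
Proof.
move=> s_inj f0.
pose r := [seq s (a, n) | n <- zrange (- L) L, a <- zrange (- L) L].
have -> : \sum_(n <- zrange (- L) L) \sum_(a <- zrange (- L) L) f (s (a, n)) =
    \sum_(x <- r) f x by rewrite big_allpairs_dep.
have ur : uniq r.
  apply: allpairs_uniq; rewrite ?zrange_uniq //.
  by move=> [n a] [n' a'] _ _ /= /s_inj[-> ->].
rewrite [RHS]fsbig_seq //; apply/esym/fsbig_widen => //.
move=> x /= [_ xr]; apply: f0 => a n aL nL; apply/eqP => xs; apply: xr.
rewrite xs; apply/allpairsP; exists (n, a); rewrite !mem_zrange /=.
by split=> //; lia.
Qed.

(** * Counting dimensions of a filtered complex *)

Section FilteredComplex.
Context {K : fieldType} (A : dcomplex K) (F : int -> subspace A).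
Variables (M : int) (r : nat).
Hypotheses (F_decr : forall a x, F (a + 1) x -> F a x)
  (F_full : forall a x, a <= - M -> F a x)
  (F_null : forall a x, M <= a -> F a x -> x = 0)
  (tot0 : forall n x, M <= `|n| -> tot A n x -> x = 0)
  (M_ge0 : 0 <= M) (r_gt0 : (0 < r)%N).
Implicit Types (a n : int).

Let Zr a n := ss_cycle F r a n.
Let Br a n := ss_bound F r a n.
Let Zinf a n := sub_cap (F a) (dR_cocycle A n).
Let Binf a n := sub_cap (F a) (dR_cobound A n).

Let Fle a b x : b <= a -> F a x -> F b x.
Proof. exact: F_le. Qed.

Let Zinf_Zr a n x : Zinf a n x -> Zr a n x.
Proof.
case=> Fx [Tx dx]; split=> //; rewrite sub_preimE [dtot A x]dx; exact: sub0.
Qed.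

Let Binf_Zinf a n x : Binf a n x -> Zinf a n x.
Proof. by case=> Fx Bx; split=> //; apply: dR_cocycle_cobound. Qed.

(* The only part of [Br] that is not made of cocycles lies in F (a + 1). *)
Let Br_dec a n x : Br a n x -> exists u v, [/\ F (a + 1) u, tot A n u,
  F (a + r%:Z) (dtot A u), Binf a n v & x = u + v].
Proof.
case=> u [_ [[[Fu Tu] Fdu] [v [[[Fv Tv] Fdv] ->]] ->]]; exists u, (dtot A v).
split=> //.
  by rewrite sub_preimE in Fdu; apply: Fle Fdu; lia.
split; last by exists v.
by rewrite sub_preimE in Fdv; apply: Fle Fdv; lia.
Qed.

Let Br_in a n x : F (a + 1) x -> tot A n x -> F (a + r%:Z) (dtot A x) -> Br a n x.
Proof.
move=> Fx Tx Fdx; apply: sub_addl; split=> //; rewrite sub_preimE.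
by apply: Fle Fdx; lia.
Qed.

Let Br_Zr a n x : Br a n x -> Zr a n x.
Proof.
case/Br_dec => u [v [Fu Tu Fdu Bv ->]]; apply: subD; last exact/Zinf_Zr/Binf_Zinf.
by split=> //; split=> //; apply: F_decr.
Qed.

Lemma lifts_Zr a n : lifts F r a n <->
  (forall x, Zr a n x -> sub_add (Br a n) (Zinf a n) x).
Proof.
split=> [h x [[Fx Tx] Fdx]|h x Fx Tx Fdx].
  have [z [Fz [Tz dz] Fxz]] := h x Fx Tx Fdx.
  exists (x - z), z; split=> //; last by rewrite subrK.
  apply: Br_in => //; first exact: subB.
  rewrite linearB [X in _ - X]dz subr0; exact: Fdx.
have [|_ [z [/Br_dec[u [v [Fu Tu Fdu /Binf_Zinf Zv ->]]] Zz ->]]] := h x; first by [].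
have [Fvz Zvz] : Zinf a n (v + z) by apply: subD.
exists (v + z); split=> //.
by rewrite -(addrA u) addrK.
Qed.

(** A primitive y of x in F^b with b <= a - r satisfies dy in F^(b+r). Subtracting its lift, a
    cocycle, gives a primitive in F^(b+1); once b reaches a - r + 1, x is a boundary on page r. *)
Lemma lifts_Binf a n : (forall b n', lifts F r b n') ->
  forall x, Binf a n x -> Br a n x.
Proof.
move=> h x [Fx [y [Ty xE]]].
suff step k b : a - r%:Z + 1 <= b + k%:Z -> forall y, F b y -> tot A (n - 1) y ->
    dtot A y = x -> Br a n x.
  apply: (step (absz (a - r%:Z + 1 + M)%R) (- M) _ y) => //; last exact: F_full.
  by lia.
elim: k b => [|k IH] b bk {}y Fy {}Ty {}xE.
  apply: sub_addr; exists y; split=> //; split.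
    by split=> //; apply: Fle Fy; lia.
  by rewrite sub_preimE xE; apply: Fle Fx; lia.
have [ab|ba] := leP (a - r%:Z + 1) b; first by apply: (IH b _ y) => //; lia.
have [||| z [Fz [Tz dz] Fyz]] := h b (n - 1) y => //.
  by rewrite xE; apply: Fle Fx; lia.
apply: (IH (b + 1) _ (y - z)) => //; first by lia.
  exact: subB.
by rewrite linearB xE [X in _ - X]dz subr0.
Qed.

(** The preimage in the cocycles of the filtration induced on cohomology; its successive quotients
    are the graded pieces of H^n. *)
Let G n a := sub_add (dR_cobound A n) (Zinf a n).

Let G_decr n a x : G n (a + 1) x -> G n a x.
Proof.
case=> b [z [Bb [Fz Zz] ->]]; exists b, z; split=> //; split=> //.
exact: F_decr.
Qed.

Let G_bot n x : G n (- M) x <-> dR_cocycle A n x.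
Proof.
split=> [[b [z [/dR_cocycle_cobound Zb [_ Zz] ->]]]|Zx]; first exact: subD.
by apply: sub_addr; split=> //; apply: F_full.
Qed.

Let G_top n x : G n M x <-> dR_cobound A n x.
Proof.
split=> [[b [z [Bb [Fz _] ->]]]|Bx]; last exact: sub_addl.
by rewrite (F_null (lexx M) Fz) addr0.
Qed.

Variables (e : int -> int -> nat) (b : int -> nat).
Hypotheses (e_dim : forall a n, rdim (Br a n) (Zr a n) (e a n))
  (b_dim : forall n, rdim (dR_cobound A n) (dR_cocycle A n) (b n)).

Let g_ex n a : exists g, rdim (G n (a + 1)) (G n a) g.
Proof.
apply: rdim_sub (b_dim n) => x; first exact: sub_addl.
by case=> y [z [/dR_cocycle_cobound Zy [_ Zz] ->]]; apply: subD.
Qed.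

Let g n a := sval (cid (g_ex n a)).

Let gP n a : rdim (G n (a + 1)) (G n a) (g n a).
Proof. exact: svalP (cid (g_ex n a)). Qed.

Let sum_g n : b n = \sum_(a <- zrange (- M) M) g n a.
Proof.
have gM : g n M = 0%N.
  apply: rdim_uniq (gP n M) _; apply/rdim0 => x /G_top.
  exact: sub_addl.
have h := rdim_chain (k := absz (2 * M)%R) (@G_decr n) (fun a _ => gP n a) (a := - M).
rewrite (_ : - M + _ = M) in h; last by lia.
rewrite (rdim_uniq (b_dim n) (m := (\sum_(i < absz (2 * M)%R) g n (- M + i%:Z)%R)%N)).
  have := big_ord_zrange (g n) (- M) (absz (2 * M)%R).+1.
  rewrite big_ord_recr /= (_ : - M + _ = M) ?gM ?addn0; last by lia.
  by move=> ->; congr (\sum_(i <- zrange _ _) _); lia.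
have <- : G n M = dR_cobound A n by apply: subspace_ext; apply: G_top.
by have <- : G n (- M) = dR_cocycle A n by apply: subspace_ext; apply: G_bot.
Qed.

Let excess a n : exists c, e a n = (g n a + c)%N /\
  (c = 0%N <-> (forall x, Zr a n x -> sub_add (Br a n) (Zinf a n) x) /\
               (forall x, Binf a n x -> Br a n x)).
Proof.
pose BB := sub_add (Br a n) (Binf a n); pose BZ := sub_add (Br a n) (Zinf a n).
have BB_BZ x : BB x -> BZ x.
  by case=> y [z [By /Binf_Zinf Zz ->]]; exists y, z.
have BZ_Zr x : BZ x -> Zr a n x.
  by case=> y [z [/Br_Zr Zy /Zinf_Zr Zz ->]]; apply: subD.
have [c1 h1] : exists m, rdim (Br a n) BB m.
  by apply: rdim_sub (e_dim a n) => // x /BB_BZ/BZ_Zr.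
have [c2 h2] : exists m, rdim BB BZ m.
  by apply: rdim_sub (e_dim a n) => // x; apply: sub_addl.
have [c3 h3] : exists m, rdim BZ (Zr a n) m.
  by apply: rdim_sub (e_dim a n) => // x; apply: sub_addl.
have eE : e a n = (c1 + (c2 + c3))%N.
  apply: rdim_uniq (e_dim a n) (rdim_trans _ _ h1 (rdim_trans BB_BZ BZ_Zr h2 h3)).
    by move=> x; apply: sub_addl.
  by move=> x /BB_BZ/BZ_Zr.
have c2E : c2 = g n a.
  (* The middle quotient BZ/BB and the graded piece of [G] are both identified with Zinf modulo U.
     The latter holds because only the part of [Br] in F^(a+1) fails to consist of boundaries. *)
  pose U := sub_cap (Zinf a n) BB.
  have [m hm] : exists m, rdim U (Zinf a n) m.
    apply: (@rdim_bounded _ _ _ _ c2) => s us Zs fr.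
    rewrite -(card_seq_sub us); apply: (rdim_exchange (f := val) h2).
      by move=> u; apply: sub_addr; apply/Zs/valP.
    apply: rel_free_seq_sub => t c ut ts BBt; apply: fr => //; split=> //.
    by apply: sub_lin_seq => v /ts/Zs; apply: subZ.
  rewrite -(rdim_uniq _ h2 (n := m)); last first.
    apply: rdim_iso hm.
    - by move=> x [].
    - by move=> x; apply: sub_addr.
    - by move=> x Zx Bx.
    move=> _ [y [z [By Zz ->]]]; exists z => //.
    by rewrite addrK; apply: sub_addl.
  apply: rdim_uniq (gP n a); apply: rdim_iso hm.
  - move=> x [[Fx Zx] [_ [w [/Br_dec[u [v [Fu Tu Fdu Bv ->]]] Bw xE]]]].
    exists (v + w), u; split; last by rewrite xE -(addrA u) addrC.
      by apply: subD; [case: Bv|case: Bw].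
    split=> //; have -> : u = x - (v + w) by rewrite xE -(addrA u) addrK.
    by apply: subB => //; apply: subD; [case: (Binf_Zinf Bv)|case: (Binf_Zinf Bw)].
  - by move=> x; apply: sub_addr.
  - move=> x [Fx Zx] [v [z [Bv [Fz [Tz dz]] xE]]]; split=> //.
    exists z, v; split; last by rewrite xE addrC.
      by apply: Br_in => //; rewrite [dtot A z]dz; apply: sub0.
    split=> //; have -> : v = x - z by rewrite xE addrK.
    by apply: subB => //; apply: F_decr.
  move=> _ [v [z [Bv Zz ->]]]; exists z => //.
  by rewrite addrK; apply: sub_addl.
exists (c1 + c3)%N; split; first by rewrite eE c2E; lia.
split=> [c0|[h3' h1']].
  have c30 : c3 = 0%N by lia.
  have c10 : c1 = 0%N by lia.
  rewrite c30 in h3; rewrite c10 in h1; split; first exact/rdim0.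
  by move=> x Bx; apply: (rdim0 _ _).1 h1 _ _; apply: sub_addr.
have -> : c1 = 0%N.
  apply: rdim_uniq h1 _; apply/rdim0 => x [y [z [By Bz ->]]].
  by apply: subD => //; apply: h1'.
by rewrite (rdim_uniq h3 (m := 0)) //; apply/rdim0.
Qed.

Let c a n := sval (cid (excess a n)).
Let eE a n : e a n = (g n a + c a n)%N.
Proof. by have [] := svalP (cid (excess a n)). Qed.

Let cP a n : c a n = 0%N <->
  (forall x, Zr a n x -> sub_add (Br a n) (Zinf a n) x) /\
  (forall x, Binf a n x -> Br a n x).
Proof. by have [] := svalP (cid (excess a n)). Qed.

Lemma e_out a n : (M < `|a|) || (M < `|n|) -> e a n = 0%N.
Proof.
move=> an; apply: rdim_uniq (e_dim a n) _; apply/rdim0 => x [[Fx Tx] Fdx].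
have [nM|nM] := ltP M `|n|; first by rewrite (tot0 _ Tx) ?ltW //; apply: sub0.
have [aM|aM] := leP M a; first by rewrite (F_null aM Fx); apply: sub0.
by apply: Br_in => //; apply: F_full; lia.
Qed.

Lemma b_out n : M < `|n| -> b n = 0%N.
Proof.
move=> nM; apply: rdim_uniq (b_dim n) _; apply/rdim0 => x [Tx _].
by rewrite (tot0 _ Tx) ?ltW //; apply: sub0.
Qed.

(** The two sums differ by the sum of the nonnegative excesses c, so equality forces each excess to
    vanish, which is [lifts] in every degree. *)
Lemma lifts_sumP : (forall a n, lifts F r a n) <->
  \sum_(n <- zrange (- M) M) \sum_(a <- zrange (- M) M) e a n =
  \sum_(n <- zrange (- M) M) b n.
Proof.
have sumE : \sum_(n <- zrange (- M) M) \sum_(a <- zrange (- M) M) e a n =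
    (\sum_(n <- zrange (- M) M) b n +
     \sum_(n <- zrange (- M) M) \sum_(a <- zrange (- M) M) c a n)%N.
  rewrite -big_split; apply: eq_bigr => n _; rewrite sum_g -big_split.
  by apply: eq_bigr => a _; apply: eE.
have cE : (forall a n, lifts F r a n) <-> forall a n, c a n = 0%N.
  split=> [h a n|h a n].
    by apply/cP; split; [apply/lifts_Zr|apply: lifts_Binf].
  by apply/lifts_Zr; have /cP[] := h a n.
rewrite sumE; split=> [/cE c0|/eqP h]; last apply/cE; last move: h.
  by rewrite [X in (_ + X)%N]big1 ?addn0 // => n _; rewrite big1.
rewrite -[X in _ == X]addn0 eqn_add2l sum_nat_seq_eq0 => /allP c0 a n.
have [out|inb] := boolP ((M < `|a|) || (M < `|n|)).
  by have := e_out out; rewrite eE; lia.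
have /c0 /= : n \in zrange (- M) M by rewrite mem_zrange; lia.
rewrite sum_nat_seq_eq0 => /allP/(_ a) /=; rewrite mem_zrange => h.
by apply/eqP/h; lia.
Qed.

End FilteredComplex.

(** * The criteria *)

Section DegenerationCriteria.
Context {K : fieldType} (A : dcomplex K).
Hypothesis A_bounded : bounded A.

Lemma degenerates1P r : ss_degenerates (filt1 A) r <->
  forall a n, lifts (filt1 A) r a n.
Proof.
apply: ss_degeneratesP => [a x|]; first by apply: filt1_le; lia.
have [M [_ [_ hM]]] := filt1_bounded A_bounded.
by exists M => x; apply: hM.
Qed.

Lemma degenerates2P r : ss_degenerates (filt2 A) r <->
  forall a n, lifts (filt2 A) r a n.
Proof.
apply: ss_degeneratesP => [a x|]; first by apply: filt2_le; lia.
have [M [_ [_ hM]]] := filt2_bounded A_bounded.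
by exists M => x; apply: hM.
Qed.

Lemma common_bound : exists M : int, [/\ 0 <= M,
  forall n (x : A), M <= `|n| -> tot A n x -> x = 0,
  (forall m x, m <= - M -> filt1 A m x) /\
  (forall m x, M <= m -> filt1 A m x -> x = 0)
  & (forall m x, m <= - M -> filt2 A m x) /\
  (forall m x, M <= m -> filt2 A m x -> x = 0)].
Proof.
have [M1 [M10 [h1 h1']]] := filt1_bounded A_bounded.
have [M2 [M20 [h2 h2']]] := filt2_bounded A_bounded.
have [M3 [M30 h3]] := tot_bounded A_bounded.
exists (M1 + M2 + M3); split; first by lia.
- by move=> n x nM; apply: h3; lia.
- by split=> m x mM; [apply: h1|apply: h1']; lia.
by split=> m x mM; [apply: h2|apply: h2']; lia.
Qed.

Lemma fin_dim_rdim (V : lmodType K) (Z B : subspace V) :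
  fin_dim (sub_full (subquot Z B)) -> rdim B Z (sdim (sub_full (subquot Z B))).
Proof. by case=> n /has_dimP dn; rewrite (sdimE dn); apply/sq_rdim_full. Qed.

(** [s] converts filtration degree and total degree into the bidegree that indexes the pages, which
    differs for the two filtrations. *)
Lemma degenerates_fsum (F : int -> subspace A) (r : nat) (M : int)
    (f : int * int -> nat) (s : int * int -> int * int) :
  (forall a x, F (a + 1) x -> F a x) ->
  (forall a x, a <= - M -> F a x) -> (forall a x, M <= a -> F a x -> x = 0) ->
  (forall n (x : A), M <= `|n| -> tot A n x -> x = 0) -> 0 <= M -> (0 < r)%N ->
  injective s -> (forall x, exists a n, x = s (a, n)) ->
  (forall a n, rdim (ss_bound F r a n) (ss_cycle F r a n) (f (s (a, n)))) ->
  (forall m, fin_dim (sub_full (HdR A m))) ->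
  (forall a n, lifts F r a n) <->
  \sum_(x \in [set: int * int]) f x = \sum_(m \in [set: int]) betti A m.
Proof.
move=> Fd Ff Fn t0 M0 r0 s_inj s_surj e_dim finH.
have b_dim n : rdim (dR_cobound A n) (dR_cocycle A n) (betti A n).
  exact: (fin_dim_rdim (finH n)).
rewrite (fsbig_zrange2 (s := s) (L := M)) //; last first.
  move=> x xs; have [a [n xE]] := s_surj x; rewrite xE.
  apply: (e_out (e := fun a n => f (s (a, n))) Fd Ff Fn t0 M0 r0 e_dim).
  apply: contraT => an; have aM : `|a| <= M by lia.
  have nM : `|n| <= M by lia.
  by have := xs a n aM nM; rewrite xE eqxx.
rewrite (fsbig_zrange (L := M)); last first.
  by move=> m mM; apply: (b_out t0 b_dim).
exact: (lifts_sumP Fd Ff Fn t0 M0 r0 (e := fun a n => f (s (a, n))) e_dim b_dim).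
Qed.

Lemma degenerates1_dim (r : nat) : (1 <= r)%N ->
  (forall p q : int, fin_dim (sub_full (froelicher1 A r p q))) ->
  (forall m : int, fin_dim (sub_full (HdR A m))) ->
  ss_degenerates (filt1 A) r <->
  \sum_(x \in [set: int * int]) sdim (sub_full (froelicher1 A r x.1 x.2)) =
    \sum_(m \in [set: int]) betti A m.
Proof.
move=> r1 finE finH; rewrite degenerates1P.
have [M [M0 t0 [hf hn] _]] := common_bound.
apply: (degenerates_fsum (M := M) (s := fun x => (x.1, x.2 - x.1))) => //.
- by move=> a x; apply: filt1_le; lia.
- by move=> [a n] [a' n'] /= [->]; move/addIr => ->.
- by move=> [p q]; exists p, (p + q); rewrite /= addrC addKr.
move=> a n /=; have := fin_dim_rdim (finE a (n - a)).
by rewrite /froelicher1 [a + (n - a)]addrC subrK.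
Qed.

Lemma degenerates2_dim (r : nat) : (1 <= r)%N ->
  (forall p q : int, fin_dim (sub_full (froelicher2 A r p q))) ->
  (forall m : int, fin_dim (sub_full (HdR A m))) ->
  ss_degenerates (filt2 A) r <->
  \sum_(x \in [set: int * int]) sdim (sub_full (froelicher2 A r x.1 x.2)) =
    \sum_(m \in [set: int]) betti A m.
Proof.
move=> r1 finE finH; rewrite degenerates2P.
have [M [M0 t0 _ [hf hn]]] := common_bound.
apply: (degenerates_fsum (M := M) (s := fun x => (x.2 - x.1, x.1))) => //.
- by move=> a x; apply: filt2_le; lia.
- by move=> [a n] [a' n'] /= [+ aa]; rewrite aa => /addIr ->.
- by move=> [p q]; exists q, (p + q); rewrite /= addrK.
move=> a n /=; have := fin_dim_rdim (finE (n - a) a).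
by rewrite /froelicher2 subrK.
Qed.

Lemma pure_hodge_dim (d k : int) : fin_dim (sub_full (HdR A d)) ->
  pure_hodge A d k <->
  betti A d = \sum_(p \in [set: int]) hodge_number A d p (k - p).
Proof.
case=> b /has_dimP bH; have bE : betti A d = b by apply: sdimE.
have [M0 [M00 [h1f h2f h1n h2n]]] := hodge_bounded A_bounded d.
have d1 := @hodge1_decr _ A d; have d2 := @hodge2_decr _ A d.
pose F1 := hodge1 A d; pose F2 := hodge2 A d.
(* This is the preimage in F2 q of the filtration induced by F1 on the graded piece of F2; its
   successive quotients are the spaces gr gr. *)
pose X q p := sub_add (sub_cap (F1 p) (F2 q)) (F2 (q + 1)).
have X_decr q p x : X q (p + 1) x -> X q p x.
  case=> y [z [[F1y F2y] Fz ->]]; exists y, z; split=> //; split=> //.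
  exact: d1.
have XF2 q p x : X q p x -> F2 q x.
  by case=> y [z [[F1y F2y] Fz ->]]; apply: subD => //; apply: d2.
have h_ex q p : exists n, rdim (X q (p + 1)) (X q p) n.
  by apply: rdim_sub bH => // x ->; apply: sub0.
pose h q p := sval (cid (h_ex q p)).
have hP q p : rdim (X q (p + 1)) (X q p) (h q p) := svalP (cid (h_ex q p)).
have hN q p : hodge_number A d p q = h q p.
  apply: sdimE; apply/sq_rdim_full; apply: sq_rdim_induced.
  have [n hn] : exists n, rdim (X q (p + 1)) (sub_cap (F1 p) (F2 q)) n.
    by apply: rdim_sub bH => // x ->; apply: sub0.
  suff -> : h q p = n by [].
  apply: rdim_uniq (hP q p) _; apply: rdim_iso hn => //.
    by move=> x; apply: sub_addl.
  move=> _ [y [z [Fy Fz ->]]]; exists y => //.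
  have -> : y + z - y = z by rewrite addrC addKr.
  exact: sub_addr.
have h0P q p : h q p = 0%N <-> jumpfree F1 F2 p q.
  split=> [h0 x [F1x F2x]|jf].
    have := hP q p; rewrite h0 => /rdim0/(_ x)[|y [z [[F1y F2y] Fz xE]]].
      by apply: sub_addl.
    exists y, z; split=> //; split=> //; have -> : z = x - y by rewrite xE addrC addKr.
    by apply: subB => //; apply: d1.
  apply: rdim_uniq (hP q p) _; apply/rdim0 => x [y [z [Fy Fz ->]]].
  have [u [v [Fu [_ F2v] ->]]] := jf y Fy.
  by exists u, (v + z); split; [|apply: subD|rewrite addrA].
have out q p : (M0 < `|p|) || (M0 < `|q|) -> h q p = 0%N.
  move=> pq; apply/h0P => x [F1x F2x].
  have [pM|pM] := leP M0 p; first by rewrite (h1n _ _ pM F1x); apply: sub0.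
  have [qM|qM] := leP M0 q; first by rewrite (h2n _ _ qM F2x); apply: sub0.
  have [pM'|pM'] := ltP M0 `|p|.
    by apply: sub_addl; split=> //; apply: h1f; lia.
  by apply: sub_addr; split=> //; apply: h2f; lia.
pose R := zrange (- M0) M0.
have chain (g : int -> nat) (G : int -> subspace (HdR A d)) :
    (forall j x, G (j + 1) x -> G j x) -> (forall j, rdim (G (j + 1)) (G j) (g j)) ->
    rdim (G (M0 + 1)) (G (- M0)) (\sum_(j <- R) g j).
  move=> Gd gd.
  have := rdim_chain (k := (absz (2 * M0)%R).+1) Gd (fun j _ => gd j) (a := - M0).
  rewrite (_ : - M0 + _ = M0 + 1); last by lia.
  rewrite big_ord_zrange; congr rdim; rewrite /R.
  by congr (\sum_(i <- zrange _ _) _); lia.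
have rowP q : rdim (F2 (q + 1)) (F2 q) (\sum_(p <- R) h q p).
  have := chain (h q) (X q) (X_decr q) (hP q).
  have -> : X q (M0 + 1) = F2 (q + 1).
    apply: subspace_ext => x; split=> [[y [z [[F1y _] Fz ->]]]|Fx]; last exact: sub_addr.
    by rewrite (h1n _ _ _ F1y) ?add0r //; lia.
  have -> // : X q (- M0) = F2 q.
  apply: subspace_ext => x; split=> [/XF2//|Fx].
  by apply: sub_addl; split=> //; apply: h1f.
have sumE : b = \sum_(q <- R) \sum_(p <- R) h q p.
  apply: rdim_uniq bH _; have := chain _ F2 d2 rowP.
  have -> : F2 (M0 + 1) = sub_null (HdR A d).
    apply: subspace_ext => x; split=> [Fx|->]; last exact: sub0.
    by apply: (h2n _ _ _ Fx); lia.
  have -> // : F2 (- M0) = sub_full (HdR A d).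
  by apply: subspace_ext => x; split=> // _; apply: h2f.
have rhsE : \sum_(p \in [set: int]) hodge_number A d p (k - p) =
    \sum_(p <- R) h (k - p) p.
  rewrite (fsbig_zrange (L := M0)) => [|p pM]; first by apply: eq_bigr => p _; apply: hN.
  by rewrite hN out // pM.
(* The total of all h is b; splitting off the diagonal p + q = k leaves nonnegative terms that must
   vanish. If k - p is outside the range R, the diagonal entry is zero anyway. *)
have sumE' : b = (\sum_(p <- R) h (k - p)%R p +
    \sum_(p <- R) \sum_(q <- R | q != (k - p)%R) h q p)%N.
  rewrite sumE exchange_big -big_split; apply: eq_bigr => p _ /=.
  have [kR|kR] := boolP (k - p \in R); first by rewrite (bigD1_seq (k - p)) ?zrange_uniq.
  have -> : h (k - p) p = 0%N.
    by apply: out; move: kR; rewrite /R mem_zrange; lia.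
  rewrite add0n big_seq_cond [RHS]big_seq_cond; apply: eq_bigl => q.
  by case: (boolP (q \in R)) => //= qR; apply/esym; apply: contraNneq kR => <-.
rewrite bE rhsE; have pureP := pure_jumpfree d1 d2 h1f h2f h1n h2n k.
split=> [/pureP jf|/eqP].
  rewrite sumE' [X in (_ + X)%N]big1 ?addn0 // => p _.
  by rewrite big1 // => q qk; apply/h0P/jf; lia.
rewrite sumE' -[X in _ == X]addn0 eqn_add2l sum_nat_seq_eq0 => /allP c0.
apply/pureP => p q pqk; apply/h0P.
have [o|inb] := boolP ((M0 < `|p|) || (M0 < `|q|)); first exact: out.
have /c0 /= : p \in R by rewrite mem_zrange; lia.
rewrite sum_nat_seq_eq0 => /allP/(_ q) /=; rewrite mem_zrange => hq.
by apply/eqP/(implyP (hq _)); lia.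
Qed.

End DegenerationCriteria.

Section Multiplicities.
Context {K : fieldType} (A : dcomplex K).
Hypothesis A_bounded : bounded A.
Implicit Types (S : {fset int * int}) (d p q k : int).

Lemma multiplicities_shape m S : multiplicities A m -> m S -> is_shape S.
Proof. by case=> mS _ z; apply: contrapT => nS; apply: mS nS z. Qed.

(** A decomposition in which S occurs makes C(S) a retract of [A], and C(S) detects its own length.
    Conversely, the lifts on the summands of the constructed decomposition add up to lifts on
    [A]. *)
Lemma degenerates_even (r : nat) : (1 <= r)%N ->
  (ss_degenerates (filt1 A) r /\ ss_degenerates (filt2 A) r) <->
  (forall S, is_even_zigzag S -> mult_neq0 A S -> (#|` S| < 2 * r)%N).
Proof.
move=> r1; rewrite (degenerates1P A_bounded) (degenerates2P A_bounded).
split=> [[h1 h2] S evS [m [mA [z]]]|h].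
  have Ssh := multiplicities_shape mA z; case: mA => _ [C [CC /iso_direct_sum_retracts]].
  move=> [f [g [fM gM gf _]]]; pose i : {S : {fset int * int} & m S} := Tagged m z.
  have SC : is_C S (C (tag i)) by apply: CC.
  apply: (even_lifts_card SC evS) => a n.
    apply: (lifts_retract (fM i) (gM i) (gf i) (F := fun Y => filt1 Y)) (h1 a n) => t x;
      exact: morph_part.
  apply: (lifts_retract (fM i) (gM i) (gf i) (F := fun Y => filt2 Y)) (h2 a n) => t x;
    exact: morph_part.
have [m mA] := multiplicities_exist A_bounded.
have [_ [C [CC /iso_direct_sum_retracts[f [g [fM gM gf dec]]]]]] := mA.
have lft (i : {S : {fset int * int} & m S}) a n :
    lifts (filt1 (C (tag i))) r a n /\ lifts (filt2 (C (tag i))) r a n.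
  case: i => S z /=; have Ssh := multiplicities_shape mA z.
  apply: (shape_lifts a n (CC S Ssh) Ssh r1) => evS.
  by apply: h => //; exists m.
split=> a n.
  apply: (lifts_sum fM gM dec (F := fun Y => filt1 Y)) => [i t x|i t x|i].
  - exact: morph_part.
  - exact: morph_part.
  by have [] := lft i a n.
apply: (lifts_sum fM gM dec (F := fun Y => filt2 Y)) => [i t x|i t x|i].
- exact: morph_part.
- exact: morph_part.
by have [] := lft i a n.
Qed.

Lemma pure_hodge_odd d k : pure_hodge A d k <->
  (forall p q, mult_neq0 A (odd_shape d p q) -> p + q = k).
Proof.
rewrite (pure_hodgeP A_bounded); split=> [jf p q [m [mA [z]]]|h p q pqk].
  apply/eqP; apply: contraT => pqk.
  have Ssh := multiplicities_shape mA z; case: mA => _ [C [CC /iso_direct_sum_retracts]].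
  move=> [f [g [fM gM gf _]]]; pose i : {S : {fset int * int} & m S} := Tagged m z.
  have SC : is_C (odd_shape d p q) (C (tag i)) by apply: CC.
  have := hodge_jumpfree_retract (fM i) (gM i) (gf i) (jf p q pqk).
  by move/(odd_jumpfree p q SC); rewrite eqxx.
have [m mA] := multiplicities_exist A_bounded.
have [_ [C [CC /iso_direct_sum_retracts[f [g [fM gM gf dec]]]]]] := mA.
apply: (hodge_jumpfree_sum fM gM dec) => -[S z] /=.
have Ssh := multiplicities_shape mA z; have SC := CC S Ssh.
case: Ssh => [sqS|[evS|[d' [p' [q' SE]]]]].
- by apply: jumpfree_cobound => x; apply: square_HdR SC sqS.
- by apply: jumpfree_cobound => x; apply: even_HdR SC evS.
have {}SC : is_C (odd_shape d' p' q') (C S) by rewrite -SE.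
have [dd|dd] := eqVneq d d'; last first.
  by apply: jumpfree_cobound => x; apply: odd_HdR_neq SC dd.
rewrite -dd in SC SE; apply/(odd_jumpfree p q SC).
apply: contra_neq pqk => -[-> ->]; apply: h.
by exists m; rewrite -SE.
Qed.

Lemma contributesP d S : contributes A d S <->
  mult_neq0 A S /\ exists p q, S = odd_shape d p q.
Proof.
split=> [[zS mS [X [SX [h hX]]]]|[mS [p [q SE]]]].
  split=> //; case: zS => [evS|[d' [p [q SE]]]].
    by case: hX; apply: (HdR_eq0 X d).2 => x; apply: even_HdR SX evS.
  exists p, q; rewrite SE in SX; have [->//|dd] := eqVneq d d'.
  by case: hX; apply: (HdR_eq0 X d).2 => x; apply: odd_HdR_neq SX dd.
split=> //; first by right; exists d, p, q.
have [m [mA [z]]] := mS; have Ssh := multiplicities_shape mA z.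
have [_ [C [CC _]]] := mA; exists (C S); split; first exact: CC.
have := CC S Ssh; rewrite {1}SE => SC.
have [x Zx nBx] := odd_HdR SC.
exists (sq_class (dR_cocycle (C S) d) (dR_cobound (C S) d) x).
by move/(sq_class_eq _ Zx (sub0 _)); rewrite subr0.
Qed.

(** The length determines k only up to reflection in d; the side on which the second total degree
    lies removes the ambiguity. *)
Lemma odd_shape_length d p q k : p + q = k <->
  #|` odd_shape d p q| = (2 * absz (d - k)%R + 1)%N /\
  (forall x : int * int, x \in odd_shape d p q ->
     x.1 + x.2 = d \/ x.1 + x.2 = d + sgz (d - k)).
Proof.
rewrite card_odd_shape; split=> [<-|[cardE degE]].
  split=> [|[x y]]; first by lia.
  by rewrite mem_odd_shape /=; case: ifP; lia.
have [pq|pq] := eqVneq (p + q) d; first by lia.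
have [pqd|pqd] := ltP (p + q) d.
  (* A bidegree of total degree d + 1; in the other case (d - q, q - 1) has total degree d - 1. *)
  have /degE /= : (p + 1, d - p) \in odd_shape d p q.
    by rewrite mem_odd_shape; case: ifP; lia.
  by lia.
have /degE /= : (d - q, q - 1) \in odd_shape d p q.
  by rewrite mem_odd_shape; case: ifP; lia.
by lia.
Qed.

Lemma odd_contributes d k :
  (forall p q, mult_neq0 A (odd_shape d p q) -> p + q = k) <->
  (forall S, contributes A d S ->
     #|` S| = (2 * absz (d - k)%R + 1)%N /\
     (forall x : int * int, x \in S ->
        x.1 + x.2 = d \/ x.1 + x.2 = d + sgz (d - k))).
Proof.
split=> [h S /contributesP[mS [p [q SE]]]|h p q mS].
  by rewrite SE; apply/odd_shape_length/h; rewrite -SE.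
apply/(odd_shape_length d); apply: h; apply/contributesP; split=> //.
by exists p, q.
Qed.

End Multiplicities.

Theorem theorem3 (K : fieldType) (A : dcomplex K) (A_bounded : bounded A) :
  (forall r : nat, (1 <= r)%N ->
     (ss_degenerates (filt1 A) r /\ ss_degenerates (filt2 A) r) <->
     (forall S : {fset int * int}, is_even_zigzag S -> mult_neq0 A S ->
        (#|` S| < 2 * r)%N)) /\
  (forall d k : int,
     (pure_hodge A d k <->
      (forall p q : int, mult_neq0 A (odd_shape d p q) -> p + q = k)) /\
     ((forall p q : int, mult_neq0 A (odd_shape d p q) -> p + q = k) <->
      (forall S : {fset int * int}, contributes A d S ->
         #|` S| = (2 * absz (d - k)%R + 1)%N /\
         (forall x : int * int, x \in S ->
            x.1 + x.2 = d \/ x.1 + x.2 = d + sgz (d - k))))) /\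
  (forall d p q : int,
     (d <= p + q -> forall h : HdR A d,
        Hpq A d p q h <->
        (forall j : int, d - q <= j <= p ->
           exists w : A, dc_comp A j (d - j) w /\ dR_represents d w h)) /\
     (p + q <= d -> forall h : HdR A d,
        Hpq A d p q h <->
        (exists w : int -> A,
           (forall j : int, p <= j <= d - q -> dc_comp A j (d - j) (w j)) /\
           dR_represents d (\sum_(j <- zrange p (d - q)) w j) h))) /\
  (forall r : nat, (1 <= r)%N ->
     (forall p q : int, fin_dim (sub_full (froelicher1 A r p q))) ->
     (forall p q : int, fin_dim (sub_full (froelicher2 A r p q))) ->
     (forall m : int, fin_dim (sub_full (HdR A m))) ->
     (ss_degenerates (filt1 A) r /\ ss_degenerates (filt2 A) r) <->
     (\sum_(x \in [set: int * int]) sdim (sub_full (froelicher1 A r x.1 x.2)) =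
        \sum_(m \in [set: int]) betti A m /\
      \sum_(x \in [set: int * int]) sdim (sub_full (froelicher2 A r x.1 x.2)) =
        \sum_(m \in [set: int]) betti A m)) /\
  (forall d k : int, fin_dim (sub_full (HdR A d)) ->
     pure_hodge A d k <->
     betti A d = \sum_(p \in [set: int]) hodge_number A d p (k - p)).
Proof.
split; first by move=> r; apply: degenerates_even.
split.
  by move=> d k; split; [apply: pure_hodge_odd|apply: odd_contributes].
split; first by move=> d p q; split=> pq h; [apply: Hpq_ge|apply: Hpq_le].
split; last exact: pure_hodge_dim.
move=> r r1 fin1 fin2 finH.
by rewrite (degenerates1_dim A_bounded r1 fin1 finH)
  (degenerates2_dim A_bounded r1 fin2 finH).
Qed.
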